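(* Let $k\in\mathbb{N}$, $t\in(0,1)$ and $L>0$, and let $\Omega^k_{t,L}$ and $\Xi_1$ be the class of operators and the (set-valued) problem function defined in the context. Then $\{\Xi_1,\Omega^k_{t,L}\}\in\Delta_1$. In other words, for all $n\in\mathbb{N}$ there exists a general tower using radicals, $\Gamma_n$, such that for all $T\in\Omega^k_{t,L}$, $$\mathrm{dist}(\Gamma_n(T),\Xi_1(T))\le2^{-n}.$$
   Context: Operators act on $l^2(\mathbb{N})$ with canonical basis $\{e_j\}$; $P_m$ is the orthogonal projection onto $\mathrm{span}\{e_1,\dots,e_m\}$; $\chi_S(T)$ is the spectral projection of a normal $T$ (with $\chi_\lambda=\chi_{\{\lambda\}}$). Subspace angle: for closed subspaces with orthogonal projections $E,F$, $\hat\delta=\|E-F\|$ and $\phi\in[0,\pi/2]$ with $\sin\phi=\hat\delta$. $Q$-sequence: for invertible $T$, $T_0=T$, $T_{m-1}=Q^{(m)}R^{(m)}$ (QR decomposition: $Q^{(m)}$ unitary, $R^{(m)}$ upper triangular), $T_m=R^{(m)}Q^{(m)}$, and $Q_n=Q^{(1)}\cdots Q^{(n)}$. The class $\Omega^k_{t,L}$ consists of the invertible normal operators $T$ on $l^2(\mathbb{N})$ with $\|T\|\le L$ such that: 1. $\sigma(T)=\omega\cup\Psi$ with $\omega\cap\Psi=\emptyset$, $\omega=\{\lambda_i\}_{i=1}^N$, where the $\lambda_i$ are isolated eigenvalues of multiplicity $m_i$ with $|\lambda_1|>\dots>|\lambda_N|$, all $m_i$ except possibly $m_N$ are finite, $\rho(T):=\sup\{|z|:z\in\Psi\}<|\lambda_N|$,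 and $m_1+\dots+m_{N-1}<k\le M:=m_1+\dots+m_N\in\mathbb{N}\cup\{\infty\}$. 2. If $m_1+\dots+m_l<k$ then $\{\chi_{\{\lambda_1,\dots,\lambda_l\}}(T)e_j\}_{j=1}^{m_1+\dots+m_l}$ are linearly independent; also $\{\chi_{\{\lambda_1,\dots,\lambda_N\}}(T)e_j\}_{j=1}^k$ are linearly independent. 3. We have access to increasing functions $g^j:\mathbb{N}\to\mathbb{N}$ ($j\in\mathbb{N}$) such that the infinite matrix $T_{(j)}$ with columns $\{P_{g^j(n)}Te_n\}_{n\in\mathbb{N}}$ is invertible and $\|(P_{g^j(n)}-I)Te_n\|\le1/j$ for all $n\in\mathbb{N}$. 4. $r(T)\le t$ and $\tan(\Phi(T,\{e_j\}_{j=1}^k))\le L$, where $r(T)=\max\{|\lambda_2/\lambda_1|,\dots,|\lambda_N/\lambda_{N-1}|,\rho(T)/|\lambda_N|\}$ and $$\Phi(T,\{e_j\}_{j=1}^k)=\sup_{l=1,\dots,N}\phi\Big(\bigoplus_{i=1}^lE_i,\ \mathrm{span}\{e_j\}_{j=1}^{\min\{m_1+\dots+m_l,k\}}\Big).$$ Here $E_i=\ker(T-\lambda_iI)$ for $i<N$ and $E_N\subset\ker(T-\lambda_NI)$ is the subspace (depending on $k$ and the $e_j$; it exists because $T$ is invertible and normal, $\sigma(T)=\{\lambda_i\}_{i=1}^N\cup\Psi$ is a disjoint union with the $\lambda_i$ isolated eigenvalues of multiplicity $m_i$ satisfying $|\lambda_1|>\dots>|\lambda_N|>\sup\{|z|:z\in\Psi\}$,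 with $m_1+\dots+m_{N-1}<k\le m_1+\dots+m_N$, and because $\{\chi_{\{\lambda_1,\dots,\lambda_l\}}(T)e_j\}_{j=1}^{m_1+\dots+m_l}$ for each $l<N$ and $\{\chi_{\{\lambda_1,\dots,\lambda_N\}}(T)e_j\}_{j=1}^k$ are linearly independent) such that $\hat\delta\big(\bigoplus_{i=1}^lE_i,\mathrm{span}\{Q_ne_j\}_{j=1}^{\min\{m_1+\dots+m_l,k\}}\big)\to0$ as $n\to\infty$ for $l=1,\dots,N$, with $\{Q_n\}$ a $Q$-sequence of $T$. Problem function: $\Xi_1(T)\subset\mathcal{M}=\mathbb{C}^k\times(l^2(\mathbb{N}))^k$ is the set of all elements $$(\underbrace{\lambda_1,\dots,\lambda_1}_{m_1},\dots,\underbrace{\lambda_N,\dots,\lambda_N}_{k-(m_1+\dots+m_{N-1})})\times(\hat q_1,\dots,\hat q_k)$$ such that $\{\hat q_j\}_{j=m_1+\dots+m_{l-1}+1}^{m_1+\dots+m_l}$ is an orthonormal basis of $\mathrm{ran}(\chi_{\lambda_l}(T))$ for $l<N$ and $\{\hat q_j\}_{j=m_1+\dots+m_{N-1}+1}^k$ is an orthonormal basis of a subspace of $\mathrm{ran}(\chi_{\lambda_N}(T))$. $\mathcal{M}$ carries the product metric $d_{\mathcal{M}}$ (sum of the distances of the components), and $\mathrm{dist}(x,\Xi_1(T))=\inf_{y\in\Xi_1(T)}d_{\mathcal{M}}(x,y)$ for $x\in\mathcal{M}$. Algorithms: the evaluations available on an input $T$ are the matrix entries $\langle Te_j,e_i\rangle$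 and the values $g^j(n)$; $k,t,L$ are known. A general algorithm is a map $\Gamma:\Omega\to\mathcal{M}$ such that for each $T$ there is a finite set $\Lambda_\Gamma(T)$ of evaluations on which alone $\Gamma(T)$ depends, and such that $\Lambda_\Gamma(B)=\Lambda_\Gamma(T)$ whenever $B$ agrees with $T$ on $\Lambda_\Gamma(T)$. It is radical (''using radicals'') if its action consists of finitely many arithmetic operations, comparisons and extractions of square roots of positive numbers on these evaluations. $\{\Xi,\Omega\}\in\Delta_1$ means there is a sequence $\{\Gamma_n\}$ of radical general algorithms with $\mathrm{dist}(\Gamma_n(T),\Xi(T))\le2^{-n}$ for all $T\in\Omega$ and $n\in\mathbb{N}$. *)

(* Defs.v *)
From HB Require Import structures.
From mathcomp Require Import all_boot all_order all_algebra.
From mathcomp Require Import all_classical all_reals all_analysis.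
From mathcomp Require Import complex ring.
Set Implicit Arguments.
Unset Strict Implicit.
Unset Printing Implicit Defensive.
Import Order.TTheory GRing.Theory Num.Theory.
Import numFieldNormedType.Exports.
Import ComplexField.Normc.
Local Open Scope classical_set_scope.
Local Open Scope complex_scope.
Local Open Scope ring_scope.

(* l^2(N) over C = R[i]. All indices start at 0: the canonical basis is
   ebasis 0, ebasis 1, ... *)

Definition square_summable (R : realType) (u : nat -> R[i]) : Prop :=
  cvgn (series (fun n => normc (u n) ^+ 2)).

Definition sqsum (R : realType) : {pred nat -> R[i]} :=
  fun u => `[< square_summable u >].

Lemma normcE2 (R : realType) (a : R[i]) :
  normc a ^+ 2 = complex.Re a ^+ 2 + complex.Im a ^+ 2.
Proof. by case: a => x y /=; rewrite sqr_sqrtr// addr_ge0// sqr_ge0. Qed.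

Lemma normc_sqrD (R : realType) (a b : R[i]) :
  normc (a + b) ^+ 2 <= 2 * (normc a ^+ 2 + normc b ^+ 2).
Proof.
rewrite !normcE2; case: a b => [x y] [z w] /=.
rewrite -subr_ge0 (_ : _ - _ = (x - z) ^+ 2 + (y - w) ^+ 2).
  by rewrite addr_ge0// sqr_ge0.
by rewrite !sqrrB !sqrrD mulrDr !mulrDl !mul1r !mulr2n; ring.
Qed.

Lemma sqsum_submod_closed (R : realType) : submod_closed (@sqsum R).
Proof.
split.
  apply/asboolP; rewrite /square_summable.
  rewrite (_ : series _ = fun=> 0); first exact: is_cvg_cst.
  apply/funext => n; rewrite /series /= big1// => i _.
  by rewrite !expr0n /= addr0 sqrtr0 expr0n.
move=> a u v /asboolP su /asboolP sv; apply/asboolP.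
have s2 : cvgn (series (fun n =>
    2 * (normc a ^+ 2 * normc (u n) ^+ 2 + normc (v n) ^+ 2))).
  rewrite (_ : series _ = fun n => 2 * (normc a ^+ 2 *
      series (fun n => normc (u n) ^+ 2) n + series (fun n => normc (v n) ^+ 2) n)).
    by apply: is_cvgMr; apply: is_cvgD => //; apply: is_cvgMr.
  by apply/funext => n; rewrite /series /= mulr_sumr -big_split /= mulr_sumr.
apply: series_le_cvg s2 => [n|n|n].
- exact: sqr_ge0.
- by apply: mulr_ge0 => //; apply: addr_ge0; [apply: mulr_ge0|]; exact: sqr_ge0.
- by rewrite (le_trans (normc_sqrD _ _))// normcM exprMn.
Qed.

HB.instance Definition _ (R : realType) :=
  GRing.isSubmodClosed.Build R[i] (nat -> R[i]) (@sqsum R)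
    (sqsum_submod_closed R).

Record l2 (R : realType) := L2 {
  l2seq :> nat -> R[i];
  l2P : l2seq \in @sqsum R }.

HB.instance Definition _ (R : realType) := [isSub for @l2seq R].
HB.instance Definition _ (R : realType) := [Choice of l2 R by <:].
HB.instance Definition _ (R : realType) :=
  [SubChoice_isSubLmodule of l2 R by <:].

Lemma ebasis_subproof (R : realType) (j : nat) :
  (fun i => (i == j)%:R : R[i]) \in @sqsum R.
Proof.
apply/asboolP; rewrite /square_summable.
apply: (@is_cvg_near_cst _ _ (1 : R)); near=> n.
have jn : (j < n)%N by near: n; exact: nbhs_infty_gt.
rewrite /series /= big_mkord (bigD1 (Ordinal jn))//= eqxx normc1 expr1n big1 ?addr0//.
by move=> i; rewrite -val_eqE /= => /negPf ->; rewrite normc0 expr0n.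
Unshelve. all: by end_near. Qed.

Definition ebasis (R : realType) (j : nat) : l2 R := L2 (ebasis_subproof R j).

(* The series below converges (Cauchy-Schwarz); it is split into real and
   imaginary parts because limits are taken in R. *)
Definition inner (R : realType) (u v : l2 R) : R[i] :=
  limn (series (fun n => complex.Re (u n * (v n)^* ))) +i*
  limn (series (fun n => complex.Im (u n * (v n)^* ))).

Definition l2norm (R : realType) (u : l2 R) : R :=
  Num.sqrt (complex.Re (inner u u)).

Definition lin_subspace (R : realType) (V : set (l2 R)) : Prop :=
  V 0 /\ forall (a : R[i]) u v, V u -> V v -> V (a *: u + v).

Definition closed_subspace (R : realType) (V : set (l2 R)) : Prop :=
  lin_subspace V /\
  forall (u : nat -> l2 R) (x : l2 R), (forall n, V (u n)) ->
    l2norm (u n - x) @[n --> \oo] --> (0 : R) -> V x.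

Definition lin_indep (R : realType) (s : nat) (v : nat -> l2 R) : Prop :=
  forall c : 'I_s -> R[i], \sum_(i < s) c i *: v i = 0 -> forall i, c i = 0.

Definition lspan (R : realType) (s : nat) (v : nat -> l2 R) : set (l2 R) :=
  [set \sum_(i < s) c i *: v i | c in [set: 'I_s -> R[i]]].

Definition sum_subspaces (R : realType) (l : nat) (E : nat -> set (l2 R)) :
    set (l2 R) :=
  [set x | exists2 y : nat -> l2 R,
     (forall i, (i < l)%N -> E i (y i)) & x = \sum_(i < l) y i].

(* None stands for infinity *)
Definition has_dim (R : realType) (V : set (l2 R)) (d : option nat) : Prop :=
  match d with
  | Some d => exists2 v : nat -> l2 R, lin_indep d v & V = lspan d v
  | None => forall d, exists2 v : nat -> l2 R, lin_indep d v & lspan d v `<=` V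
  end.

(* the vectors q j with a <= j < b form an orthonormal basis of V *)
Definition orthonormal_basis (R : realType) (k : nat) (q : 'I_k -> l2 R)
    (a b : nat) (V : set (l2 R)) : Prop :=
  (forall i j : 'I_k, (a <= i < b)%N -> (a <= j < b)%N ->
     inner (q i) (q j) = (i == j)%:R) /\
  V = [set \sum_(j < k | (a <= j < b)%N) c j *: q j | c in [set: 'I_k -> R[i]]].

Definition bounded_op (R : realType) (T : l2 R -> l2 R) : Prop :=
  linear T /\ exists C : R, forall x, l2norm (T x) <= C * l2norm x.

Definition opnorm (R : realType) (T : l2 R -> l2 R) : R :=
  sup [set l2norm (T x) | x in [set x | l2norm x <= 1]].

Definition invertible (R : realType) (T : l2 R -> l2 R) : Prop :=
  exists S, [/\ bounded_op S, cancel T S & cancel S T].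

Definition adjoint (R : realType) (T S : l2 R -> l2 R) : Prop :=
  forall x y, inner (T x) y = inner x (S y).

Definition normal_op (R : realType) (T : l2 R -> l2 R) : Prop :=
  exists S, [/\ bounded_op S, adjoint T S & T \o S =1 S \o T].

Definition unitary_op (R : realType) (U : l2 R -> l2 R) : Prop :=
  bounded_op U /\
  exists V, [/\ bounded_op V, adjoint U V, cancel U V & cancel V U].

Definition orth_projector (R : realType) (P : l2 R -> l2 R) : Prop :=
  [/\ bounded_op P, P \o P =1 P & adjoint P P].

Definition orth_proj (R : realType) (V : set (l2 R)) (x : l2 R) : l2 R :=
  xget 0 [set y | V y /\ forall z, V z -> inner (x - y) z = 0].

Definition Pm (R : realType) (m : nat) : l2 R -> l2 R :=
  orth_proj (lspan m (ebasis R)).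

Definition delta (R : realType) (V W : set (l2 R)) : R :=
  opnorm (fun x => orth_proj V x - orth_proj W x).

Definition angle (R : realType) (V W : set (l2 R)) : R := asin (delta V W).

Definition spectrum (R : realType) (T : l2 R -> l2 R) : set R[i] :=
  [set z | ~ invertible (fun x => T x - z *: x)].

Definition eigspace (R : realType) (T : l2 R -> l2 R) (z : R[i]) :
    set (l2 R) := [set x | T x = z *: x].

Definition isolated_eigenvalue (R : realType) (T : l2 R -> l2 R) (z : R[i]) :
    Prop :=
  (exists2 x, eigspace T z x & x != 0) /\
  exists2 eps : R, 0 < eps &
    forall w, spectrum T w -> normc (w - z) < eps -> w = z.

(* C as a measurable space: R^2 with its Borel sets *)
Definition plane (R : realType) :=
  (measurableTypeR R * measurableTypeR R)%type.

Definition to_plane (R : realType) (S : set R[i]) : set (plane R) :=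
  [set p | S (p.1 +i* p.2)].

(* E is the spectral measure of T: a projection-valued measure on the Borel
   sets of C, concentrated on the spectrum, with T = \int z dE(z). *)
Definition spectral_measure (R : realType) (T : l2 R -> l2 R)
    (E : set (plane R) -> l2 R -> l2 R) : Prop :=
  [/\ forall A, measurable A -> orth_projector (E A),
      E (to_plane (spectrum T)) =1 id,
      forall A B, measurable A -> measurable B ->
        E (A `&` B) =1 E A \o E B
    & forall x, exists mu : {measure set (plane R) -> \bar R},
        [/\ forall A, measurable A -> mu A = (complex.Re (inner (E A x) x))%:E,
            complex.Re (inner (T x) x) = Rintegral mu setT (fun p => p.1)
          & complex.Im (inner (T x) x) = Rintegral mu setT (fun p => p.2)]].

(* chi_S(T); the spectral theorem provides the measure for a normal T *)
Definition chi (R : realType) (T : l2 R -> l2 R) (S : set R[i]) :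
    l2 R -> l2 R :=
  xget (fun _ _ => 0) (spectral_measure T) (to_plane S).

Definition upper_triangular (R : realType) (T : l2 R -> l2 R) : Prop :=
  forall i j, (j < i)%N -> inner (T (ebasis R j)) (ebasis R i) = 0.

Definition Q_sequence (R : realType) (T : l2 R -> l2 R)
    (Q : nat -> l2 R -> l2 R) : Prop :=
  exists Ts Us Rs : nat -> l2 R -> l2 R,
  [/\ Ts 0%N =1 T,
      forall m, [/\ unitary_op (Us m.+1), bounded_op (Rs m.+1),
                    upper_triangular (Rs m.+1),
                    Ts m =1 Us m.+1 \o Rs m.+1
                  & Ts m.+1 =1 Rs m.+1 \o Us m.+1],
      Q 0%N =1 id
    & forall n, Q n.+1 =1 Q n \o Us n.+1].

(* An input is an operator T together with the functions g: the value g^j(n)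
   for j, n >= 1 is g (j - 1) (n - 1). *)
Definition input (R : realType) : Type :=
  ((l2 R -> l2 R) * (nat -> nat -> nat))%type.

(* Multiplicities m_1, ..., m_N are m 0, ..., m (N - 1), with None for
   infinity. *)
Definition all_finite (m : nat -> option nat) (l : nat) : bool :=
  [forall i : 'I_l, isSome (m i)].

(* m_1 + ... + m_l when these are finite *)
Definition mult_sum (m : nat -> option nat) (l : nat) : nat :=
  (\sum_(i < l) odflt 0 (m i))%N.

(* min {m_1 + ... + m_l, k} *)
Definition cutoff (k : nat) (m : nat -> option nat) (l : nat) : nat :=
  if all_finite m l then minn (mult_sum m l) k else k.

Definition omega (R : realType) (N : nat) (lam : nat -> R[i]) : set R[i] :=
  [set lam i | i in `I_N].

(* rho(T), with rho(T) = 0 when Psi is empty *)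
Definition rho (R : realType) (T : l2 R -> l2 R) (N : nat)
    (lam : nat -> R[i]) : R :=
  sup [set normc z | z in spectrum T `\` omega N lam].

Definition dominant_part (R : realType) (T : l2 R -> l2 R) (k N : nat)
    (lam : nat -> R[i]) (m : nat -> option nat) : Prop :=
  [/\ (0 < N)%N,
      forall i, (i < N)%N -> isolated_eigenvalue T (lam i) /\
        has_dim (eigspace T (lam i)) (m i),
      forall i, (i.+1 < N)%N -> normc (lam i.+1) < normc (lam i) /\ isSome (m i),
      rho T N lam < normc (lam N.-1)
    & (mult_sum m N.-1 < k)%N /\ (all_finite m N -> (k <= mult_sum m N)%N)].

Definition independence (R : realType) (T : l2 R -> l2 R) (k N : nat)
    (lam : nat -> R[i]) (m : nat -> option nat) : Prop :=
  (forall l, (0 < l <= N)%N -> all_finite m l -> (mult_sum m l < k)%N ->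
     lin_indep (mult_sum m l) (fun j => chi T (omega l lam) (ebasis R j))) /\
  lin_indep k (fun j => chi T (omega N lam) (ebasis R j)).

Definition access (R : realType) (T : l2 R -> l2 R) (g : nat -> nat -> nat) :
    Prop :=
  forall j,
  [/\ {homo g j : a b / (a <= b)%N},
      exists Tj, [/\ bounded_op Tj, invertible Tj
                   & forall n, Tj (ebasis R n) = Pm (g j n) (T (ebasis R n))]
    & forall n, l2norm (Pm (g j n) (T (ebasis R n)) - T (ebasis R n)) <= j.+1%:R^-1].

Definition rate (R : realType) (T : l2 R -> l2 R) (N : nat)
    (lam : nat -> R[i]) : R :=
  Num.max (\big[Num.max/0]_(i < N.-1) normc (lam i.+1 / lam i))
          (rho T N lam / normc (lam N.-1)).

Definition Espace (R : realType) (T : l2 R -> l2 R) (N : nat)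
    (lam : nat -> R[i]) (EN : set (l2 R)) (i : nat) : set (l2 R) :=
  if i == N.-1 then EN else eigspace T (lam i).

Definition is_EN (R : realType) (T : l2 R -> l2 R) (k N : nat)
    (lam : nat -> R[i]) (m : nat -> option nat) (EN : set (l2 R)) : Prop :=
  [/\ closed_subspace EN, EN `<=` eigspace T (lam N.-1)
    & exists2 Q, Q_sequence T Q &
        forall l, (0 < l <= N)%N ->
          delta (sum_subspaces l (Espace T N lam EN))
                (lspan (cutoff k m l) (fun j => Q n (ebasis R j)))
            @[n --> \oo] --> (0 : R)].

Definition Phi (R : realType) (T : l2 R -> l2 R) (k N : nat)
    (lam : nat -> R[i]) (m : nat -> option nat) (EN : set (l2 R)) : R :=
  sup [set angle (sum_subspaces l (Espace T N lam EN))
                 (lspan (cutoff k m l) (ebasis R))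
      | l in [set l | (0 < l <= N)%N]].

(* In the last clause the angle Phi = pi / 2, whose tangent is infinite, has to
   be excluded explicitly: tan is total, with tan (pi / 2) = 0. *)
Definition Omega (R : realType) (k : nat) (t L : R) : set (input R) :=
  [set inp | let: (T, g) := inp in
    [/\ bounded_op T, invertible T, normal_op T, opnorm T <= L & access T g] /\
    exists N lam m,
    [/\ dominant_part T k N lam m, independence T k N lam m, rate T N lam <= t
      & exists2 EN, is_EN T k N lam m EN &
          Phi T k N lam m EN < pi / 2 /\ tan (Phi T k N lam m EN) <= L]].

Definition Mspace (R : realType) (k : nat) : Type :=
  (('I_k -> R[i]) * ('I_k -> l2 R))%type.

Definition distM (R : realType) (k : nat) (x y : Mspace R k) : R :=
  \sum_(j < k) normc (x.1 j - y.1 j) + \sum_(j < k) l2norm (x.2 j - y.2 j).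

(* With 0-based l, the l-th block of indices is cutoff l <= j < cutoff l.+1,
   the last block being cut at k. *)
Definition Xi1 (R : realType) (k : nat) (inp : input R) : set (Mspace R k) :=
  let T := inp.1 in
  [set y | exists N lam m, dominant_part T k N lam m /\
    forall l, (l < N)%N ->
    [/\ forall j : 'I_k, (cutoff k m l <= j < cutoff k m l.+1)%N -> y.1 j = lam l,
        (l.+1 < N)%N ->
          orthonormal_basis y.2 (cutoff k m l) (cutoff k m l.+1)
            (range (chi T [set lam l]))
      & l.+1 = N -> exists V,
          [/\ lin_subspace V, V `<=` range (chi T [set lam l])
            & orthonormal_basis y.2 (cutoff k m l) k V]]].

(* an extended real, so that the distance to the empty set is +oo *)
Definition dist (R : realType) (k : nat) (x : Mspace R k)
    (S : set (Mspace R k)) : \bar R :=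
  ereal_inf [set (distM x y)%:E | y in S].

Inductive evaluation := EntryEv of nat & nat | GEv of nat & nat.

Definition eval_at (R : realType) (q : evaluation) (inp : input R) : R[i] :=
  match q with
  | EntryEv i j => inner (inp.1 (ebasis R j)) (ebasis R i)
  | GEv j n => (inp.2 j n)%:R
  end.

Definition general_algorithm (R : realType) (k : nat) (Om : set (input R))
    (Gamma : input R -> Mspace R k) (Lambda : input R -> set evaluation) :
    Prop :=
  forall T, Om T -> finite_set (Lambda T) /\
    forall B, Om B -> (forall q, Lambda T q -> eval_at q B = eval_at q T) ->
      Gamma B = Gamma T /\ Lambda B = Lambda T.

(* A radical algorithm is a decision tree. It stores real numbers in a list of
   registers, which grows at its end; an instruction refers to registers by
   their positions in this list. The next instruction is determined by the
   discrete observations made so far, namely the outcomes of comparisons and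
   the natural numbers g^j(n). *)
Inductive instruction (k : nat) :=
| IEntry of nat & nat      (* store the real and imaginary parts of <T e_j, e_i> *)
| IGval of nat & nat       (* observe g^j(n) *)
| IConst of rat
| IAdd of nat & nat
| ISub of nat & nat
| IMul of nat & nat
| IDiv of nat & nat
| ISqrt of nat
| ICompare of nat & nat    (* observe whether r_a <= r_b *)
| IHalt of 'I_k -> nat * nat & 'I_k -> seq (nat * nat).

Definition creg (R : realType) (r : seq R) (p : nat * nat) : R[i] :=
  r`_p.1 +i* r`_p.2.

(* The result consists of k complex numbers and of k finitely supported vectors
   given by their first coordinates. *)
Definition output (R : realType) (k : nat) (r : seq R)
    (lam : 'I_k -> nat * nat) (q : 'I_k -> seq (nat * nat)) : Mspace R k :=
  (fun j => creg r (lam j),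
   fun j => \sum_(i < size (q j)) creg r (nth (0, 0)%N (q j) i) *: ebasis R i).

(* runs ctrl inp h r qs y: from the history h of observations and the registers
   r, the tree ctrl halts on inp after finitely many steps with result y, having
   made the evaluations qs. An instruction without observation adds 0 to the
   history. Divisions by 0 and square roots of nonpositive numbers are blocked. *)
Inductive runs (R : realType) (k : nat) (ctrl : seq nat -> instruction k)
    (inp : input R) :
    seq nat -> seq R -> seq evaluation -> Mspace R k -> Prop :=
| RunEntry h (r : seq R) qs y i j of ctrl h = IEntry k i j
    & runs ctrl inp (rcons h 0%N)
        (r ++ [:: complex.Re (eval_at (EntryEv i j) inp);
                  complex.Im (eval_at (EntryEv i j) inp)]) qs y :
    runs ctrl inp h r (EntryEv i j :: qs) y
| RunGval h (r : seq R) qs y j n of ctrl h = IGval k j n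
    & runs ctrl inp (rcons h (inp.2 j n)) r qs y :
    runs ctrl inp h r (GEv j n :: qs) y
| RunConst h (r : seq R) qs y c of ctrl h = IConst k c
    & runs ctrl inp (rcons h 0%N) (rcons r (ratr c)) qs y :
    runs ctrl inp h r qs y
| RunAdd h (r : seq R) qs y a b of ctrl h = IAdd k a b
    & runs ctrl inp (rcons h 0%N) (rcons r (r`_a + r`_b)) qs y :
    runs ctrl inp h r qs y
| RunSub h (r : seq R) qs y a b of ctrl h = ISub k a b
    & runs ctrl inp (rcons h 0%N) (rcons r (r`_a - r`_b)) qs y :
    runs ctrl inp h r qs y
| RunMul h (r : seq R) qs y a b of ctrl h = IMul k a b
    & runs ctrl inp (rcons h 0%N) (rcons r (r`_a * r`_b)) qs y :
    runs ctrl inp h r qs y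
| RunDiv h (r : seq R) qs y a b of ctrl h = IDiv k a b & r`_b != 0
    & runs ctrl inp (rcons h 0%N) (rcons r (r`_a / r`_b)) qs y :
    runs ctrl inp h r qs y
| RunSqrt h (r : seq R) qs y a of ctrl h = ISqrt k a & 0 < r`_a
    & runs ctrl inp (rcons h 0%N) (rcons r (Num.sqrt r`_a)) qs y :
    runs ctrl inp h r qs y
| RunCompare h (r : seq R) qs y a b of ctrl h = ICompare k a b
    & runs ctrl inp (rcons h (nat_of_bool (r`_a <= r`_b))) r qs y :
    runs ctrl inp h r qs y
| RunHalt h (r : seq R) lam q of ctrl h = IHalt lam q :
    runs ctrl inp h r [::] (output r lam q).

(* params are the known real parameters, available from the start *)
Definition radical_algorithm (R : realType) (k : nat) (params : seq R)
    (Om : set (input R)) (Gamma : input R -> Mspace R k) : Prop :=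
  exists2 Lambda, general_algorithm Om Gamma Lambda &
    exists ctrl : seq nat -> instruction k, forall T, Om T ->
      exists2 qs, runs ctrl T [::] params qs (Gamma T)
                & Lambda T = [set q | List.In q qs].

Definition Delta1 (R : realType) (k : nat) (params : seq R)
    (Xi : input R -> set (Mspace R k)) (Om : set (input R)) : Prop :=
  exists Gamma : nat -> input R -> Mspace R k, forall n,
    radical_algorithm params Om (Gamma n) /\
    forall T, Om T -> (dist (Gamma n T) (Xi T) <= (2 ^- n)%:E)%E.

(* Main.v *)
Require Import Defs.
From HB Require Import structures.
From mathcomp Require Import all_boot all_order all_algebra.
From mathcomp Require Import all_classical all_reals all_analysis.
From mathcomp Require Import complex ring lra zify.
Set Implicit Arguments.
Unset Strict Implicit.
Unset Printing Implicit Defensive.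
Import Order.TTheory GRing.Theory Num.Theory.
Import numFieldNormedType.Exports.
Import ComplexField.Normc.
Local Open Scope classical_set_scope.
Local Open Scope complex_scope.
Local Open Scope ring_scope.

(* The control of a radical algorithm is an arbitrary function of the history of
   observations, so that it can interrogate the input by a fixed schedule
   (reading entries, comparing them with rationals, reading the functions g) and
   halt as soon as some rational point is a correct answer for every operator of
   the class that is compatible with the history. Correctness is then automatic,
   and termination amounts to a stability statement: every T in the class has a
   point y such that y is close to Xi1 B for all B in the class agreeing with T
   on enough entries, up to a small error, and on enough values of g.

   By the truncation bounds such B converge strongly to T. Let q_j be the
   Gram-Schmidt vectors of T^n e_0, ..., T^n e_{k-1} for a large n; since q_j is
   a fixed combination of the T^n e_i, the same combination of the B^n e_i is
   close to q_j, and a small correction makes these vectors orthonormal. The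
   angle hypothesis on B bounds the component of e_j off the dominant spectral
   subspaces by L times the component inside, and the n-th power of B improves
   this to L t^n, uniformly in B. As the dimensions match, the j-th vector is
   then 2 L t^n-close to the eigenspace of its block, and another orthonormal
   correction inside the eigenspaces gives an element of Xi1 B close to
   (<T q_j, q_j>, q_j)_j.

   The spectral theorem is not needed: if T had no spectral measure, chi T would
   vanish, against the independence hypothesis. *)

(** * The Hilbert space structure of l2 *)

(** Nothing relates the block data [N], [lam], [m] of a nearby operator B to those of T, so no step
    compares the two spectra: only the vectors B^n e_j are compared with T^n e_j, and every spectral
    estimate takes place inside B. Hence n is fixed before B, from k, t, L and the error alone.
    Since T^n e_0, ..., T^n e_j span the same space as the first columns of Q_n, power iteration can
    stand in for the QR algorithm. There are two orthonormal corrections because a point of [Xi1 B]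
    has to be exactly orthonormal and to lie exactly in the eigenspaces. On the spectral side, the
    measure gives access to the quadratic form <Tx,x> only. That T commutes with the projections is
    recovered by varying the argument of the form, and a bound on the form bounds the norm only up
    to a factor 2. Such a factor would be raised to the n-th power and ruin t^n. It is removed by
    cutting the spectrum into small cells, on which T is almost scalar and whose ranges are
    orthogonal and invariant. *)

Local Notation Re := complex.Re.
Local Notation Im := complex.Im.

Section ComplexFacts.
Variable R : realType.
Implicit Types a b z : R[i].

Lemma ReD a b : Re (a + b) = Re a + Re b. Proof. by case: a b => ? ? []. Qed.
Lemma ImD a b : Im (a + b) = Im a + Im b. Proof. by case: a b => ? ? []. Qed.
Lemma ReN a : Re (- a) = - Re a. Proof. by case: a. Qed.
Lemma ImN a : Im (- a) = - Im a. Proof. by case: a. Qed.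
Lemma ReM a b : Re (a * b) = Re a * Re b - Im a * Im b.
Proof. by case: a b => ? ? []. Qed.
Lemma ImM a b : Im (a * b) = Re a * Im b + Im a * Re b.
Proof. by case: a b => ? ? []. Qed.
Lemma conjE a : a^* = conjc a. Proof. by []. Qed.
Lemma ReJ a : Re a^* = Re a. Proof. by rewrite conjE; case: a. Qed.
Lemma ImJ a : Im a^* = - Im a. Proof. by rewrite conjE; case: a. Qed.
Lemma ReC (x : R) : Re x%:C = x. Proof. by []. Qed.
Lemma ImC (x : R) : Im x%:C = 0. Proof. by []. Qed.
Definition RIE := (ReD, ImD, ReN, ImN, ReM, ImM, ReJ, ImJ).

Lemma complex_ext a b : Re a = Re b -> Im a = Im b -> a = b.
Proof. by case: a b => ? ? [? ?] /= -> ->. Qed.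

Lemma normc_ge0 a : 0 <= normc a. Proof. by case: a => x y; exact: sqrtr_ge0. Qed.

Lemma ler_normcD a b : normc (a + b) <= normc a + normc b.
Proof. exact: le_normcD. Qed.

Lemma normcJ a : normc a^* = normc a.
Proof. by rewrite conjE; case: a => x y /=; rewrite sqrrN. Qed.

Lemma normc_Re a : `|Re a| <= normc a.
Proof.
rewrite -(@ler_pXn2r _ 2)// ?nnegrE ?normc_ge0// normcE2 real_normK ?num_real//.
by rewrite lerDl sqr_ge0.
Qed.

Lemma normc_Im a : `|Im a| <= normc a.
Proof.
rewrite -(@ler_pXn2r _ 2)// ?nnegrE ?normc_ge0// normcE2 real_normK ?num_real//.
by rewrite lerDr sqr_ge0.
Qed.

Lemma normc_le_ReIm a : normc a <= `|Re a| + `|Im a|.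
Proof.
rewrite -(@ler_pXn2r _ 2)// ?nnegrE ?normc_ge0 ?addr_ge0// normcE2.
rewrite sqrrD !real_normK ?num_real// lerD2r lerDl.
by rewrite mulrn_wge0// mulr_ge0.
Qed.

Lemma normcR (x : R) : normc x%:C = `|x|.
Proof. by rewrite /= expr0n/= addr0 sqrtr_sqr. Qed.

Lemma normc_eq0 a : (normc a == 0) = (a == 0).
Proof. by apply/eqP/eqP => [/eq0_normc//|->]; exact: normc0. Qed.

End ComplexFacts.

Section Inner.
Variable R : realType.
Implicit Types u v w x y : l2 R.
Implicit Types a b : R[i].

Lemma l2_ext u v : (forall n, u n = v n) -> u = v.
Proof. by move=> h; apply: val_inj; apply/funext. Qed.

Lemma l2D u v n : (u + v) n = u n + v n. Proof. by []. Qed.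
Lemma l2Z a u n : (a *: u) n = a * u n. Proof. by []. Qed.
Lemma l2N u n : (- u) n = - u n. Proof. by []. Qed.
Lemma l2_sum (I : Type) (r : seq I) (P : pred I) (F : I -> l2 R) n :
  (\sum_(i <- r | P i) F i) n = \sum_(i <- r | P i) F i n.
Proof. by apply: (big_morph (fun u : l2 R => u n)). Qed.

Lemma ebasisE j n : ebasis R j n = (n == j)%:R. Proof. by []. Qed.

Lemma cvg_l2 u : cvgn (series (fun n => normc (u n) ^+ 2)).
Proof. by case: u => u /= /asboolP. Qed.
Arguments cvg_l2 : clear implicits.

Lemma cvg_series_le (f g : R ^nat) : (forall n, `|f n| <= g n) ->
  cvgn (series g) -> cvgn (series f).
Proof.
move=> fg cg; apply: normed_cvg; by apply: series_le_cvg cg => n /=; rewrite ?normr_ge0 ?(le_trans _ (fg n)).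
Qed.
Arguments cvg_series_le : clear implicits.

Lemma normc_mulJ_le a b : normc (a * b^*) <= normc a ^+ 2 + normc b ^+ 2.
Proof.
rewrite normcM normcJ; have := normc_ge0 a; have := normc_ge0 b; nra.
Qed.

Lemma cvg_inner_dom u v :
  cvgn (series (fun n => normc (u n) ^+ 2 + normc (v n) ^+ 2)).
Proof. by have := is_cvg_seriesD (cvg_l2 u) (cvg_l2 v). Qed.
Arguments cvg_inner_dom : clear implicits.

Lemma cvg_inner_Re u v : cvgn (series (fun n => Re (u n * (v n)^*))).
Proof.
apply: cvg_series_le _ _ _ (cvg_inner_dom u v) => n.
by rewrite (le_trans (normc_Re _))//= normc_mulJ_le.
Qed.
Arguments cvg_inner_Re : clear implicits.

Lemma cvg_inner_Im u v : cvgn (series (fun n => Im (u n * (v n)^*))).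
Proof.
apply: cvg_series_le _ _ _ (cvg_inner_dom u v) => n.
by rewrite (le_trans (normc_Im _))//= normc_mulJ_le.
Qed.
Arguments cvg_inner_Im : clear implicits.

Lemma lim_series_comb (f g : R^nat) (c d : R) :
  cvgn (series f) -> cvgn (series g) ->
  limn (series (fun n => c * f n + d * g n)) =
  c * limn (series f) + d * limn (series g).
Proof.
move=> cf cg; have h := lim_seriesD (is_cvg_seriesZ (k := c) cf) (is_cvg_seriesZ (k := d) cg).
by rewrite !lim_seriesZ in h.
Qed.

Lemma is_cvg_series_comb (f g : R^nat) (c d : R) :
  cvgn (series f) -> cvgn (series g) ->
  cvgn (series (fun n => c * f n + d * g n)).
Proof.
move=> cf cg.
by have := is_cvg_seriesD (is_cvg_seriesZ (k := c) cf) (is_cvg_seriesZ (k := d) cg).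
Qed.
Arguments is_cvg_series_comb : clear implicits.

Lemma Re_inner u v : Re (inner u v) = limn (series (fun n => Re (u n * (v n)^*))).
Proof. by []. Qed.
Lemma Im_inner u v : Im (inner u v) = limn (series (fun n => Im (u n * (v n)^*))).
Proof. by []. Qed.

Lemma innerP a u v w : inner (a *: u + v) w = a * inner u w + inner v w.
Proof.
have key (f g h : R^nat) (c d : R) : cvgn (series f) -> cvgn (series g) ->
    cvgn (series h) ->
    limn (series (fun n => 1 * (c * f n + d * g n) + 1 * h n)) =
    c * limn (series f) + d * limn (series g) + limn (series h).
  move=> cf cg ch.
  rewrite (lim_series_comb 1 1 (is_cvg_series_comb f g c d cf cg) ch).
  by rewrite (lim_series_comb c d cf cg) !mul1r.
apply: complex_ext; rewrite !RIE !Re_inner !Im_inner.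
- rewrite (_ : (fun n => _) = fun n => 1 * (Re a * Re (u n * (w n)^*) +
     (- Im a) * Im (u n * (w n)^*)) + 1 * Re (v n * (w n)^*)); last first.
    by apply/funext => n; rewrite l2D l2Z !RIE; ring.
  rewrite (key _ _ _ _ _ (cvg_inner_Re u w) (cvg_inner_Im u w) (cvg_inner_Re v w)).
  by rewrite mulNr.
- rewrite (_ : (fun n => _) = fun n => 1 * (Re a * Im (u n * (w n)^*) +
     Im a * Re (u n * (w n)^*)) + 1 * Im (v n * (w n)^*)); last first.
    by apply/funext => n; rewrite l2D l2Z !RIE; ring.
  by rewrite (key _ _ _ _ _ (cvg_inner_Im u w) (cvg_inner_Re u w) (cvg_inner_Im v w)).
Qed.

Lemma innerC u v : inner v u = (inner u v)^*.
Proof.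
apply: complex_ext; rewrite ?RIE.
  by rewrite !Re_inner; congr (limn (series _)); apply/funext => n; rewrite !RIE; ring.
rewrite !Im_inner -lim_seriesN; last exact: cvg_inner_Im.
by congr (limn (series _)); apply/funext => n; rewrite fctE !RIE; ring.
Qed.

Local Opaque inner.

Lemma inner0l w : inner 0 w = 0.
Proof. by have := innerP (-1) 0 0 w; rewrite scaler0 addr0 mulN1r addrC subrr. Qed.

Lemma innerDl u v w : inner (u + v) w = inner u w + inner v w.
Proof. by rewrite -[u]scale1r innerP mul1r scale1r. Qed.

Lemma innerZl a u w : inner (a *: u) w = a * inner u w.
Proof. by rewrite -[a *: u]addr0 innerP inner0l addr0. Qed.

Lemma innerNl u w : inner (- u) w = - inner u w.
Proof. by rewrite -scaleN1r innerZl mulN1r. Qed.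

Lemma innerBl u v w : inner (u - v) w = inner u w - inner v w.
Proof. by rewrite innerDl innerNl. Qed.

Lemma inner0r w : inner w 0 = 0.
Proof. by rewrite innerC inner0l conjC0. Qed.

Lemma innerDr u v w : inner w (u + v) = inner w u + inner w v.
Proof. by rewrite innerC innerDl rmorphD/= -!innerC. Qed.

Lemma innerZr a u w : inner w (a *: u) = a^* * inner w u.
Proof. by rewrite innerC innerZl rmorphM/= -innerC. Qed.

Lemma innerNr u w : inner w (- u) = - inner w u.
Proof. by rewrite innerC innerNl rmorphN/= -innerC. Qed.

Lemma innerBr u v w : inner w (u - v) = inner w u - inner w v.
Proof. by rewrite innerDr innerNr. Qed.

Lemma inner_suml (I : Type) (r : seq I) (P : pred I) (F : I -> l2 R) w :
  inner (\sum_(i <- r | P i) F i) w = \sum_(i <- r | P i) inner (F i) w.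
Proof.
elim/big_rec2 : _ => [|i x y _ <-]; first exact: inner0l.
by rewrite innerDl.
Qed.

Lemma inner_sumr (I : Type) (r : seq I) (P : pred I) (F : I -> l2 R) w :
  inner w (\sum_(i <- r | P i) F i) = \sum_(i <- r | P i) inner w (F i).
Proof.
elim/big_rec2 : _ => [|i x y _ <-]; first exact: inner0r.
by rewrite innerDr.
Qed.

Lemma Im_inner_self u : Im (inner u u) = 0.
Proof.
by have := congr1 (@complex.Im R) (innerC u u); rewrite ImJ; lra.
Qed.

Lemma Re_inner_self u : Re (inner u u) = limn (series (fun n => normc (u n) ^+ 2)).
Proof.
by rewrite Re_inner; congr (limn (series _)); apply/funext => n; rewrite normcE2 !RIE; ring.
Qed.

Lemma psum_le_inner u n : \sum_(i < n) normc (u i) ^+ 2 <= Re (inner u u).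
Proof.
rewrite Re_inner_self.
have := nondecreasing_cvgn_le
  (nondecreasing_series (u_ := fun n => normc (u n) ^+ 2) (P := xpredT) (m := 0%N) (fun _ _ _ => sqr_ge0 _)) (cvg_l2 u) n.
by rewrite /series /= big_mkord.
Qed.

Lemma inner_self_ge0 u : 0 <= Re (inner u u).
Proof. by have := psum_le_inner u 0; rewrite big_ord0. Qed.

Lemma l2normE2 u : l2norm u ^+ 2 = Re (inner u u).
Proof. by rewrite sqr_sqrtr// inner_self_ge0. Qed.

Lemma inner_self u : inner u u = (l2norm u ^+ 2)%:C.
Proof. by apply: complex_ext; [rewrite l2normE2|exact: Im_inner_self]. Qed.

Lemma l2norm_ge0 u : 0 <= l2norm u. Proof. exact: sqrtr_ge0. Qed.

Lemma normc_coord u n : normc (u n) <= l2norm u.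
Proof.
rewrite -(@ler_pXn2r _ 2)// ?nnegrE ?normc_ge0 ?l2norm_ge0// l2normE2.
apply: le_trans (psum_le_inner u n.+1); rewrite big_ord_recr/= lerDr.
by apply: sumr_ge0 => i _; exact: sqr_ge0.
Qed.

Lemma l2norm0 : l2norm (0 : l2 R) = 0.
Proof. by rewrite /l2norm inner0l /= sqrtr0. Qed.

Lemma l2norm_eq0 u : l2norm u = 0 -> u = 0.
Proof.
move=> u0; apply: l2_ext => n; apply/eq0_normc/eqP.
by rewrite eq_le normc_ge0 -u0 normc_coord.
Qed.

Lemma l2normZ a u : l2norm (a *: u) = normc a * l2norm u.
Proof.
apply/eqP; rewrite -(@eqrXn2 _ 2)// ?mulr_ge0 ?normc_ge0 ?l2norm_ge0//.
rewrite exprMn !l2normE2 normcE2 innerZl innerZr !RIE Im_inner_self; apply/eqP; ring.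
Qed.

Lemma l2normN u : l2norm (- u) = l2norm u.
Proof. by rewrite -scaleN1r l2normZ normcN normc1 mul1r. Qed.

Lemma l2normB u v : l2norm (u - v) = l2norm (v - u).
Proof. by rewrite -l2normN opprB. Qed.

Lemma l2normD2 u v :
  l2norm (u + v) ^+ 2 = l2norm u ^+ 2 + l2norm v ^+ 2 + 2 * Re (inner u v).
Proof.
rewrite !l2normE2 innerDl !innerDr !RIE (innerC u v) ReJ; ring.
Qed.

(** The squared norm of |v| u - |u| v equals 2 |u| |v| (|u| |v| - Re <u,v>), and it is
    nonnegative. *)
Lemma Re_inner_le u v : Re (inner u v) <= l2norm u * l2norm v.
Proof.
have [v0|v0] := eqVneq (l2norm v) 0.
  by rewrite v0 (l2norm_eq0 v0) inner0r mulr0.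
have [u0|u0] := eqVneq (l2norm u) 0.
  by rewrite u0 (l2norm_eq0 u0) inner0l mul0r.
have h : 0 <= l2norm ((l2norm v)%:C *: u + (- (l2norm u)%:C) *: v) ^+ 2 by exact: sqr_ge0.
move: h; rewrite l2normD2 !l2normZ normcN !normcR !ger0_norm ?l2norm_ge0//.
rewrite innerZl innerZr !RIE !ReC !ImC.
have : 0 < l2norm u * l2norm v by rewrite mulr_gt0// lt0r ?u0 ?v0 l2norm_ge0.
move: (Re (inner u v)) (Im (inner u v)) => r i; move: (l2norm u) (l2norm v) => p q pq h.
by rewrite -subr_ge0 -(pmulr_rge0 _ pq); nra.
Qed.

(** Multiplying u by the conjugate of <u,v> turns the inner product into the real number |<u,v>|^2,
    which reduces the claim to the bound on the real part. *)
Lemma CauchySchwarz u v : normc (inner u v) <= l2norm u * l2norm v.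
Proof.
have [->|z0] := eqVneq (inner u v) 0; first by rewrite normc0 mulr_ge0 ?l2norm_ge0.
have := Re_inner_le ((inner u v)^* *: u) v.
rewrite l2normZ normcJ innerZl !RIE mulNr opprK -!expr2 -normcE2 expr2 -mulrA.
by rewrite ler_pM2l// lt0r normc_ge0 normc_eq0 z0.
Qed.

Lemma l2normD u v : l2norm (u + v) <= l2norm u + l2norm v.
Proof.
rewrite -(@ler_pXn2r _ 2)// ?nnegrE ?addr_ge0 ?l2norm_ge0// l2normD2.
have := Re_inner_le u v; nra.
Qed.

Lemma l2norm_dist u v w : l2norm (u - w) <= l2norm (u - v) + l2norm (v - w).
Proof. by rewrite -[X in l2norm X <= _](subrKA v) l2normD. Qed.

Lemma l2norm_sum (I : Type) (r : seq I) (P : pred I) (F : I -> l2 R) :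
  l2norm (\sum_(i <- r | P i) F i) <= \sum_(i <- r | P i) l2norm (F i).
Proof.
elim/big_ind2 : _ => //; first by rewrite l2norm0.
by move=> a x b y ax by_; rewrite (le_trans (l2normD _ _))// lerD.
Qed.

Lemma pythagoras u v : inner u v = 0 ->
  l2norm (u + v) ^+ 2 = l2norm u ^+ 2 + l2norm v ^+ 2.
Proof. by move=> uv; rewrite l2normD2 uv /= mulr0 addr0. Qed.

Lemma inner_ebasis u i : inner u (ebasis R i) = u i.
Proof.
have h (f : R^nat) c : (forall n, f n = if n == i then c else 0) -> limn (series f) = c.
  move=> fE; apply/cvg_lim => //; apply: cvg_near_cst; near=> n.
  have jn : (i < n)%N by near: n; exact: nbhs_infty_gt.
  rewrite /series /= big_mkord (bigD1 (Ordinal jn))//= fE eqxx big1 ?addr0//.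
  by move=> j; rewrite -val_eqE fE /= => /negPf ->.
by apply: complex_ext; rewrite ?Re_inner ?Im_inner; apply: h => n; rewrite ebasisE;
  case: eqP => [->|_]; rewrite ?conjC1 ?mulr1// conjC0 mulr0.
Unshelve. all: by end_near. Qed.

Lemma ebasis_orth i j : inner (ebasis R i) (ebasis R j) = (i == j)%:R.
Proof. by rewrite inner_ebasis ebasisE eq_sym. Qed.

Lemma l2norm_ebasis i : l2norm (ebasis R i) = 1.
Proof. by rewrite /l2norm ebasis_orth eqxx /= sqrtr1. Qed.

Definition trunc_l2 (n : nat) u : l2 R := \sum_(i < n) u i *: ebasis R i.

Lemma trunc_l2E n u j : trunc_l2 n u j = if (j < n)%N then u j else 0.
Proof.
rewrite l2_sum; under eq_bigr => i _ do rewrite l2Z ebasisE.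
case: ifPn => jn.
  rewrite (bigD1 (Ordinal jn))//= eqxx mulr1 big1 ?addr0// => i.
  by rewrite -val_eqE eq_sym /= => /negPf ->; rewrite mulr0.
rewrite big1// => i _; case: eqP => [ji|]; rewrite ?mulr0//.
by move: jn; rewrite ji ltn_ord.
Qed.

Lemma trunc_l2_sub n u j :
  normc ((u - trunc_l2 n u) j) = if (j < n)%N then 0 else normc (u j).
Proof. by rewrite l2D l2N trunc_l2E; case: ifP; rewrite ?subrr ?normc0 ?subr0. Qed.

(** The squared distance is the full sum of |u_i|^2 minus its n-th partial sum. *)
Lemma trunc_l2_cvg u : l2norm (u - trunc_l2 n u) @[n --> \oo] --> (0 : R).
Proof.
have E n : Re (inner (u - trunc_l2 n u) (u - trunc_l2 n u)) =
    Re (inner u u) - \sum_(i < n) normc (u i) ^+ 2.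
  rewrite !Re_inner_self.
  have cf := cvg_l2 u; have cg := cvg_l2 (u - trunc_l2 n u).
  apply/eqP; rewrite eq_sym subr_eq addrC -subr_eq -lim_seriesB//.
  apply/eqP/cvg_lim => //; apply: cvg_near_cst; near=> m.
  have nm : (n <= m)%N by near: m; exact: nbhs_infty_ge.
  rewrite /series /= -(big_mkord xpredT (fun i => normc (u i) ^+ 2)) (big_cat_nat (leq0n n) nm)//= [X in _ + X]big1_seq ?addr0.
    apply: eq_big_nat => i /andP[_ ni].
    by rewrite -[LHS]/(normc (u i) ^+ 2 - normc ((u - trunc_l2 n u) i) ^+ 2) trunc_l2_sub ni expr0n subr0.
  move=> i; rewrite mem_index_iota /= => /andP[ni _].
  by rewrite -[LHS]/(normc (u i) ^+ 2 - normc ((u - trunc_l2 n u) i) ^+ 2) trunc_l2_sub ltnNge ni subrr.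
rewrite (_ : (fun n => _) = fun n => Num.sqrt (Re (inner u u) - \sum_(i < n) normc (u i) ^+ 2)); last first.
  by apply/funext => n; rewrite /l2norm E.
rewrite -[X in _ --> X]sqrtr0 -[X in Num.sqrt X](subrr (Re (inner u u))).
apply: continuous_cvg; first exact: sqrt_continuous.
apply: cvgB; first exact: cvg_cst.
rewrite Re_inner_self (_ : (fun n => _) = series (fun n => normc (u n) ^+ 2)).
  exact: cvg_l2.
by apply/funext => n; rewrite /series /= big_mkord.
Unshelve. all: by end_near. Qed.

End Inner.

Local Opaque inner.

(** * Bounded operators, completeness and the resolvent set *)

Section Operators.
Variable R : realType.
Implicit Types (T S A B K : l2 R -> l2 R) (x y : l2 R).

Lemma lin0 T : linear T -> T 0 = 0.
Proof. by move=> lT; have := lT (-1) 0 0; rewrite scaler0 addr0 scaleN1r addrC subrr. Qed.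

Lemma linD T x y : linear T -> T (x + y) = T x + T y.
Proof. by move=> lT; have := lT 1 x y; rewrite !scale1r. Qed.

Lemma linZ T a x : linear T -> T (a *: x) = a *: T x.
Proof. by move=> lT; have := lT a x 0; rewrite (lin0 lT) !addr0. Qed.

Lemma linN T x : linear T -> T (- x) = - T x.
Proof. by move=> lT; rewrite -scaleN1r linZ// scaleN1r. Qed.

Lemma linB T x y : linear T -> T (x - y) = T x - T y.
Proof. by move=> lT; rewrite linD// linN. Qed.

Lemma lin_sum T (I : Type) (r : seq I) (P : pred I) (F : I -> l2 R) : linear T ->
  T (\sum_(i <- r | P i) F i) = \sum_(i <- r | P i) T (F i).
Proof.
move=> lT; elim/big_rec2 : _ => [|i x y _ <-]; first exact: lin0.
by rewrite linD.
Qed.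

Lemma linear_iter T n : linear T -> linear (iter n T).
Proof.
move=> lT; elim: n => [|n ih] a x y //=.
by rewrite ih lT.
Qed.

Lemma bounded_op_ge0 T : bounded_op T ->
  exists2 C, 0 <= C & forall x, l2norm (T x) <= C * l2norm x.
Proof.
move=> [_ [C TC]]; exists `|C| => // x; rewrite (le_trans (TC x))//.
by rewrite ler_wpM2r ?l2norm_ge0// ler_norm.
Qed.

Lemma opnorm_le T x : bounded_op T -> l2norm (T x) <= opnorm T * l2norm x.
Proof.
move=> bT; have [C C0 TC] := bounded_op_ge0 bT.
have hs : has_sup [set l2norm (T x) | x in [set x | l2norm x <= 1]].
  split; first by exists (l2norm (T 0)), 0 => //=; rewrite l2norm0.
  exists C => _ [y /= y1 <-]; rewrite (le_trans (TC y))//.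
  by rewrite -[leRHS]mulr1 ler_wpM2l.
have lT := bT.1.
have [x0|x0] := eqVneq (l2norm x) 0.
  by rewrite (l2norm_eq0 x0) (lin0 lT) l2norm0 mulr0.
have xp : 0 < l2norm x by rewrite lt0r x0 l2norm_ge0.
rewrite -ler_pdivrMr// mulrC -[X in X * _](@ger0_norm _ (l2norm x)^-1) ?invr_ge0 ?l2norm_ge0//.
rewrite -normcR -l2normZ -(linZ _ _ lT); apply: (ub_le_sup hs.2).
exists ((l2norm x)^-1%:C *: x) => //=.
by rewrite l2normZ normcR ger0_norm ?invr_ge0 ?l2norm_ge0// mulVf.
Qed.

Lemma cauchy_R (f : nat -> R) (M : nat -> R) :
  (forall n m, (n <= m)%N -> `|f m - f n| <= M n) -> M n @[n --> \oo] --> (0 : R) ->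
  cvgn f.
Proof.
move=> fM M0; apply: cauchy_cvg; apply: cauchy_exP => e e0.
move/cvgrPdist_lt : M0 => /(_ e e0)[n _ /(_ n (leqnn n))]; rewrite sub0r normrN => Mn.
exists (f n), n => // m /= nm; rewrite /ball /= distrC.
by rewrite (le_lt_trans (fM _ _ nm))// (le_lt_trans (ler_norm _)).
Qed.

Lemma square_summable_bounded (u : nat -> R[i]) (C : R) :
  (forall p, \sum_(i < p) normc (u i) ^+ 2 <= C) ->
  exists v : l2 R, (forall n, v n = u n) /\ l2norm v ^+ 2 <= C.
Proof.
move=> uC.
have su : cvgn (series (fun n => normc (u n) ^+ 2)).
  apply: nondecreasing_is_cvgn.
    by apply/nondecreasing_seqP => n; rewrite -subr_ge0 seriesSB sqr_ge0.
  by exists C => _ [n _ <-]; rewrite /series /= big_mkord.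
have uP : u \in @sqsum R by apply/asboolP.
exists (L2 uP); split=> //; rewrite l2normE2 Re_inner_self.
apply: limr_le => //; near=> n; rewrite /series /= big_mkord; exact: uC.
Unshelve. all: by end_near. Qed.

(** The coordinates converge, and the bound [M n] survives the limit in every finite partial sum,
    hence in the norm. *)
Lemma l2_complete (u : nat -> l2 R) (M : nat -> R) :
  (forall n m, (n <= m)%N -> l2norm (u m - u n) <= M n) ->
  M n @[n --> \oo] --> (0 : R) ->
  exists x, forall n, l2norm (u n - x) <= M n.
Proof.
move=> uM M0.
have M_ge0 n : 0 <= M n by rewrite (le_trans _ (uM n n _))// l2norm_ge0.
have cR i : cvgn (fun n => Re (u n i)).
  apply: cauchy_R M0 => n m nm; rewrite -ReN -ReD (le_trans (normc_Re _))//.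
  exact: le_trans (normc_coord (u m - u n) i) (uM _ _ nm).
have cI i : cvgn (fun n => Im (u n i)).
  apply: cauchy_R M0 => n m nm; rewrite -ImN -ImD (le_trans (normc_Im _))//.
  exact: le_trans (normc_coord (u m - u n) i) (uM _ _ nm).
pose y i := limn (fun n => Re (u n i)) +i* limn (fun n => Im (u n i)).
have sumC n p : (fun m => \sum_(i < p) normc (u n i - u m i) ^+ 2) @ \oo -->
    \sum_(i < p) normc (u n i - y i) ^+ 2.
  elim: p => [|p ih].
    by under eq_fun do rewrite big_ord0; rewrite big_ord0; exact: cvg_cst.
  under eq_fun do rewrite big_ord_recr /= normcE2 !RIE.
  rewrite big_ord_recr /= normcE2 !RIE.
  apply: cvgD ih _; apply: cvgD; rewrite !expr2.
    by apply: cvgM; apply: cvgB; [exact: cvg_cst|exact: cR|exact: cvg_cst|exact: cR].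
  by apply: cvgM; apply: cvgB; [exact: cvg_cst|exact: cI|exact: cvg_cst|exact: cI].
have sumM n p : \sum_(i < p) normc (u n i - y i) ^+ 2 <= M n ^+ 2.
  rewrite -(cvg_lim _ (sumC n p))//; apply: limr_le; first by apply/cvg_ex; eexists; exact: sumC.
  near=> m; have nm : (n <= m)%N by near: m; exact: nbhs_infty_ge.
  rewrite (le_trans (psum_le_inner (u n - u m) p))// -l2normE2 l2normB.
  by rewrite ler_pXn2r ?nnegrE ?l2norm_ge0// uM.
(* The coordinatewise limit [y] is not yet known to be square summable. Its difference with [u 0]
   is, so the limit in l2 is reached as [u 0 - v]. *)
have [v [vE _]] := @square_summable_bounded (fun i => u 0%N i - y i) _ (sumM 0%N).
exists (u 0%N - v) => n.
have [w [wE wM]] := @square_summable_bounded (fun i => u n i - y i) _ (sumM n).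
rewrite -(@ler_pXn2r _ 2)// ?nnegrE ?l2norm_ge0// (le_trans _ wM)//.
rewrite (_ : u n - _ = w)//; apply: l2_ext => i; rewrite wE !(l2D, l2N) vE; ring.
Unshelve. all: by end_near. Qed.

(** The solution is the Neumann series, the sum of all K^i y; [M n] is the geometric bound on its
    tail. *)
Lemma neumann K (c : R) y : linear K -> 0 <= c < 1 ->
  (forall x, l2norm (K x) <= c * l2norm x) -> exists x, x - K x = y.
Proof.
move=> lK /andP[c0 c1] Kc.
have c1' : 0 < 1 - c by rewrite subr_gt0.
pose u n := \sum_(i < n) iter i K y.
pose M n := c ^+ n * ((1 - c)^-1 * l2norm y).
have Kn n : l2norm (iter n K y) <= c ^+ n * l2norm y.
  elim: n => [|n ih]; first by rewrite mul1r.
  by rewrite /= (le_trans (Kc _))// exprS -mulrA ler_wpM2l.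
have uE n : u n - K (u n) = y - iter n K y.
  rewrite /u; elim: n => [|n ih]; first by rewrite big_ord0 (lin0 lK) /= !subrr.
  by rewrite big_ord_recr/= (linD _ _ lK) opprD addrACA ih -addrA addKr.
have M0 : M n @[n --> \oo] --> (0 : R).
  rewrite -[X in _ --> X](mul0r ((1 - c)^-1 * l2norm y)).
  by apply: cvgMl; apply: cvg_expr; rewrite ger0_norm.
have uM n m : (n <= m)%N -> l2norm (u m - u n) <= M n.
  (* The exact value of the geometric sum from n to m, rather than the tail, makes the induction on
     m - n close. *)
  move=> /subnKC <-; apply: (@le_trans _ _ ((c ^+ n - c ^+ (n + (m - n))) * ((1 - c)^-1 * l2norm y))).
    elim: (m - n)%N => [|d ih]; first by rewrite addn0 !subrr l2norm0 mul0r.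
    rewrite addnS /u big_ord_recr /= addrAC (le_trans (l2normD _ _))//.
    rewrite (le_trans (lerD ih (Kn _)))//.
    rewrite -subr_ge0 (_ : _ - _ = 0)// exprS; field.
    by rewrite gt_eqF.
  apply: ler_wpM2r; first by rewrite mulr_ge0 ?invr_ge0 ?l2norm_ge0 1?ltW.
  by rewrite lerBlDr lerDl exprn_ge0.
have [x ux] := l2_complete uM M0; exists x.
apply/eqP; rewrite -subr_eq0; apply/eqP/l2norm_eq0/eqP.
rewrite eq_le l2norm_ge0 andbT.
have B0 : (1 + c + (1 - c)) * M n @[n --> \oo] --> (0 : R).
  by rewrite -[X in _ --> X](mulr0 (1 + c + (1 - c))); apply: cvgMr.
rewrite -(cvg_lim _ B0)//; apply: limr_ge; first by apply/cvg_ex; exists 0.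
near=> n.
have -> : x - K x - y = - ((u n - x) - K (u n - x)) - iter n K y.
  rewrite (linB _ _ lK) [iter n K y](_ : _ = y - (u n - K (u n))).
    by apply: l2_ext => i; rewrite !(l2D, l2N); ring.
  by rewrite uE opprB addrC subrK.
rewrite (le_trans (l2normD _ _))// !l2normN mulrDl lerD//.
  rewrite (le_trans (l2normD _ _))// l2normN mulrDl mul1r lerD//.
  by rewrite (le_trans (Kc _))// ler_wpM2l.
rewrite (le_trans (Kn _))// (_ : _ * M n = c ^+ n * l2norm y)// /M; field.
by rewrite gt_eqF.
Unshelve. all: by end_near. Qed.

Lemma invertible_bij A (d : R) : linear A -> 0 < d ->
  (forall x, d * l2norm x <= l2norm (A x)) -> (forall y, exists x, A x = y) ->
  invertible A.
Proof.
move=> lA d0 Ad /choice[S AS].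
have Ainj x y : A x = A y -> x = y.
  move=> Axy; apply/eqP; rewrite -subr_eq0; apply/eqP/l2norm_eq0/eqP.
  rewrite eq_le l2norm_ge0 andbT -(pmulr_rle0 _ d0) (le_trans (Ad _))//.
  by rewrite linB// Axy subrr l2norm0.
exists S; split=> // [|x]; last exact: Ainj.
split; first by move=> a x y; apply: Ainj; rewrite (linD _ _ lA) (linZ _ _ lA) !AS.
by exists d^-1 => x; rewrite mulrC ler_pdivlMr// mulrC -{2}(AS x).
Qed.

(** A - B = (I - B S) A, where B S is a contraction with constant b C: solve v - B S v = y by a
    Neumann series and take S v. *)
Lemma invertible_pert A S B (C b : R) : linear A -> linear S -> linear B ->
  cancel A S -> cancel S A -> 0 < C -> 0 <= b ->
  (forall x, l2norm (S x) <= C * l2norm x) ->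
  (forall x, l2norm (B x) <= b * l2norm x) -> b * C < 1 ->
  invertible (fun x => A x - B x).
Proof.
move=> lA lS lB AS SA C0 b0 SC Bb bC.
apply: (@invertible_bij _ (C^-1 - b)).
- by move=> a x y; rewrite lA lB scalerBr opprD addrACA.
- by rewrite subr_gt0 -[C^-1]mul1r ltr_pdivlMr.
- move=> x; have := l2normD (A x - B x) (B x); rewrite subrK -lerBlDr.
  apply: le_trans; rewrite mulrBl lerB//.
  by rewrite mulrC ler_pdivrMr// mulrC -{1}(AS x).
- move=> y.
  have lK : linear (B \o S) by move=> a x z /=; rewrite lS lB.
  have [|x|v vE] := @neumann (B \o S) (b * C) y lK.
  + by rewrite bC mulr_ge0// ltW.
  + by rewrite /= (le_trans (Bb _))// -mulrA ler_wpM2l.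
  by exists (S v); rewrite SA.
Qed.

(** For |z| > C, T - z is a perturbation of the scalar -z, whose inverse has norm 1/|z|. *)
Lemma spectrum_bounded T (C : R) z : linear T ->
  (forall x, l2norm (T x) <= C * l2norm x) -> spectrum T z -> normc z <= C.
Proof.
move=> lT TC sp; rewrite leNgt; apply/negP => Cz; apply: sp.
have C0 : 0 <= C by rewrite -[C]mulr1 -(l2norm_ebasis R 0) (le_trans _ (TC _))// l2norm_ge0.
have z0 : z != 0 by rewrite -normc_eq0 gt_eqF// (le_lt_trans C0).
rewrite (_ : (fun x => _) = fun x => - z *: x - (- T x)); last first.
  by apply/funext => x; rewrite opprK scaleNr addrC.
apply: (@invertible_pert _ (fun x => (- z^-1) *: x) _ (normc z)^-1 C) => //.
- by move=> a x y; rewrite scalerDr !scalerA mulrC.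
- by move=> a x y; rewrite scalerDr !scalerA mulrC.
- by move=> a x y; rewrite lT opprD scalerN.
- by move=> x; rewrite scalerA mulrNN mulVf// scale1r.
- by move=> x; rewrite scalerA mulrNN mulfV// scale1r.
- by rewrite invr_gt0 (le_lt_trans C0).
- by move=> x; rewrite l2normZ normcN normcV.
- by move=> x; rewrite l2normN.
- by rewrite ltr_pdivrMr ?mul1r// (le_lt_trans C0).
Qed.

Lemma resolvent_open T z : bounded_op T -> ~ spectrum T z ->
  exists2 e : R, 0 < e & forall w, normc (w - z) < e -> ~ spectrum T w.
Proof.
move=> bT; rewrite /spectrum /= => /contrapT[S [bS AS SA]].
have [C C0 SC] := bounded_op_ge0 bS.
have C1 : 0 < C + 1 by rewrite ltr_wpDl.
exists (C + 1)^-1; first by rewrite invr_gt0.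
move=> w wz; apply; rewrite (_ : (fun x => _) = fun x => (T x - z *: x) - (w - z) *: x); last first.
  by apply/funext => x; rewrite scalerBl opprB addrA addrNK.
apply: (@invertible_pert _ S _ (C + 1) (normc (w - z))) => //.
- move=> a x y; rewrite bT.1 scalerBr scalerDr !scalerA [z * a]mulrC.
  by rewrite opprD addrACA.
- exact: bS.1.
- by move=> a x y; rewrite scalerDr !scalerA mulrC.
- exact: normc_ge0.
- by move=> x; rewrite (le_trans (SC x))// ler_wpM2r ?l2norm_ge0// lerDl.
- by move=> x; rewrite l2normZ.
- by rewrite -ltr_pdivlMr// div1r.
Qed.

End Operators.

(** * Spectral measures *)

Section PlaneMeasurability.
Variable R : realType.

(** The product sigma-algebra is generated by rectangles, so U is written as the countable union of
    the rational open squares that it contains; [F] replaces the other squares by the empty set. *)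
Lemma measurable_plane_open (U : set (plane R)) :
  (forall p, U p -> exists2 e : R, 0 < e &
     forall p', `|p'.1 - p.1| < e -> `|p'.2 - p.2| < e -> U p') ->
  measurable U.
Proof.
move=> openU.
pose sq (a b r : rat) : set (plane R) :=
  `](ratr a - ratr r : R), (ratr a + ratr r : R)[%classic `*`
  `](ratr b - ratr r : R), (ratr b + ratr r : R)[%classic.
pose F a b r := if `[< sq a b r `<=` U >] then sq a b r else set0.
rewrite (_ : U = \bigcup_a \bigcup_b \bigcup_r F a b r).
  do 3! (apply: bigcupT_measurable_rat => ?); rewrite /F; case: ifP => // _.
  by apply: measurableX; exact: measurable_itv.
apply/seteqP; split => [p Up|p [a _ [b _ [r _]]]]; last first.
  by rewrite /F; case: asboolP => // sU /sU.
have [e e0 eU] := openU _ Up.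
(* In each coordinate two points of the square differ by less than 2 r < e. *)
have [|r] := @rat_in_itvoo R 0 (e / 2); first by rewrite divr_gt0.
rewrite in_itv /= => /andP[r0 re].
have [|a] := @rat_in_itvoo R (p.1 - ratr r) (p.1 + ratr r); first by lra.
rewrite in_itv /= => /andP[a1 a2].
have [|b] := @rat_in_itvoo R (p.2 - ratr r) (p.2 + ratr r); first by lra.
rewrite in_itv /= => /andP[b1 b2].
exists a => //; exists b => //; exists r => //; rewrite /F.
case: asboolP => [_|].
  by split => /=; rewrite in_itv /=; apply/andP; split; lra.
case=> p' [/=]; rewrite !in_itv /= => /andP[h1 h2] /andP[h3 h4].
by apply: eU; rewrite ltr_norml; apply/andP; split; lra.
Qed.

Lemma measurable_plane_closed (F : set (plane R)) :
  (forall p, ~ F p -> exists2 e : R, 0 < e &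
     forall p', `|p'.1 - p.1| < e -> `|p'.2 - p.2| < e -> ~ F p') ->
  measurable F.
Proof. by move=> cF; rewrite -[F]setCK; apply: measurableC; exact: measurable_plane_open. Qed.

Lemma measurable_spectrum (T : l2 R -> l2 R) : bounded_op T ->
  measurable (to_plane (spectrum T)).
Proof.
move=> bT; apply: measurable_plane_closed => p np.
have [e e0 eT] := resolvent_open bT np.
exists (e / 2); first by rewrite divr_gt0.
move=> p' h1 h2; apply: eT; rewrite (le_lt_trans (normc_le_ReIm _))// !RIE /=.
by rewrite [ltRHS](splitr e) ltrD.
Qed.

Lemma measurable_to_plane1 (z : R[i]) : measurable (to_plane [set z]).
Proof.
rewrite (_ : to_plane _ = [set complex.Re z] `*` [set complex.Im z]).
  by apply: measurableX; exact: measurable_set1.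
by case: z => x y; apply/seteqP; split => -[a b] /=; rewrite /to_plane /= => -[-> ->].
Qed.

Lemma measurable_finite_to_plane (n : nat) (lam : nat -> R[i]) :
  measurable (to_plane (omega n lam)).
Proof.
rewrite (_ : to_plane _ = \bigcup_(i in `I_n) to_plane [set lam i]).
  by apply: fin_bigcup_measurable => // i _; exact: measurable_to_plane1.
apply/seteqP; split => p.
  by move=> [i /= ni il]; exists i => //=; rewrite /to_plane /= il.
by move=> [i /= ni il]; exists i.
Qed.

(** The boolean lets each estimate be proved once for the real and the imaginary part. *)
Definition pcoord (b : bool) (p : plane R) : R := if b then p.1 else p.2.

Lemma measurable_pcoord b : measurable_fun setT (pcoord b).
Proof. by case: b; [exact: measurable_fst|exact: measurable_snd]. Qed.

Lemma measurable_pcoord_ge b (c : R) : measurable [set p | c <= pcoord b p].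
Proof.
rewrite -[X in measurable X]setTI.
rewrite (_ : [set p | _] = pcoord b @^-1` `[c, +oo[%classic); last first.
  by apply/seteqP; split => p /=; rewrite in_itv /= andbT.
by apply: measurable_pcoord => //; exact: measurable_itv.
Qed.

Lemma measurable_pcoord_le b (c : R) : measurable [set p | pcoord b p <= c].
Proof.
rewrite -[X in measurable X]setTI.
rewrite (_ : [set p | _] = pcoord b @^-1` `]-oo, c]%classic); last first.
  by apply/seteqP; split => p /=; rewrite in_itv /=.
by apply: measurable_pcoord => //; exact: measurable_itv.
Qed.

End PlaneMeasurability.

(** * Orthogonal projections *)

Section Projectors.
Variable R : realType.
Implicit Types (P : l2 R -> l2 R) (x y : l2 R).

Lemma projK P x : orth_projector P -> P (P x) = P x.
Proof. by case=> _ /(_ x). Qed.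

Lemma projA P x y : orth_projector P -> inner (P x) y = inner x (P y).
Proof. by case=> _ _; exact. Qed.

Lemma proj_lin P : orth_projector P -> linear P.
Proof. by case=> -[]. Qed.

Lemma proj_inner P x : orth_projector P -> inner (P x) x = (l2norm (P x) ^+ 2)%:C.
Proof. by move=> oP; rewrite -inner_self -{1}(projK x oP) projA. Qed.

Lemma proj_compl P x : orth_projector P -> P (x - P x) = 0.
Proof. by move=> oP; rewrite linB ?projK ?subrr//; exact: proj_lin. Qed.

Lemma proj_orth P x y : orth_projector P -> P x = x -> P y = 0 -> inner x y = 0.
Proof. by move=> oP <- y0; rewrite projA// y0 inner0r. Qed.

Lemma proj_pythagoras P x : orth_projector P ->
  l2norm x ^+ 2 = l2norm (P x) ^+ 2 + l2norm (x - P x) ^+ 2.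
Proof.
move=> oP; rewrite -pythagoras ?[P x + _]addrC ?subrK//.
by apply: proj_orth (proj_compl _ _) => //; rewrite projK.
Qed.

Lemma proj_le P x : orth_projector P -> l2norm (P x) <= l2norm x.
Proof.
move=> oP; rewrite -(@ler_pXn2r _ 2)// ?nnegrE ?l2norm_ge0//.
by rewrite (proj_pythagoras x oP) lerDl sqr_ge0.
Qed.

Lemma proj_compl_le P x : orth_projector P -> l2norm (x - P x) <= l2norm x.
Proof.
move=> oP; rewrite -(@ler_pXn2r _ 2)// ?nnegrE ?l2norm_ge0//.
by rewrite (proj_pythagoras x oP) lerDr sqr_ge0.
Qed.

Lemma proj_dist_le P x y : orth_projector P -> P y = y ->
  l2norm (x - P x) <= l2norm (x - y).
Proof.
move=> oP Py; have lP := proj_lin oP; have := proj_compl_le (x - y) oP.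
by rewrite (linB _ _ lP) Py (_ : x - y - (P x - y) = x - P x)// opprB addrA addrNK.
Qed.

End Projectors.

(** * The projection-valued measure and the quadratic form of T *)

Section SpectralMeasure.
Variables (R : realType) (T : l2 R -> l2 R) (E : set (plane R) -> l2 R -> l2 R).
Hypotheses (bT : bounded_op T) (hE : spectral_measure T E).
Implicit Types (A B : set (plane R)) (x y : l2 R).
Local Notation sp := (to_plane (spectrum T)).

Let lT : linear T. Proof. exact: bT.1. Qed.

Lemma E_proj A : measurable A -> orth_projector (E A).
Proof. by case: hE => h _ _ _; exact: h. Qed.

Lemma E_I A B x : measurable A -> measurable B -> E (A `&` B) x = E A (E B x).
Proof. by case: hE => _ _ h _ mA mB; exact: h. Qed.

Lemma E_comm A B x : measurable A -> measurable B -> E A (E B x) = E B (E A x).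
Proof. by move=> mA mB; rewrite -!E_I// setIC. Qed.

Definition is_mu x (mu : {measure set (plane R) -> \bar R}) :=
  forall A, measurable A -> mu A = (l2norm (E A x) ^+ 2)%:E.

Definition tquad (b : bool) x : R :=
  if b then Re (inner (T x) x) else Im (inner (T x) x).

Lemma spectral_mu x : exists2 mu, is_mu x mu &
  forall b, tquad b x = Rintegral mu setT (pcoord b).
Proof.
case: hE => _ _ _ /(_ x)[mu [muE h1 h2]]; exists mu; last by case.
by move=> A mA; rewrite muE// proj_inner//; exact: E_proj.
Qed.

Let msp : measurable sp. Proof. exact: measurable_spectrum. Qed.

Lemma E_sp A x : measurable A -> E (A `&` sp) x = E A x.
Proof. by move=> mA; rewrite E_I//; case: hE => _ -> . Qed.

Lemma E_set0 x : E set0 x = 0.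
Proof.
have [mu muE _] := spectral_mu x; apply/l2norm_eq0/eqP; rewrite -sqrf_eq0.
by have := muE set0 measurable0; rewrite measure0 => -[<-].
Qed.

Lemma E_null A x : measurable A -> (forall p, A p -> ~ sp p) -> E A x = 0.
Proof.
move=> mA Asp; rewrite -E_sp// (_ : A `&` sp = set0) ?E_set0//.
by apply/seteqP; split => p // -[/Asp].
Qed.

Lemma E_setT x : E setT x = x.
Proof. by rewrite -E_sp ?setTI//; case: hE => _ ->. Qed.

Lemma E_sub A B x : measurable A -> measurable B -> A `<=` B -> E A (E B x) = E A x.
Proof. by move=> mA mB AB; rewrite -E_I//; congr E; apply/setIidPl. Qed.

Lemma E_subr A B x : measurable A -> measurable B -> A `<=` B -> E B (E A x) = E A x.
Proof. by move=> mA mB AB; rewrite E_comm// E_sub. Qed.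

Lemma E_disj A B x : measurable A -> measurable B -> A `&` B = set0 -> E A (E B x) = 0.
Proof. by move=> mA mB AB; rewrite -E_I// AB E_set0. Qed.

(** Only the scalar measures are assumed additive. With z the left-hand side and a, b the orthogonal
    summands, Re <z,a> = |a|^2 and Re <z,b> = |b|^2, so |z - a - b|^2 = |z|^2 - |a|^2 - |b|^2, which
    is 0 by scalar additivity. *)
Lemma E_U A B x : measurable A -> measurable B -> A `&` B = set0 ->
  E (A `|` B) x = E A x + E B x.
Proof.
move=> mA mB AB; have mU := measurableU _ _ mA mB.
have [mu muE _] := spectral_mu x.
have h : l2norm (E (A `|` B) x) ^+ 2 = l2norm (E A x) ^+ 2 + l2norm (E B x) ^+ 2.
  apply: EFin_inj; rewrite EFinD -(muE _ mU) -(muE _ mA) -(muE _ mB).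
  exact: measureU.
set z := E (A `|` B) x in h *.
have zA : E A z = E A x by apply: E_sub => //; exact: subsetUl.
have zB : E B z = E B x by apply: E_sub => //; exact: subsetUr.
have ab : inner (E A x) (E B x) = 0.
  by rewrite projA ?E_disj ?inner0r//; exact: E_proj.
have za : Re (inner z (E A x)) = l2norm (E A x) ^+ 2.
  by rewrite -[E A x](projK x (E_proj mA)) -projA ?zA ?inner_self ?ReC ?projK//; exact: E_proj.
have zb : Re (inner z (E B x)) = l2norm (E B x) ^+ 2.
  by rewrite -[E B x](projK x (E_proj mB)) -projA ?zB ?inner_self ?ReC ?projK//; exact: E_proj.
apply/eqP; rewrite -subr_eq0; apply/eqP/l2norm_eq0/eqP; rewrite -sqrf_eq0; apply/eqP.
rewrite l2normD2 l2normN (pythagoras ab) innerNr innerDr !RIE za zb h; ring.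
Qed.

Lemma E_C A x : measurable A -> E (~` A) x = x - E A x.
Proof.
move=> mA; have mC := measurableC mA.
have d : ~` A `&` A = set0 by rewrite setIC setICr.
apply/esym/eqP; rewrite subr_eq -(E_U x mC mA d).
by rewrite setUC setUCr E_setT.
Qed.

Lemma bounded_sp : exists2 C : R, 0 <= C & forall b p, sp p -> `|pcoord b p| <= C.
Proof.
have [C C0 TC] := bounded_op_ge0 bT; exists C => // b p /(spectrum_bounded lT TC).
apply: le_trans; case: b => /=.
  exact: (normc_Re (p.1 +i* p.2)).
exact: (normc_Im (p.1 +i* p.2)).
Qed.

Lemma mu_spC x mu : is_mu x mu -> mu (~` sp) = 0.
Proof.
by move=> muE; rewrite muE ?E_null ?l2norm0 ?expr0n//; exact: measurableC.
Qed.

(** The coordinates are unbounded on the plane, but the measure vanishes off the spectrum, which is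
    bounded. *)
Lemma pcoord_integrable x mu b : is_mu x mu ->
  mu.-integrable setT (EFin \o pcoord b).
Proof.
move=> muE; have [C C0 spC] := bounded_sp.
have mf := measurable_pcoord b.
apply/(negligible_integrable (N := ~` sp)) => //.
- exact: measurableC.
- exact/measurable_realfun.measurable_EFinP.
- exact: mu_spC muE.
rewrite setTD setCK; apply: measurable_bounded_integrable => //.
- by rewrite muE// ltry.
- exact: measurable_funTS.
- exists C; split; first exact: num_real.
  by move=> M CM p /= /spC h; rewrite (le_trans (h b))// ltW.
Qed.

Lemma pcoord_integral_sub x mu b A : is_mu x mu -> measurable A -> E A x = x ->
  Rintegral mu setT (pcoord b) = Rintegral mu (A `&` sp) (pcoord b).
Proof.
move=> muE mA Ax; rewrite /Rintegral.
rewrite (@negligible_integral _ _ _ _ setT (~` (A `&` sp))) ?setTD ?setCK//.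
- by apply: measurableC; exact: measurableI.
- exact: pcoord_integrable muE.
rewrite muE; last by apply: measurableC; exact: measurableI.
by rewrite E_C ?E_sp ?Ax ?subrr ?l2norm0 ?expr0n//; exact: measurableI.
Qed.

Lemma mu_sub x mu A : is_mu x mu -> measurable A -> E A x = x ->
  fine (mu (A `&` sp)) = l2norm x ^+ 2.
Proof. by move=> muE mA Ax; rewrite muE ?E_sp ?Ax//; exact: measurableI. Qed.

Lemma integrable_cst_sub x mu A c : is_mu x mu -> measurable A ->
  mu.-integrable A (EFin \o (fun=> c)).
Proof.
move=> muE mA; apply: measurable_bounded_integrable => //; first by rewrite muE// ltry.
by exists `|c|; split; [exact: num_real|move=> M cM p _ /=; exact: ltW].
Qed.

Lemma tquad_ge b c A x : measurable A -> E A x = x ->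
  (forall p, A p -> sp p -> c <= pcoord b p) -> c * l2norm x ^+ 2 <= tquad b x.
Proof.
move=> mA Ax Ac; have [mu muE ->] := spectral_mu x.
have mAs : measurable (A `&` sp) by exact: measurableI.
rewrite (pcoord_integral_sub _ muE mA Ax) -(mu_sub muE mA Ax) -Rintegral_cst//.
apply: le_Rintegral => //.
- exact: integrable_cst_sub muE _.
- by apply: integrableS (pcoord_integrable b muE).
- by move=> p [Ap sp_]; exact: Ac.
Qed.

Lemma tquad_le b c A x : measurable A -> E A x = x ->
  (forall p, A p -> sp p -> pcoord b p <= c) -> tquad b x <= c * l2norm x ^+ 2.
Proof.
move=> mA Ax Ac; have [mu muE ->] := spectral_mu x.
have mAs : measurable (A `&` sp) by exact: measurableI.
rewrite (pcoord_integral_sub _ muE mA Ax) -(mu_sub muE mA Ax) -Rintegral_cst//.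
apply: le_Rintegral => //.
- by apply: integrableS (pcoord_integrable b muE).
- exact: integrable_cst_sub muE _.
- by move=> p [Ap sp_]; exact: Ac.
Qed.

(** E B x and E B y are orthogonal for every B, because E B commutes with E A; hence the measure of
    x + y is the sum of the measures of x and y. *)
Lemma tquadD b A x y : measurable A -> E A x = x -> E A y = 0 ->
  tquad b (x + y) = tquad b x + tquad b y.
Proof.
move=> mA Ax Ay.
have [mu muE ->] := spectral_mu x; have [nu nuE ->] := spectral_mu y.
have [ka kaE ->] := spectral_mu (x + y).
have kaE' : forall B, measurable B -> B `<=` setT -> ka B = measure_add mu nu B.
  move=> B mB _; rewrite kaE// /measure_add/= /msum big_ord_recr big_ord_recr /= big_ord0 add0e.
  rewrite [X in _ = (X + _)%E](muE _ mB) [X in _ = (_ + X)%E](nuE _ mB) -EFinD.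
  congr EFin; rewrite (linD _ _ (proj_lin (E_proj mB))) pythagoras//.
  apply: (proj_orth (E_proj mA)).
    by rewrite E_comm// Ax.
  by rewrite E_comm// Ay (lin0 (proj_lin (E_proj mB))).
have fi := pcoord_integrable b muE; have gi := pcoord_integrable b nuE.
rewrite /Rintegral (eq_measure_integral _ kaE') integral_measure_add//.
by rewrite fineD//; exact: integrable_fin_num.
Qed.

End SpectralMeasure.

(** * Operator bounds from spectral measures *)

Section SpectralCalculus.
Variables (R : realType) (T : l2 R -> l2 R) (E : set (plane R) -> l2 R -> l2 R).
Hypotheses (bT : bounded_op T) (hE : spectral_measure T E).
Implicit Types (A B : set (plane R)) (x y : l2 R).
Local Notation sp := (to_plane (spectrum T)).

Let lT : linear T. Proof. exact: bT.1. Qed.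
Let E_lin A : measurable A -> linear (E A).
Proof. by move=> mA; exact: proj_lin (E_proj hE mA). Qed.

Lemma T_orth_sum A x y : measurable A -> E A x = x -> E A y = 0 ->
  inner (T x) y + inner (T y) x = 0.
Proof.
move=> mA Ax Ay.
have q : inner (T (x + y)) (x + y) = inner (T x) x + inner (T y) y.
  apply: complex_ext; rewrite RIE.
    exact: (tquadD bT hE true mA Ax Ay).
  exact: (tquadD bT hE false mA Ax Ay).
move: q; rewrite (linD _ _ lT) innerDl !innerDr => q.
by apply: (addrI (inner (T x) x + inner (T y) y)); rewrite addr0 -[RHS]q; ring.
Qed.

(** The sum of the two cross terms vanishes; with i x in place of x the same identity says that
    their difference vanishes. *)
Lemma T_orth A x y : measurable A -> E A x = x -> E A y = 0 ->
  inner (T x) y = 0 /\ inner (T y) x = 0.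
Proof.
move=> mA Ax Ay; have h1 := T_orth_sum mA Ax Ay.
have /(T_orth_sum mA) : E A ((0 +i* 1) *: x) = (0 +i* 1) *: x by rewrite linZ ?Ax//; exact: E_lin.
move=> /(_ y Ay); rewrite (linZ _ _ lT) innerZl innerZr.
move: (inner (T x) y) (inner (T y) x) h1 => a b h1 h2.
have := congr1 (@complex.Re R) h1; have := congr1 (@complex.Im R) h1.
have := congr1 (@complex.Re R) h2; have := congr1 (@complex.Im R) h2.
by rewrite !RIE /= => ? ? ? ?; split; apply: complex_ext => /=; lra.
Qed.

(** By [T_orth], T maps both the range and the kernel of E A into themselves. *)
Lemma E_T A x : measurable A -> E A (T x) = T (E A x).
Proof.
move=> mA; have oP := E_proj hE mA.
have ran z : E A z = z -> E A (T z) = T z.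
  move=> Az; apply/eqP; rewrite eq_sym -subr_eq0; apply/eqP/l2norm_eq0/eqP.
  rewrite -sqrf_eq0 -[_ ^+ 2]ReC -inner_self; set k := _ - _.
  have Ak : E A k = 0 by exact: proj_compl.
  rewrite {1}/k innerBl (T_orth mA Az Ak).1 projA// Ak inner0r subrr.
  exact/eqP.
have ker z : E A z = 0 -> E A (T z) = 0.
  move=> Az; apply/l2norm_eq0/eqP; rewrite -sqrf_eq0 -[_ ^+ 2]ReC -inner_self.
  rewrite projA// projK// (T_orth mA _ Az).2 ?projK//; exact/eqP.
rewrite -{1}(subrK (E A x) x) (linD _ _ lT) (linD _ _ (E_lin mA)).
by rewrite ker ?proj_compl// add0r ran// projK.
Qed.

Lemma quad_expand (D : l2 R -> l2 R) (c : R[i]) x y : linear D ->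
  inner (D (x + c *: y)) (x + c *: y) = inner (D x) x + c^* * inner (D x) y +
    (c * inner (D y) x + c * (c^* * inner (D y) y)).
Proof.
by move=> lD; rewrite (linD _ _ lD) (linZ _ _ lD) innerDl !innerDr !innerZl !innerZr.
Qed.

Lemma l2normD2Z (c : R[i]) x y : l2norm (x + c *: y) ^+ 2 =
  l2norm x ^+ 2 + normc c ^+ 2 * l2norm y ^+ 2 + 2 * Re (c^* * inner x y).
Proof. by rewrite l2normD2 l2normZ exprMn innerZr. Qed.

(** Polarization without symmetry of D: the real parts at c = 1, -1 isolate Re (<Dz,y> + <Dy,z>),
    the imaginary parts at c = i, -i isolate Re (<Dz,y> - <Dy,z>), and the parallelogram law bounds
    each by 2 w (|z|^2 + |y|^2) up to a factor 2 that cancels. *)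
Lemma polar_bound (D : l2 R -> l2 R) (w : R) z y : linear D ->
  (forall c : R[i], let v := z + c *: y in
     `|Re (inner (D v) v)| <= w * l2norm v ^+ 2 /\
     `|Im (inner (D v) v)| <= w * l2norm v ^+ 2) ->
  Re (inner (D z) y) <= w * (l2norm z ^+ 2 + l2norm y ^+ 2).
Proof.
move=> lD q.
have q' c : `|Re (inner (D z) z + c^* * inner (D z) y +
        (c * inner (D y) z + c * (c^* * inner (D y) y)))| <=
      w * (l2norm z ^+ 2 + normc c ^+ 2 * l2norm y ^+ 2 + 2 * Re (c^* * inner z y)) /\
    `|Im (inner (D z) z + c^* * inner (D z) y +
        (c * inner (D y) z + c * (c^* * inner (D y) y)))| <=
      w * (l2norm z ^+ 2 + normc c ^+ 2 * l2norm y ^+ 2 + 2 * Re (c^* * inner z y)).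
  by have := q c; rewrite /= quad_expand// l2normD2Z.
have := q' 1; have := q' (- 1); have := q' (0 +i* 1); have := q' (0 -i* 1).
move: (inner (D z) z) (inner (D z) y) (inner (D y) z) (inner (D y) y) (inner z y).
move: (l2norm z ^+ 2) (l2norm y ^+ 2) => Z Y a b d e s.
move=> -[_ mi] [_ pi] [m1 _] [p1 _].
move: mi pi m1 p1; rewrite !normcE2 !RIE /= !ler_norml => /andP[_ mi] /andP[pi _] /andP[m1 _] /andP[_ p1].
move: (Re a) (Im a) (Re b) (Im b) (Re d) (Im d) (Re e) (Im e) (Re s) (Im s) mi pi m1 p1.
by move=> a1 a2 b1 b2 d1 d2 e1 e2 s1 s2 mi pi m1 p1; clear -mi pi m1 p1; lra.
Qed.

Lemma quad_bound A (c : R[i]) (w : R) z : measurable A -> E A z = z ->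
  (forall p, A p -> sp p -> `|p.1 - Re c| <= w /\ `|p.2 - Im c| <= w) ->
  `|Re (inner (T z - c *: z) z)| <= w * l2norm z ^+ 2 /\
  `|Im (inner (T z - c *: z) z)| <= w * l2norm z ^+ 2.
Proof.
move=> mA Az Ac; rewrite innerBl innerZl inner_self.
have h1 : forall p, A p -> sp p -> Re c - w <= pcoord true p.
  by move=> p Ap /(Ac _ Ap)[]; rewrite ler_norml /= => /andP[]; lra.
have h2 : forall p, A p -> sp p -> pcoord true p <= Re c + w.
  by move=> p Ap /(Ac _ Ap)[]; rewrite ler_norml /= => /andP[]; lra.
have h3 : forall p, A p -> sp p -> Im c - w <= pcoord false p.
  by move=> p Ap /(Ac _ Ap)[_]; rewrite ler_norml /= => /andP[]; lra.
have h4 : forall p, A p -> sp p -> pcoord false p <= Im c + w.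
  by move=> p Ap /(Ac _ Ap)[_]; rewrite ler_norml /= => /andP[]; lra.
have := tquad_ge bT hE mA Az h1; have := tquad_le bT hE mA Az h2.
have := tquad_ge bT hE mA Az h3; have := tquad_le bT hE mA Az h4.
rewrite /tquad; move: (inner (T z) z) (l2norm z ^+ 2) => q N.
rewrite !RIE /= !ler_norml; by move=> ? ? ? ?; split; apply/andP; split; nra.
Qed.

(** The form of D = T - c is bounded by w on the range of E A, which D preserves; polarization turns
    this into a norm bound at the cost of the factor 2. *)
Lemma cell_bound A (c : R[i]) (w : R) x : measurable A -> E A x = x ->
  (forall p, A p -> sp p -> `|p.1 - Re c| <= w /\ `|p.2 - Im c| <= w) ->
  l2norm (T x - c *: x) <= 2 * w * l2norm x.
Proof.
move=> mA Ax Ac; pose D z := T z - c *: z.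
have lD : linear D.
  by move=> a u v; rewrite /D lT scalerDr opprD addrACA scalerBr !scalerA mulrC.
have lA := E_lin mA.
have DA z : E A z = z -> E A (D z) = D z.
  by move=> Az; rewrite /D (linB _ _ lA) (linZ _ _ lA) E_T// Az.
have q z : E A z = z -> `|Re (inner (D z) z)| <= w * l2norm z ^+ 2 /\
    `|Im (inner (D z) z)| <= w * l2norm z ^+ 2.
  by move=> Az; exact: quad_bound Ac.
have polar z y : E A z = z -> E A y = y ->
    Re (inner (D z) y) <= w * (l2norm z ^+ 2 + l2norm y ^+ 2).
  move=> Az Ay.
  apply: polar_bound => // c'; apply: q.
  by rewrite (linD _ _ lA) (linZ _ _ lA) Az Ay.
have [N0|N0] := eqVneq (l2norm (D x)) 0.
  (* The sign of w is not given; for x nonzero it follows from the bound on the form. *)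
  have w0 : 0 <= w * l2norm x ^+ 2 by rewrite (le_trans _ (q x Ax).1).
  have [x0|x0] := eqVneq (l2norm x) 0; first by rewrite -/(D x) N0 x0 mulr0.
  have xp : 0 < l2norm x ^+ 2 by rewrite exprn_gt0// lt0r x0 l2norm_ge0.
  by rewrite -/(D x) N0 !mulr_ge0 ?l2norm_ge0// -(pmulr_lge0 _ xp).
have x0 : 0 < l2norm x.
  rewrite lt0r l2norm_ge0 andbT; apply: contra_neq N0 => /l2norm_eq0 ->.
  by rewrite (lin0 lD) l2norm0.
have Np : 0 < l2norm (D x) by rewrite lt0r N0 l2norm_ge0.
have sp0 : 0 < l2norm x / l2norm (D x) by rewrite divr_gt0.
(* The test vector is D x rescaled to the norm of x: the inner product becomes |x| |Dx| and the
   bound 2 w |x|^2. *)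
have := polar x ((l2norm x / l2norm (D x))%:C *: D x) Ax.
rewrite (linZ _ _ lA) DA// => /(_ erefl); rewrite l2normZ normcR (ger0_norm (ltW sp0)).
rewrite divfK// innerZr inner_self conjE conjc_real -rmorphM ReC -/(D x).
rewrite (_ : l2norm x / _ * _ = l2norm x * l2norm (D x)); last by field.
rewrite (_ : w * _ = l2norm x * (2 * w * l2norm x)); last by ring.
by rewrite ler_pM2l.
Qed.

(** T respects the orthogonal splitting given by E C, so the squares of the two bounds add up with
    no loss in K. *)
Lemma split_bound C x (K : R) : measurable C -> 0 <= K ->
  l2norm (T (E C x)) <= K * l2norm (E C x) ->
  l2norm (T (E (~` C) x)) <= K * l2norm (E (~` C) x) ->
  l2norm (T x) <= K * l2norm x.
Proof.
move=> mC K0; rewrite (E_C bT hE)// => h1 h2.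
have oC := E_proj hE mC.
rewrite -(@ler_pXn2r _ 2)// ?nnegrE ?mulr_ge0 ?l2norm_ge0// exprMn.
rewrite (proj_pythagoras x oC) (proj_pythagoras (T x) oC) E_T// -(linB _ _ lT).
by rewrite mulrDr -!exprMn lerD// ler_pXn2r ?nnegrE ?mulr_ge0 ?l2norm_ge0.
Qed.

(* Quartering the square m times: on the range of a small cell around c the
   operator T is close to c. *)
Lemma square_bound (m : nat) (r a b w : R) A x : 0 <= r -> 0 <= w -> measurable A ->
  E A x = x ->
  (forall p, A p -> sp p -> [/\ `|p.1 - a| <= w, `|p.2 - b| <= w & normc (p.1 +i* p.2) <= r]) ->
  l2norm (T x) <= (r + 4 * w / 2 ^+ m) * l2norm x.
Proof.
elim: m => [|m ih] in a b w A x *; move=> r0 w0 mA Ax Ac.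
  have [[p [Ap spp]]|nAp] := pselect (exists p, A p /\ sp p); last first.
    rewrite -Ax (E_null bT hE)// ?(lin0 lT) ?l2norm0 ?mulr0// => p Ap spp.
    by apply: nAp; exists p.
  pose c := p.1 +i* p.2.
  have [p1 p2 pr] := Ac _ Ap spp.
  (* The reference point c is a point of the spectrum in the cell, so that |c| <= r; it need not be
     the centre, hence the half-width 2 w and the constant 4 w. *)
  have := @cell_bound A c (2 * w) x mA Ax.
  move=> /(_ _)/wrap[].
    move=> p' /Ac/[apply] -[]; move: p1 p2; rewrite /= !ler_norml.
    by do 4! (case/andP => ? ?); move=> _; split; apply/andP; split; lra.
  move=> h; rewrite -(subrK (c *: x) (T x)) (le_trans (l2normD _ _))//.
  rewrite addrC mulrDl lerD//; first by rewrite l2normZ ler_wpM2r ?l2norm_ge0.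
  by rewrite expr0 divr1 (le_trans h)//; lra.
have w2 : 4 * w / 2 ^+ m.+1 = 4 * (w / 2) / 2 ^+ m :> R.
  by rewrite exprS invfM; ring.
rewrite w2.
have w20 : 0 <= w / 2 by rewrite divr_ge0.
have K0 : 0 <= r + 4 * (w / 2) / 2 ^+ m :> R.
  by rewrite addr_ge0// divr_ge0// ?mulr_ge0// exprn_ge0.
have m1 := measurable_pcoord_le true a; have m2 := measurable_pcoord_le false b.
have m1C := measurableC m1; have m2C := measurableC m2.
have ran C D : measurable C -> measurable D ->
    E ((A `&` C) `&` D) (E D (E C x)) = E D (E C x).
  move=> mC mD; have mAC := measurableI _ _ mA mC.
  rewrite (E_I hE _ mAC mD) (projK _ (E_proj hE mD)) (E_I hE _ mA mC).
  rewrite (E_comm hE _ mC mD) (projK _ (E_proj hE mC)).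
  by rewrite (E_comm hE _ mA mD) (E_comm hE _ mA mC) Ax.
have cell C D a' b' : measurable C -> measurable D ->
    (forall p, A p -> sp p -> C p -> `|p.1 - a'| <= w / 2) ->
    (forall p, A p -> sp p -> D p -> `|p.2 - b'| <= w / 2) ->
    l2norm (T (E D (E C x))) <= (r + 4 * (w / 2) / 2 ^+ m) * l2norm (E D (E C x)).
  move=> mC mD Ca Db; apply: (ih a' b' (w / 2) (A `&` C `&` D)) => //; [|exact: ran|].
    by apply: measurableI => //; exact: measurableI.
  by move=> p [[Ap Cp] Dp] spp; split; [exact: Ca|exact: Db|have [] := Ac _ Ap spp].
have lea p : A p -> sp p -> p.1 <= a -> `|p.1 - (a - w / 2)| <= w / 2.
  by move=> Ap spp pa; have [+ _ _] := Ac _ Ap spp; rewrite !ler_norml => /andP[? ?]; lra.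
have gta p : A p -> sp p -> ~ (p.1 <= a) -> `|p.1 - (a + w / 2)| <= w / 2.
  move=> Ap spp /negP; rewrite -ltNge => pa; have [+ _ _] := Ac _ Ap spp.
  by rewrite !ler_norml => /andP[? ?]; lra.
have leb p : A p -> sp p -> p.2 <= b -> `|p.2 - (b - w / 2)| <= w / 2.
  by move=> Ap spp pb; have [_ + _] := Ac _ Ap spp; rewrite !ler_norml => /andP[? ?]; lra.
have gtb p : A p -> sp p -> ~ (p.2 <= b) -> `|p.2 - (b + w / 2)| <= w / 2.
  move=> Ap spp /negP; rewrite -ltNge => pb; have [_ + _] := Ac _ Ap spp.
  by rewrite !ler_norml => /andP[? ?]; lra.
by apply: (split_bound m1) => //; apply: (split_bound m2) => //; apply: cell; eauto.
Qed.

(** The spectrum in A lies in the square of half-width r around 0. The error of the m-fold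
    quartering vanishes as m grows, which leaves the sharp constant r, fit to be raised to the power
    n. *)
Lemma disc_bound (r : R) A x : 0 <= r -> measurable A -> E A x = x ->
  (forall p, A p -> sp p -> normc (p.1 +i* p.2) <= r) -> l2norm (T x) <= r * l2norm x.
Proof.
move=> r0 mA Ax Ar.
have h m : l2norm (T x) <= (r + 4 * r / 2 ^+ m) * l2norm x.
  apply: (@square_bound m r 0 0 r A) => // p Ap spp; have pr := Ar _ Ap spp.
  rewrite !subr0; split=> //; apply: le_trans pr.
    exact: (normc_Re (p.1 +i* p.2)).
  exact: (normc_Im (p.1 +i* p.2)).
have cv : (fun m => (r + 4 * r / 2 ^+ m) * l2norm x) @ \oo --> (r + 4 * r * 0) * l2norm x.
  apply: cvgMl; apply: cvgD; first exact: cvg_cst.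
  apply: cvgMr; under eq_fun do rewrite -exprVn.
  by apply: cvg_expr; rewrite ger0_norm// invf_lt1// ltr1n.
rewrite mulr0 addr0 in cv; rewrite -(cvg_lim _ cv)//.
by apply: limr_ge; [apply/cvg_ex; eexists; exact: cv|near=> m; exact: h].
Unshelve. all: by end_near. Qed.

Lemma E_setD_null A B x : measurable A -> measurable B -> E B x = 0 ->
  E A x = E (A `\` B) x.
Proof.
move=> mA mB Bx; rewrite -{1}(setUIDK A B) (E_U hE).
- by rewrite (E_I hE)// Bx (lin0 (E_lin mA)) add0r.
- exact: measurableI.
- exact: measurableD.
- by rewrite setDE setIACA setICr setI0.
Qed.

(** A singleton is a cell of half-width 0. *)
Lemma eigspace_ran (z : R[i]) x : E (to_plane [set z]) x = x -> T x = z *: x.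
Proof.
move=> zx; have := @cell_bound _ z 0 x (measurable_to_plane1 z) zx.
move=> /(_ _)/wrap[].
  by move=> [p1 p2] + _ => /= zE; rewrite -zE /= !subrr normr0.
rewrite mulr0 mul0r => h; apply/eqP; rewrite -subr_eq0; apply/eqP/l2norm_eq0/eqP.
by rewrite eq_le h l2norm_ge0.
Qed.

(** On the half-planes at distance e/2 from z the form of T cannot take the value prescribed by the
    eigenvalue equation, so their projections kill x. Outside these four half-planes and the point z
    there remains a punctured square, free of spectrum by isolation. *)
Lemma ran_eigspace (z : R[i]) (e : R) x : 0 < e ->
  (forall w, spectrum T w -> normc (w - z) < e -> w = z) ->
  T x = z *: x -> E (to_plane [set z]) x = x.
Proof.
move=> e0 iso Tx.
pose zc b := if b then Re z else Im z.
have tq b y : T y = z *: y -> tquad T b y = zc b * l2norm y ^+ 2.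
  rewrite /tquad => ->; rewrite innerZl inner_self.
  by case: b; move: (l2norm y ^+ 2) => N; rewrite !RIE /=; ring.
have e2 : 0 < e / 2 by rewrite divr_gt0.
have H1 b : E [set p | zc b + e / 2 <= pcoord b p] x = 0.
  set H := [set p | _]; have mH : measurable H by exact: measurable_pcoord_ge.
  set y := E H x; have Hy : E H y = y by exact: (projK x (E_proj hE mH)).
  have Ty : T y = z *: y by rewrite /y -E_T// Tx linZ//; exact: E_lin.
  have := tquad_ge bT hE (b := b) (c := zc b + e / 2) mH Hy (fun p Hp _ => Hp).
  rewrite tq// mulrDl gerDl pmulr_rle0// => y0.
  by apply/l2norm_eq0/eqP; rewrite -sqrf_eq0 eq_le y0 sqr_ge0.
have H2 b : E [set p | pcoord b p <= zc b - e / 2] x = 0.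
  set H := [set p | _]; have mH : measurable H by exact: measurable_pcoord_le.
  set y := E H x; have Hy : E H y = y by exact: (projK x (E_proj hE mH)).
  have Ty : T y = z *: y by rewrite /y -E_T// Tx linZ//; exact: E_lin.
  have := tquad_le bT hE (b := b) (c := zc b - e / 2) mH Hy (fun p Hp _ => Hp).
  rewrite tq// mulrBl lerBrDl gerDr pmulr_rle0// => y0.
  by apply/l2norm_eq0/eqP; rewrite -sqrf_eq0 eq_le y0 sqr_ge0.
have mz := measurable_to_plane1 z; have mzC := measurableC mz.
have mg b := measurable_pcoord_ge b (zc b + e / 2).
have ml b := measurable_pcoord_le b (zc b - e / 2).
have d1 := measurableD mzC (mg true).
have d2 := measurableD d1 (mg false).
have d3 := measurableD d2 (ml true).
have d4 := measurableD d3 (ml false).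
apply/eqP; rewrite eq_sym -subr_eq0 -(E_C bT hE)//; apply/eqP.
rewrite (E_setD_null mzC (mg true))// (E_setD_null d1 (mg false))//.
rewrite (E_setD_null d2 (ml true))// (E_setD_null d3 (ml false))//.
apply: (E_null bT hE) => // p [[[[nz h1] h2] h3] h4] spp; apply: nz.
apply: iso spp _; rewrite (le_lt_trans (normc_le_ReIm _))// !RIE [ltRHS]splitr.
move: h1 h2 h3 h4 => /= /negP + /negP + /negP + /negP; rewrite -!ltNge => h1 h2 h3 h4.
by rewrite ltrD// ltr_norml; apply/andP; split; lra.
Qed.

End SpectralCalculus.

(** * Spans and Gram-Schmidt *)

Section LinearAlgebra.
Variable R : realType.
Implicit Types (x y : l2 R) (V W : set (l2 R)).

Lemma subspaceZ V a x : lin_subspace V -> V x -> V (a *: x).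
Proof. by move=> [V0 VP] Vx; rewrite -[_ *: _]addr0; exact: VP. Qed.

Lemma subspaceD V x y : lin_subspace V -> V x -> V y -> V (x + y).
Proof. by move=> [V0 VP] Vx Vy; rewrite -[x]scale1r; exact: VP. Qed.

Lemma subspaceB V x y : lin_subspace V -> V x -> V y -> V (x - y).
Proof.
by move=> sV Vx Vy; apply: subspaceD => //; rewrite -scaleN1r; exact: subspaceZ.
Qed.

Lemma subspace_sum V (I : Type) (r : seq I) (P : pred I) (F : I -> l2 R) :
  lin_subspace V -> (forall i, P i -> V (F i)) -> V (\sum_(i <- r | P i) F i).
Proof.
move=> sV VF; elim/big_ind : _ => //; first by case: sV.
by move=> x y; exact: subspaceD.
Qed.

Lemma lspan_subspace s (v : nat -> l2 R) : lin_subspace (lspan s v).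
Proof.
split; first by exists (fun=> 0) => //; rewrite big1// => i _; rewrite scale0r.
move=> a _ _ [c _ <-] [d _ <-]; exists (fun i => a * c i + d i) => //.
rewrite scaler_sumr -big_split /=; apply: eq_bigr => i _.
by rewrite scalerDl scalerA.
Qed.

Lemma mem_lspan s (v : nat -> l2 R) i : (i < s)%N -> lspan s v (v i).
Proof.
move=> si; exists (fun j => (j == Ordinal si)%:R) => //.
rewrite (bigD1 (Ordinal si))//= eqxx scale1r big1 ?addr0// => j /negPf ->.
by rewrite scale0r.
Qed.

Lemma lspan_min s (v : nat -> l2 R) V : lin_subspace V ->
  (forall i, (i < s)%N -> V (v i)) -> lspan s v `<=` V.
Proof.
move=> sV Vv _ [c _ <-]; apply: subspace_sum => // i _.
by apply: subspaceZ => //; exact: Vv.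
Qed.

Lemma lspan_mono s t (v : nat -> l2 R) : (s <= t)%N -> lspan s v `<=` lspan t v.
Proof.
move=> st; apply: lspan_min; first exact: lspan_subspace.
by move=> i si; apply: mem_lspan; exact: leq_trans st.
Qed.

Lemma lspan_linear_inv s (v : nat -> l2 R) (T : l2 R -> l2 R) y : linear T ->
  lspan s (fun i => T (v i)) y -> exists2 x, lspan s v x & y = T x.
Proof.
move=> lT [c _ <-]; exists (\sum_(i < s) c i *: v i); first by exists c.
by rewrite lin_sum//; apply: eq_bigr => i _; rewrite linZ.
Qed.

(** The square matrix expressing the p_i through the w_j has independent rows, hence is
    invertible. *)
Lemma exchange d (p w : nat -> l2 R) : lin_indep d p ->
  (forall i, (i < d)%N -> lspan d w (p i)) -> lspan d w `<=` lspan d p.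
Proof.
move=> ip pw.
have /choice[a aE] (i : 'I_d) : exists a, p i = \sum_(j < d) a j *: w j.
  by have [a _ <-] := pw _ (ltn_ord i); exists a.
pose A := \matrix_(i < d, j < d) a i j : 'M[R[i]]_d.
have comb (c : 'I_d -> R[i]) :
    \sum_i c i *: p i = \sum_j ((\row_i c i) *m A) ord0 j *: w j.
  under eq_bigr => i _ do rewrite aE scaler_sumr.
  rewrite exchange_big /=; apply: eq_bigr => j _.
  rewrite mxE scaler_suml; apply: eq_bigr => i _.
  by rewrite !mxE scalerA.
have fA : row_free A.
  apply/row_freeP; apply/row_freeP; rewrite -kermx_eq0; apply/eqP/row_matrixP => i.
  rewrite row0; set r := row i _.
  have rA : r *m A = 0 by rewrite -row_mul mulmx_ker row0.
  apply/rowP => j; rewrite [RHS]mxE; apply: (ip (fun i => r ord0 i)).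
  rewrite comb (_ : \row_i _ = r); last by apply/rowP => i'; rewrite !mxE.
  by rewrite rA big1// => j' _; rewrite mxE scale0r.
have uA : A \in unitmx by rewrite -row_free_unit.
move=> _ [c _ <-]; exists (fun i => ((\row_i c i) *m invmx A) ord0 i) => //.
rewrite comb; apply: eq_bigr => j _.
rewrite (_ : \row_i _ = (\row_i c i) *m invmx A); last by apply/rowP => i'; rewrite !mxE.
by rewrite mulmxKV// mxE.
Qed.

Definition orthonormal d (q : nat -> l2 R) :=
  forall i j, (i < d)%N -> (j < d)%N -> inner (q i) (q j) = (i == j)%:R.

Lemma orthonormal_norm d q i : orthonormal d q -> (i < d)%N -> l2norm (q i) = 1.
Proof. by move=> oq id_; rewrite /l2norm oq// eqxx /= sqrtr1. Qed.

Lemma orthonormal_le d e q : (d <= e)%N -> orthonormal e q -> orthonormal d q.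
Proof. by move=> de oq i j id_ jd; apply: oq; exact: leq_trans de. Qed.

Lemma orthonormal_indep d q : orthonormal d q -> lin_indep d q.
Proof.
move=> oq c c0 i; have := congr1 (fun x => inner x (q i)) c0.
rewrite inner0l inner_suml (bigD1 i)//= innerZl oq// eqxx mulr1 big1 ?addr0//.
move=> j ji; rewrite innerZl oq// (_ : (j == i :> nat) = false) ?mulr0//.
by apply/negbTE.
Qed.

Definition gs_rest d (q : nat -> l2 R) p := p - \sum_(i < d) inner p (q i) *: q i.

Lemma gs_step d q p (r := gs_rest d q p) : orthonormal d q -> r != 0 ->
  orthonormal d.+1 (fun i => if (i < d)%N then q i else (l2norm r)^-1%:C *: r).
Proof.
move=> oq r0.
have rn : l2norm r != 0 by apply: contra_neq r0; exact: l2norm_eq0.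
have rq i : (i < d)%N -> inner r (q i) = 0.
  move=> id_; rewrite /r /gs_rest innerBl inner_suml (bigD1 (Ordinal id_))//= innerZl oq//.
  rewrite eqxx mulr1 big1 ?addr0 ?subrr// => j ji; rewrite innerZl oq//.
  by rewrite (_ : (j == i :> nat) = false) ?mulr0//; apply/negbTE.
have qr i : (i < d)%N -> inner (q i) r = 0 by move=> id_; rewrite innerC rq// conjC0.
move=> i j; rewrite !ltnS leq_eqVlt => /predU1P[->|id_]; rewrite leq_eqVlt => /predU1P[->|jd].
- rewrite ltnn eqxx innerZl innerZr inner_self conjE conjc_real -!rmorphM /=.
  by rewrite (_ : _ * _ = 1)//; field.
- by rewrite ltnn jd innerZl rq// mulr0 gtn_eqF.
- by rewrite ltnn id_ innerZr qr// mulr0 ltn_eqF.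
- by rewrite id_ jd oq.
Qed.

Lemma gs_rest_span d q p v : (forall i, (i < d)%N -> lspan i.+1 v (q i)) ->
  lspan d.+1 v p -> lspan d.+1 v (gs_rest d q p).
Proof.
move=> qv pv; have sV := lspan_subspace d.+1 v.
apply: subspaceB => //; apply: subspace_sum => // i _; apply: subspaceZ => //.
by apply: lspan_mono (qv _ (ltn_ord i)); rewrite ltnS ltnW.
Qed.

Lemma gram_schmidt d v : lin_indep d v ->
  exists2 q, orthonormal d q & forall i, (i < d)%N -> lspan i.+1 v (q i).
Proof.
elim: d => [|d ih] iv; first by exists (fun=> 0).
have [|q oq qv] := ih.
  move=> c c0 i.
  have := iv (fun j => if unlift ord_max j is Some j' then c j' else 0).
  rewrite big_ord_recr /= unlift_none scale0r addr0.
  under eq_bigr => j _.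
    rewrite (_ : widen_ord _ j = lift ord_max j); last first.
      by apply: val_inj; rewrite /= /bump leqNgt ltn_ord.
    rewrite liftK.
    over.
  by move=> /(_ c0 (lift ord_max i)); rewrite liftK.
pose r := gs_rest d q (v d).
have r0 : r != 0.
  apply/eqP => r0.
  have [c _ cE] : lspan d v (v d).
    rewrite (_ : v d = \sum_(i < d) inner (v d) (q i) *: q i); last by apply/eqP; rewrite -subr_eq0; apply/eqP.
    have sV := lspan_subspace d v; apply: subspace_sum => // i _.
    by apply: subspaceZ => //; apply: lspan_mono (qv _ (ltn_ord i)).
  have := iv (fun j => if unlift ord_max j is Some j' then - c j' else 1).
  rewrite big_ord_recr /= unlift_none scale1r -cE.
  under eq_bigr => j _.
    rewrite (_ : widen_ord _ j = lift ord_max j); last first.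
      by apply: val_inj; rewrite /= /bump leqNgt ltn_ord.
    rewrite liftK scaleNr.
    over.
  rewrite sumrN addrC subrr => /(_ erefl ord_max); rewrite unlift_none.
  by move/eqP; rewrite oner_eq0.
exists (fun i => if (i < d)%N then q i else (l2norm r)^-1%:C *: r); first exact: gs_step.
move=> i; rewrite ltnS leq_eqVlt => /predU1P[->|id_]; last by rewrite id_; exact: qv.
rewrite ltnn; apply: subspaceZ; first exact: lspan_subspace.
by apply: gs_rest_span => //; exact: mem_lspan.
Qed.

(** When the Gram matrix is close to the identity, Gram-Schmidt hardly moves the vectors. The bound
    h is chosen before the vectors, which makes the statement uniform. *)
Lemma gram_schmidt_stable d (e : R) : 0 < e -> exists2 h : R, 0 < h &
  forall p, (forall i j, (i < d)%N -> (j < d)%N ->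
     normc (inner (p i) (p j) - (i == j)%:R) <= h) ->
  exists2 q, orthonormal d q &
    forall i, (i < d)%N -> lspan i.+1 p (q i) /\ l2norm (q i - p i) <= e.
Proof.
elim: d e => [|d ih] e e0; first by exists 1 => // p _; exists (fun=> 0).
pose m := Num.min e (1 / 2); have m0 : 0 < m by rewrite lt_min e0 divr_gt0.
(* Removing the first d components moves p_d by at most 3 d e1, and normalizing by at most h + 3 d
   e1, with h <= e1: in total (6 d + 1) e1 = m. The bound m <= 1/2 keeps the remainder away from
   0. *)
pose e1 := m / (6 * d%:R + 1).
have d0 : 0 <= d%:R :> R by exact: ler0n.
have e10 : 0 < e1 by rewrite divr_gt0// ltr_wpDl// mulr_ge0.
have e1m : (6 * d%:R + 1) * e1 = m by rewrite mulrC divfK// gt_eqF// ltr_wpDl// mulr_ge0.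
have me : m <= e by rewrite ge_min lexx.
have m2 : m <= 1 / 2 by rewrite ge_min lexx orbT.
have [h1 h10 hyp] := ih e1 e10.
exists (Num.min h1 e1); first by rewrite lt_min h10.
set h := Num.min h1 e1 => p ph.
have he1 : h <= e1 by rewrite ge_min lexx orbT.
have [|q oq qp] := hyp p.
  by move=> i j id_ jd; rewrite (le_trans (ph _ _ (ltnW id_) (ltnW jd)))// ge_min lexx.
have pn : `|l2norm (p d) - 1| <= h.
  have := ph d d (ltnSn _) (ltnSn _); rewrite eqxx inner_self -[true%:R]/(1%:C) -rmorphB normcR.
  rewrite subr_sqr_1 normrM; apply: le_trans; rewrite ler_peMr//.
  by rewrite (le_trans _ (ler_norm _))// lerDr l2norm_ge0.
have h0 : 0 <= h by rewrite (le_trans _ pn).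
have pd2 : l2norm (p d) <= 2.
  by move: pn; rewrite ler_norml => /andP[_]; nra.
pose r := gs_rest d q (p d).
have rp : l2norm (r - p d) <= 3 * d%:R * e1.
  rewrite /r /gs_rest addrAC subrr add0r l2normN (le_trans (l2norm_sum _ _ _))//.
  rewrite (_ : 3 * _ * _ = \sum_(i < d) (3 * e1)); last first.
    by rewrite sumr_const card_ord -mulr_natr; ring.
  apply: ler_sum => i _; rewrite l2normZ (orthonormal_norm oq)// mulr1.
  rewrite -(subrK (p i) (q i)) innerDr (le_trans (ler_normcD _ _))//.
  (* The coefficient of q_i is <p_d, q_i - p_i> + <p_d, p_i>, where |p_d| <= 2 and the second term
     is an entry of the Gram matrix off the diagonal. *)
  have -> : 3 * e1 = 2 * e1 + e1 by ring.
  apply: lerD.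
    rewrite (le_trans (CauchySchwarz _ _))// ler_pM ?l2norm_ge0//.
    by have [] := qp _ (ltn_ord i).
  have := ph d i (ltnSn _) (ltnW (ltn_ord i)).
  by rewrite gtn_eqF// subr0 => /le_trans; apply.
have rn : `|l2norm r - 1| <= h + 3 * d%:R * e1.
  have := l2normD (r - p d) (p d); rewrite subrK => t1.
  have := l2normD (p d - r) r; rewrite subrK l2normB => t2.
  by move: pn; rewrite !ler_norml => /andP[? ?]; apply/andP; split; lra.
have rpos : 0 < l2norm r.
  by move: rn; rewrite ler_norml => /andP[? ?]; nra.
have r0 : r != 0 by apply/eqP => r0; move: rpos; rewrite r0 l2norm0 ltxx.
exists (fun i => if (i < d)%N then q i else (l2norm r)^-1%:C *: r); first exact: gs_step.
move=> i; rewrite ltnS leq_eqVlt => /predU1P[->|id_]; last first.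
  rewrite id_; have [? qe] := qp i id_; split=> //; rewrite (le_trans qe)//.
  by rewrite (le_trans _ me)// -e1m; nra.
rewrite ltnn; split.
  apply: subspaceZ; first exact: lspan_subspace.
  apply: gs_rest_span; last exact: mem_lspan.
  by move=> j jd; have [] := qp j jd.
have rr : l2norm ((l2norm r)^-1%:C *: r - r) = `|l2norm r - 1|.
  rewrite -[X in _ - X]scale1r -scalerBl -[1]/(1%:C) -rmorphB l2normZ normcR.
  rewrite -{2}(ger0_norm (ltW rpos)) -normrM distrC mulrBl mul1r mulVf//.
  by rewrite gt_eqF.
rewrite (le_trans (l2norm_dist _ r _))// rr (le_trans (lerD rn rp))//.
by rewrite (le_trans _ me)// -e1m; nra.
Qed.

Lemma orthonormal_approx d (e : R) : 0 < e -> exists2 h : R, 0 < h &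
  forall q p, orthonormal d q -> (forall i, (i < d)%N -> l2norm (p i - q i) <= h) ->
  exists2 q', orthonormal d q' &
    forall i, (i < d)%N -> lspan i.+1 p (q' i) /\ l2norm (q' i - q i) <= e.
Proof.
move=> e0; have e2 : 0 < e / 2 by rewrite divr_gt0.
have [h h0 gs] := gram_schmidt_stable d e2.
(* An error m in each vector changes an entry of the Gram matrix by at most 2 m + m, since |p_j| <=
   2 and |q_i| = 1. *)
pose m := Num.min 1 (Num.min (h / 3) (e / 2)).
have m0 : 0 < m by rewrite !lt_min ltr01 divr_gt0.
have m1 : m <= 1 by rewrite ge_min lexx.
have mh : m <= h / 3 by rewrite !ge_min lexx orbT.
have me : m <= e / 2 by rewrite !ge_min lexx !orbT.
exists m => // q p oq pq.
have [|q' oq' q'p] := gs p.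
  move=> i j id_ jd; rewrite -(oq i j id_ jd).
  have -> : inner (p i) (p j) - inner (q i) (q j) =
      inner (p i - q i) (p j) + inner (q i) (p j - q j).
    by rewrite innerBl innerBr; ring.
  have pj : l2norm (p j) <= 2.
    rewrite -(subrK (q j) (p j)) (le_trans (l2normD _ _))//.
    by rewrite (orthonormal_norm oq)// lerD2r (le_trans (pq _ jd)).
  have qi := orthonormal_norm oq id_; have := pq _ id_; have := pq _ jd.
  have := CauchySchwarz (p i - q i) (p j); have := CauchySchwarz (q i) (p j - q j).
  have := ler_normcD (inner (p i - q i) (p j)) (inner (q i) (p j - q j)).
  have := l2norm_ge0 (p i - q i); rewrite qi.
  move: (l2norm _) (l2norm _) (l2norm _) pj (normc _) (normc _) (normc _).
  by move=> a b c' *; nra.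
exists q' => // i id_; have [? q'e] := q'p i id_; split=> //.
rewrite (le_trans (l2norm_dist _ (p i) _))// (le_trans (lerD q'e (pq i id_)))//.
by rewrite [leRHS]splitr lerD2l.
Qed.

(** The correction is applied to the blocks of B, whose sizes are unknown when h is chosen; all
    sizes up to k are served by one h. *)
Lemma orthonormal_approx_uniform k (e : R) : 0 < e -> exists2 h : R, 0 < h &
  forall d q p, (d <= k)%N -> orthonormal d q ->
  (forall i, (i < d)%N -> l2norm (p i - q i) <= h) ->
  exists2 q', orthonormal d q' &
    forall i, (i < d)%N -> lspan i.+1 p (q' i) /\ l2norm (q' i - q i) <= e.
Proof.
move=> e0; elim: k => [|k [h h0 ih]].
  have [h h0 ih] := orthonormal_approx 0 e0; exists h => // d q p.
  by rewrite leqn0 => /eqP ->; exact: ih.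
have [h' h'0 ih'] := orthonormal_approx k.+1 e0.
exists (Num.min h h'); first by rewrite lt_min h0.
move=> d q p; rewrite leq_eqVlt => /predU1P[->|dk] oq pq.
  by apply: ih' => // i /pq/le_trans; apply; rewrite ge_min lexx orbT.
by apply: ih => // i /pq/le_trans; apply; rewrite ge_min lexx.
Qed.

End LinearAlgebra.

(** * Dominant eigenspaces of an operator of the class *)

Section OrthProj.
Variable R : realType.
Implicit Types (x y z : l2 R) (V W : set (l2 R)).

Lemma orth_projP V x : orth_proj V x = 0 \/
  (V (orth_proj V x) /\ forall z, V z -> inner (x - orth_proj V x) z = 0).
Proof. by rewrite /orth_proj; case: xgetP => [y _ [Vy h]|_]; [right|left]. Qed.

(* Both projections lie on the sphere with diameter [0, x]; so does the junk value
   0 that orth_proj takes when there is no projection. *)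
Lemma orth_proj_dist V W x : l2norm (orth_proj V x - orth_proj W x) <= l2norm x.
Proof.
have sphere U : l2norm (2%:R *: orth_proj U x - x) = l2norm x.
  have [->|[Uy h]] := orth_projP U x; first by rewrite scaler0 add0r l2normN.
  set y := orth_proj U x in Uy h *.
  apply/eqP; rewrite -(@eqrXn2 _ 2)// ?l2norm_ge0//; apply/eqP.
  have e1 : 2%:R *: y - x = y + (y - x) by rewrite scaler_nat mulr2n addrA.
  have e2 : x = y - (y - x) by rewrite opprB addrC subrK.
  have orth : inner y (y - x) = 0.
    by rewrite -[y - x]opprB innerNr innerC h// conjC0 oppr0.
  have orthN : inner y (- (y - x)) = 0 by rewrite innerNr orth oppr0.
  by rewrite e1 (pythagoras orth) [in RHS]e2 (pythagoras orthN) l2normN.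
have := l2normD (2%:R *: orth_proj V x - x) (- (2%:R *: orth_proj W x - x)).
rewrite l2normN !sphere opprB addrA subrK -scalerBr l2normZ.
rewrite (_ : normc 2%:R = 2); last by rewrite -(rmorph_nat (real_complex R)) normcR ger0_norm.
by move: (l2norm _) (l2norm _) => a b; lra.
Qed.

Lemma orth_proj_unique V x y : lin_subspace V -> V y ->
  (forall z, V z -> inner (x - y) z = 0) -> orth_proj V x = y.
Proof.
move=> sV Vy h; set y' := orth_proj V x.
have [Vy' h'] : V y' /\ forall z, V z -> inner (x - y') z = 0.
  by apply: (@xgetPex _ 0 [set y | V y /\ forall z, V z -> inner (x - y) z = 0]); exists y.
have Vd := subspaceB sV Vy' Vy.
apply/eqP; rewrite -subr_eq0; apply/eqP/l2norm_eq0/eqP.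
rewrite -sqrf_eq0 -[_ ^+ 2]ReC -inner_self.
rewrite {1}(_ : y' - y = (x - y) - (x - y')); last first.
  by apply: l2_ext => i; rewrite !(l2D, l2N); ring.
by rewrite innerBl h// h'// subrr.
Qed.

Lemma orth_proj_id V x : lin_subspace V -> V x -> orth_proj V x = x.
Proof.
by move=> sV Vx; apply: orth_proj_unique => // z _; rewrite subrr inner0l.
Qed.

(** The bound by 1, valid also for junk projections, makes the supremum meaningful and puts it in
    the domain of [asin]. *)
Lemma delta_bound V W : 0 <= delta V W <= 1 /\ forall x, l2norm x <= 1 ->
  l2norm (orth_proj V x - orth_proj W x) <= delta V W.
Proof.
have sne : [set l2norm (orth_proj V x - orth_proj W x) | x in [set x | l2norm x <= 1]]
    (l2norm (orth_proj V 0 - orth_proj W 0)).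
  by exists 0 => //=; rewrite l2norm0.
have ub1 : ubound [set l2norm (orth_proj V x - orth_proj W x) | x in [set x | l2norm x <= 1]] 1.
  by move=> _ [x /= x1 <-]; rewrite (le_trans (orth_proj_dist _ _ _)).
have dP x : l2norm x <= 1 -> l2norm (orth_proj V x - orth_proj W x) <= delta V W.
  by move=> x1; apply: (@ub_le_sup _ _ _); [exists 1|exists x].
split=> //; apply/andP; split; last by apply: ge_sup; [eexists; exact: sne|].
by rewrite (le_trans _ (dP 0 _)) ?l2norm_ge0// l2norm0.
Qed.

Lemma Pm_trunc n x : Pm n x = trunc_l2 n x.
Proof.
apply: orth_proj_unique; first exact: lspan_subspace.
  by exists (fun i => x i).
move=> z [c _ <-]; rewrite inner_sumr big1// => i _.
by rewrite innerZr inner_ebasis l2D l2N trunc_l2E ltn_ord subrr mulr0.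
Qed.

End OrthProj.

Lemma proj_ran_subspace (R : realType) (P : l2 R -> l2 R) : orth_projector P ->
  lin_subspace [set x | P x = x].
Proof.
move=> /proj_lin lP; split=> [|a u v /= Pu Pv]; first exact: lin0.
by rewrite (linD _ _ lP) (linZ _ _ lP) Pu Pv.
Qed.

Lemma chi_spectral (R : realType) (T : l2 R -> l2 R) (k N : nat) lam m :
  (0 < k)%N -> independence T k N lam m ->
  exists2 E, spectral_measure T E & forall S, chi T S = E (to_plane S).
Proof.
move=> k0 [_ ind]; exists (xget (fun _ _ => 0) (spectral_measure T)) => //.
case: xgetP => [//|nE]; exfalso.
have chi0 S x : chi T S x = 0 by rewrite /chi xgetPN//; move=> y /nE.
have := ind (fun=> 1); rewrite big1; last by move=> i _; rewrite chi0 scaler0.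
by move=> /(_ erefl (Ordinal k0))/eqP; rewrite oner_eq0.
Qed.

(** * Power iteration and the dominant eigenspaces of a single operator *)

Section OneOperator.
Variables (R : realType) (k : nat) (t L : R).
Variables (T : l2 R -> l2 R) (N : nat) (lam : nat -> R[i]) (m : nat -> option nat).
Variables (EN : set (l2 R)) (E : set (plane R) -> l2 R -> l2 R).
Hypotheses (t0 : 0 < t) (L0 : 0 < L) (bT : bounded_op T).
Hypotheses (hE : spectral_measure T E) (dom : dominant_part T k N lam m).
Hypotheses (ratet : rate T N lam <= t) (ENeig : EN `<=` eigspace T (lam N.-1)).
Hypotheses (Phi2 : Phi T k N lam m EN < pi / 2) (tanPhi : tan (Phi T k N lam m EN) <= L).
Implicit Types (x y u v : l2 R).

Local Notation sp := (to_plane (spectrum T)).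
Local Notation EO l := (E (to_plane (omega l lam))).
Local Notation E1 l := (E (to_plane [set lam l])).

Let lT : linear T. Proof. exact: bT.1. Qed.
Let mO l : measurable (to_plane (omega l lam)). Proof. exact: measurable_finite_to_plane. Qed.
Let m1 l : measurable (to_plane [set lam l]). Proof. exact: measurable_to_plane1. Qed.
Let oO l : orth_projector (EO l). Proof. exact: E_proj hE _ (mO l). Qed.
Let o1 l : orth_projector (E1 l). Proof. exact: E_proj hE _ (m1 l). Qed.
Let N0 : (0 < N)%N. Proof. by case: dom. Qed.

Let L0' : 0 <= L. Proof. exact: ltW. Qed.
Let t0' : 0 <= t. Proof. exact: ltW. Qed.

Lemma E1_eig i x : (i < N)%N -> E1 i x = x <-> T x = lam i *: x.
Proof.
move=> iN; split; first exact: eigspace_ran hE _ _.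
case: dom => _ /(_ i iN)[[_ [e e0 iso]] _] _ _ _.
exact: ran_eigspace e0 iso.
Qed.

Lemma T_E1 i x : T (E1 i x) = lam i *: E1 i x.
Proof. by apply: (eigspace_ran bT hE); exact: projK (o1 i). Qed.

Lemma normc_lam_lt i j : (i < j < N)%N -> normc (lam j) < normc (lam i).
Proof.
case: dom => _ _ dec _ _.
elim: j => [|j ih] /andP[]; first by rewrite ltn0.
rewrite ltnS leq_eqVlt => /predU1P[->|ij] jN; first by have [] := dec j jN.
by rewrite (lt_trans (dec j jN).1)// ih// ij ltnW.
Qed.

Lemma normc_lam_le i j : (i <= j < N)%N -> normc (lam j) <= normc (lam i).
Proof.
move=> /andP[]; rewrite leq_eqVlt => /predU1P[->//|ij] jN.
by rewrite ltW// normc_lam_lt// ij.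
Qed.

Lemma EO0 x : EO 0 x = 0.
Proof.
rewrite (_ : to_plane _ = set0) ?(E_set0 hE)//.
by apply/seteqP; split => // p [].
Qed.

Lemma EOS l x : (l < N)%N -> EO l.+1 x = EO l x + E1 l x.
Proof.
move=> lN; rewrite -(E_U hE)//.
  congr E; apply/seteqP; split => p.
    move=> [i /=]; rewrite ltnS leq_eqVlt => /predU1P[->|il] ip; [right|left] => //.
    by exists i.
  by move=> [[i /= il ip]|/= ip]; [exists i => //=; exact: ltnW|exists l => //=].
apply/seteqP; split => // p [[i /= il ip] /= pl].
by have := @normc_lam_lt i l; rewrite il lN ip pl ltxx => /(_ isT).
Qed.

Lemma EO_T l x : EO l (T x) = T (EO l x).
Proof. exact: (E_T bT hE). Qed.

Lemma EO_iter l n x : EO l (iter n T x) = iter n T (EO l x).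
Proof. by elim: n => //= n ih; rewrite EO_T ih. Qed.

(** Peels off the last eigenvalue: T respects the orthogonal splitting into its eigenspace and the
    earlier ones, so the lower bounds add in squares. *)
Lemma EO_lower l c x : (l <= N)%N -> 0 <= c -> (forall i, (i < l)%N -> c <= normc (lam i)) ->
  EO l x = x -> c * l2norm x <= l2norm (T x).
Proof.
move=> + c0; elim: l x => [|l ih] x lN ci xl.
  by rewrite -xl EO0 (lin0 lT) l2norm0 mulr0.
have xE : x - E1 l x = EO l x by rewrite -{1}xl EOS// addrK.
rewrite -(@ler_pXn2r _ 2)// ?nnegrE ?mulr_ge0 ?l2norm_ge0// exprMn.
rewrite (proj_pythagoras x (o1 l)) (proj_pythagoras (T x) (o1 l)).
rewrite (E_T bT hE)// -(linB _ _ lT) xE T_E1 l2normZ mulrDr -!exprMn.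
rewrite lerD// ler_pXn2r ?nnegrE ?mulr_ge0 ?l2norm_ge0 ?normc_ge0//.
  by rewrite ler_wpM2r ?l2norm_ge0// ci.
apply: ih; [exact: ltnW| |exact: projK].
by move=> i il; apply: ci; exact: leq_trans il _.
Qed.

Lemma EO_lower_iter l n x : (0 < l <= N)%N -> EO l x = x ->
  normc (lam l.-1) ^+ n * l2norm x <= l2norm (iter n T x).
Proof.
move=> /andP[l0 lN] xl; elim: n => [|n ih]; first by rewrite mul1r.
rewrite exprS -mulrA (le_trans (ler_wpM2l _ ih)) ?normc_ge0//=.
apply: (@EO_lower l) => //; first exact: normc_ge0.
- move=> i il; apply: normc_lam_le; move: il l0 lN; clear; lia.
- by rewrite EO_iter xl.
Qed.

(** The radius of the spectrum that remains once the first l eigenvalues are removed. *)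
Definition tail_radius l := if (l < N)%N then normc (lam l) else rho T N lam.

Lemma rho_ub z : spectrum T z -> ~ omega N lam z -> normc z <= rho T N lam.
Proof.
move=> zs zo; have [C C0 TC] := bounded_op_ge0 bT.
apply: ub_le_sup; last by exists z.
by exists C => _ [w [ws _] <-]; exact: spectrum_bounded ws.
Qed.

Lemma rho_ge0 : 0 <= rho T N lam.
Proof.
rewrite /rho; set S := [set _ | _ in _].
have [->|/set0P[_ [z [zs zo] _]]] := eqVneq S set0; first by rewrite sup0.
by rewrite (le_trans _ (rho_ub zs zo))// normc_ge0.
Qed.

Lemma tail_radius_ge0 l : 0 <= tail_radius l.
Proof. by rewrite /tail_radius; case: ifP; rewrite ?normc_ge0 ?rho_ge0. Qed.

Lemma tail_bound l x : (l <= N)%N -> EO l x = 0 -> l2norm (T x) <= tail_radius l * l2norm x.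
Proof.
move=> lN xl; apply: (disc_bound bT hE (A := ~` to_plane (omega l lam))) => //.
- exact: tail_radius_ge0.
- exact: measurableC.
- by rewrite (E_C bT hE)// xl subr0.
move=> p npl psp; rewrite /tail_radius.
have [[i /= iN ip]|npN] := pselect (omega N lam (p.1 +i* p.2)).
  have li : (l <= i)%N by rewrite leqNgt; apply/negP => il; apply: npl; exists i.
  rewrite (leq_ltn_trans li)//; apply: (@le_trans _ _ (normc (lam i))).
    by rewrite ip.
  by apply: normc_lam_le; rewrite li.
have pr := rho_ub psp npN; case: ifP => // lN'.
rewrite (le_trans pr)//; case: dom => _ _ _ rl _; rewrite (le_trans (ltW rl))//.
by apply: normc_lam_le; move: lN' N0; clear; lia.
Qed.

Lemma tail_bound_iter l n x : (l <= N)%N -> EO l x = 0 ->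
  l2norm (iter n T x) <= tail_radius l ^+ n * l2norm x.
Proof.
move=> lN xl; elim: n => [|n ih]; first by rewrite mul1r.
have z : EO l (iter n T x) = 0 by rewrite EO_iter xl; exact: lin0 (linear_iter n lT).
by rewrite exprS -mulrA /= (le_trans (tail_bound lN z))// ler_wpM2l ?tail_radius_ge0.
Qed.

Lemma lam_gt0 i : (i < N)%N -> 0 < normc (lam i).
Proof.
move=> iN; case: dom => _ _ _ rl _; have := rho_ge0 => r0.
rewrite (lt_le_trans (le_lt_trans r0 rl))//; apply: normc_lam_le.
by move: iN N0; clear; lia.
Qed.

Lemma tail_radius_rate l : (0 < l <= N)%N -> tail_radius l <= t * normc (lam l.-1).
Proof.
move=> /andP[l0 lN]; have lam0 := @lam_gt0 l.-1; rewrite prednK// in lam0.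
rewrite -ler_pdivrMr ?lam0// /tail_radius.
move: ratet; rewrite /rate ge_max => /andP[r1 r2].
move: lN; rewrite leq_eqVlt => /predU1P[lN|lN]; first by rewrite lN ltnn.
rewrite lN -normcV -normcM (le_trans _ r1)//.
have lN1 : (l.-1 < N.-1)%N by move: l0 lN; clear; lia.
have := @le_bigmax _ _ _ 0 (fun i : 'I_N.-1 => normc (lam i.+1 / lam i)) (Ordinal lN1).
by rewrite /= prednK.
Qed.

(** Before the last block all multiplicities are finite and their sum stays below k, so neither the
    infinite case nor the minimum is reached. *)
Lemma cutoff_lt l : (l < N)%N -> cutoff k m l = mult_sum m l.
Proof.
move=> lN; case: dom => _ _ fin _ [mk _].
have -> : cutoff k m l = minn (mult_sum m l) k.
  rewrite /cutoff; case: ifP => // /negP[]; apply/forallP => i.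
  by have [] := fin i; rewrite // (leq_ltn_trans (ltn_ord i)).
apply/minn_idPl; apply: leq_trans (ltnW mk).
rewrite /mult_sum -!(big_mkord xpredT (fun i => odflt 0%N (m i))).
by rewrite (@big_cat_nat _ _ _ l 0 N.-1)//= ?leq_addr// -ltnS prednK.
Qed.

Lemma cutoffN : cutoff k m N = k.
Proof.
rewrite /cutoff; case: dom => _ _ _ _ [_ mk]; case: ifP => // /mk.
by move/minn_idPr.
Qed.

Lemma cutoff0 : cutoff k m 0 = 0%N.
Proof. by rewrite cutoff_lt// /mult_sum big_ord0. Qed.

Lemma cutoffS l : (l < N)%N -> (cutoff k m l <= cutoff k m l.+1)%N.
Proof.
move=> lN; move: (lN); rewrite leq_eqVlt => /predU1P[lN'|lN']; first rewrite lN'.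
  case: dom => _ _ _ _ [mk _]; rewrite cutoffN cutoff_lt//; move: mk.
  by rewrite -{1}lN' /= => /ltnW.
by rewrite !cutoff_lt// /mult_sum big_ord_recr leq_addr.
Qed.

Lemma sum_subspaces_EO l x : (l <= N)%N -> sum_subspaces l (Espace T N lam EN) x -> EO l x = x.
Proof.
move=> lN [y yE ->]; rewrite (lin_sum _ _ _ (proj_lin (oO l))).
apply: eq_bigr => i _; have il := ltn_ord i.
have iN : (i < N)%N by exact: leq_trans lN.
have /(E1_eig _ iN) <- : T (y i) = lam i *: y i.
  by have := yE i il; rewrite /Espace; case: eqP => [->/ENeig|].
by apply: (E_subr hE) => //; move=> p ip; exists i.
Qed.

Local Notation sn := (sin (Phi T k N lam m EN)).
Local Notation cs := (cos (Phi T k N lam m EN)).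

(** The angle of index l is nonnegative and below the supremum Phi < pi/2, where sin is monotone.
    The same bounds on Phi give the positive cosine. *)
Lemma delta_le_sin l : (0 < l <= N)%N ->
  delta (sum_subspaces l (Espace T N lam EN)) (lspan (cutoff k m l) (ebasis R)) <= sn /\
  0 < cs.
Proof.
move=> lN; set d := delta _ _.
have dI W V : -1 <= @delta R W V <= 1.
  by have [/andP[d0 ->] _] := @delta_bound R W V; rewrite (le_trans _ d0)// lerN10.
have dIn : d \in `[-1, 1] by rewrite in_itv /= dI.
have aP : asin d <= Phi T k N lam m EN.
  apply: ub_le_sup; last by exists l.
  exists (pi / 2) => _ [j _ <-]; apply: asin_lepi2; exact: dI.
have d0 : 0 <= d by have [/andP[]] := delta_bound (sum_subspaces l (Espace T N lam EN)) (lspan (cutoff k m l) (ebasis R)).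
have aI : asin d \in `[(- (pi / 2)), (pi / 2)].
  by rewrite in_itv /= asin_geNpi2 ?asin_lepi2.
have pi20 : 0 < pi / 2 :> R by rewrite divr_gt0// pi_gt0.
have zI : (0 : R) \in `[(- (pi / 2)), (pi / 2)] by rewrite in_itv /= oppr_le0 !ltW.
have a0 : 0 <= asin d.
  by rewrite leNgt -(ltr_sin aI zI) sin0 (asinK dIn) -leNgt.
have PI : Phi T k N lam m EN \in `[(- (pi / 2)), (pi / 2)].
  by rewrite in_itv /= (le_trans _ (le_trans a0 aP)) ?oppr_le0 1?ltW.
split; last first.
  by apply: cos_gt0_pihalf; rewrite Phi2 (lt_le_trans _ (le_trans a0 aP))// oppr_lt0.
by rewrite -[leLHS](asinK dIn) leNgt (ltr_sin PI aI) -leNgt.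
Qed.

(** With P = [EO l], the gap gives |v - P v| <= sin Phi |v|. By Pythagoras this reads cos Phi |v - P
    v| <= sin Phi |P v|, and tan Phi <= L concludes. *)
Lemma Vl_bound l v : (0 < l <= N)%N -> lspan (cutoff k m l) (ebasis R) v ->
  l2norm (v - EO l v) <= L * l2norm (EO l v).
Proof.
move=> lN Vv; have [ds c0] := delta_le_sin lN.
have sL : sn <= L * cs by rewrite -ler_pdivrMr//; exact: tanPhi.
have s0 : 0 <= sn.
  by rewrite (le_trans _ ds)//; have [/andP[]] := delta_bound (sum_subspaces l (Espace T N lam EN)) (lspan (cutoff k m l) (ebasis R)).
have vs : l2norm (v - EO l v) <= sn * l2norm v.
  have [v0|v0] := eqVneq (l2norm v) 0.
    by rewrite (l2norm_eq0 v0) (lin0 (proj_lin (oO l))) subrr l2norm0 mulr0.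
  have vp : 0 < l2norm v by rewrite lt0r v0 l2norm_ge0.
  pose v1 := (l2norm v)^-1%:C *: v.
  have v1n : l2norm v1 = 1 by rewrite l2normZ normcR ger0_norm ?invr_ge0 ?l2norm_ge0// mulVf.
  have Vv1 : lspan (cutoff k m l) (ebasis R) v1 by apply: subspaceZ => //; exact: lspan_subspace.
  set W := sum_subspaces l (Espace T N lam EN) in ds.
  (* The projection to W, or its junk value 0, lies in the range of [EO l], so [EO l v1] is at least
     as close to v1. *)
  have Wy : EO l (orth_proj W v1) = orth_proj W v1.
    have [->|[Wy _]] := orth_projP W v1; first exact: lin0 (proj_lin (oO l)).
    by apply: sum_subspaces_EO => //; case/andP: lN.
  have := proj_dist_le v1 (oO l) Wy.
  rewrite -{3}(orth_proj_id (lspan_subspace _ _) Vv1) [leRHS]l2normB => h.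
  have [_ /(_ v1)] := delta_bound W (lspan (cutoff k m l) (ebasis R)).
  rewrite v1n => /(_ (lexx _)) h2.
  have := le_trans h (le_trans h2 ds); rewrite (linZ _ _ (proj_lin (oO l))) -scalerBr l2normZ normcR.
  by rewrite ger0_norm ?invr_ge0 ?l2norm_ge0// mulrC ler_pdivrMr.
have v2 := proj_pythagoras v (oO l).
have sc : sn ^+ 2 + cs ^+ 2 = 1 by rewrite addrC cos2Dsin2.
have h : l2norm (v - EO l v) ^+ 2 <= sn ^+ 2 * l2norm v ^+ 2.
  by rewrite -exprMn ler_pXn2r ?nnegrE ?mulr_ge0 ?l2norm_ge0.
have h1 : cs ^+ 2 * l2norm (v - EO l v) ^+ 2 <= cs ^+ 2 * (L * l2norm (EO l v)) ^+ 2.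
  have h2 : cs ^+ 2 * l2norm (v - EO l v) ^+ 2 <= sn ^+ 2 * l2norm (EO l v) ^+ 2.
    move: h; rewrite v2; have -> : cs ^+ 2 = 1 - sn ^+ 2 by rewrite -sc addrAC subrr add0r.
    by rewrite mulrBl mul1r mulrDr lerBlDr.
  rewrite (le_trans h2)// (_ : cs ^+ 2 * _ = (L * cs) ^+ 2 * l2norm (EO l v) ^+ 2); last by ring.
  rewrite ler_wpM2r ?sqr_ge0// ler_pXn2r ?nnegrE//.
  by rewrite mulr_ge0// ltW.
rewrite -(@ler_pXn2r _ 2)// ?nnegrE ?mulr_ge0 ?l2norm_ge0//.
by rewrite -(ler_pM2l (exprn_gt0 2 c0)).
Qed.

(** Write u = T^n v. The part of v off the dominant subspace grows at most like [tail_radius l] to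
    the n, the part inside at least like |lam_(l-1)|^n, and the ratio of the bases is at most t; the
    initial ratio is at most L. *)
Lemma contraction l n u : (0 < l <= N)%N ->
  lspan (cutoff k m l) (fun j => iter n T (ebasis R j)) u ->
  l2norm (u - EO l u) <= L * t ^+ n * l2norm (EO l u).
Proof.
move=> lN /(lspan_linear_inv (linear_iter n lT))[v Vv ->].
have lN' : (l <= N)%N by case/andP: lN.
rewrite EO_iter -(linB _ _ (linear_iter n lT)).
have h1 := tail_bound_iter n lN' (proj_compl v (oO l)).
have h2 := EO_lower_iter n lN (projK v (oO l)).
have h3 := Vl_bound lN Vv; have h4 := tail_radius_rate lN.
rewrite (le_trans h1)// (le_trans (ler_wpM2l _ h3)) ?exprn_ge0 ?tail_radius_ge0//.
rewrite mulrCA -mulrA ler_wpM2l//.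
rewrite (le_trans _ (ler_wpM2l _ h2)) ?exprn_ge0// mulrA ler_wpM2r ?l2norm_ge0//.
by rewrite -exprMn lerXn2r// nnegrE ?tail_radius_ge0// mulr_ge0 ?normc_ge0.
Qed.

Lemma EO_dim l : (l < N)%N ->
  exists w, forall x, EO l x = x -> lspan (mult_sum m l) w x.
Proof.
elim: l => [|l ih] lN.
  by exists (fun=> 0) => x <-; rewrite EO0; case: (lspan_subspace (mult_sum m 0) (fun=> 0 : l2 R)).
have [w wE] := ih (ltnW lN).
case: dom => _ /(_ l (ltnW lN))[_ dl] /(_ l lN)[_ fl] _ _.
have mS : mult_sum m l.+1 = (mult_sum m l + odflt 0%N (m l))%N by rewrite /mult_sum big_ord_recr.
case: (m l) fl dl mS => // d _ [v iv vE] mS.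
set M := mult_sum m l in wE mS.
pose w' j := if (j < M)%N then w j else v (j - M)%N.
have sV := lspan_subspace (mult_sum m l.+1) w'.
exists w' => x; rewrite EOS ?(ltnW lN)// => <-; apply: subspaceD => //.
  have [c _ <-] := wE _ (projK x (oO l)); apply: subspace_sum => // i _; apply: subspaceZ => //.
  rewrite (_ : w i = w' i); last by rewrite /w' ltn_ord.
  by apply: mem_lspan; rewrite mS /= ltn_addr.
have : eigspace T (lam l) (E1 l x) by exact: T_E1.
rewrite vE => -[c _ <-]; apply: subspace_sum => // i _; apply: subspaceZ => //.
rewrite (_ : v i = w' (M + i)%N); last by rewrite /w' ltnNge leq_addr /= addKn.
by apply: mem_lspan; rewrite mS /= ltn_add2l.
Qed.

(** A dimension count: the projections of q_0, ..., q_(d-1), with d = m_1 + ... + m_l, are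
    independent, hence span the dominant subspace. So W = [EO l (q j)] is the projection of some u
    in the span of these q_i, and u is orthogonal to q_j. Then |W|^2 = <q_j, W> = <q_j, W - u> <= |W
    - u| <= L t^n |W|. *)
Lemma EO_small l n q j : (l < N)%N -> orthonormal k q ->
  (forall i, (i < k)%N -> lspan i.+1 (fun j => iter n T (ebasis R j)) (q i)) ->
  (cutoff k m l <= j < k)%N -> l2norm (EO l (q j)) <= L * t ^+ n.
Proof.
move=> lN oq qs /andP[lj jk].
have Lt0 : 0 <= L * t ^+ n by rewrite mulr_ge0 ?exprn_ge0.
have [l0|l0] := posnP l; first by rewrite l0 EO0 l2norm0.
have lN' : (0 < l <= N)%N by rewrite l0 ltnW.
rewrite cutoff_lt// in lj.
set d := mult_sum m l in lj.
have dk : (d <= k)%N by exact: leq_trans (ltnW jk).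
have cE : cutoff k m l = d by exact: cutoff_lt.
have Vq u : lspan d q u -> lspan (cutoff k m l) (fun j => iter n T (ebasis R j)) u.
  rewrite cE; apply: lspan_min; first exact: lspan_subspace.
  move=> i id_; apply: lspan_mono (qs i _) => //; exact: leq_trans dk.
have con u : lspan d q u -> l2norm (u - EO l u) <= L * t ^+ n * l2norm (EO l u).
  by move=> uq; apply: contraction => //; exact: Vq.
have lO := proj_lin (oO l).
(* By [contraction], a combination of the q_i with projection 0 is itself 0. *)
have ind : lin_indep d (fun i => EO l (q i)).
  move=> c c0; apply: (orthonormal_indep (orthonormal_le dk oq)).
  apply: l2norm_eq0; apply/eqP; rewrite eq_le l2norm_ge0 andbT.
  have := con _ (ex_intro2 _ _ c I erefl); rewrite (lin_sum _ _ _ lO).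
  under [X in l2norm (_ - X)]eq_bigr => i _ do rewrite (linZ _ _ lO).
  under [X in _ * l2norm X]eq_bigr => i _ do rewrite (linZ _ _ lO).
  by rewrite c0 l2norm0 mulr0 subr0.
have [w wE] := EO_dim lN.
have /(exchange ind) sub : forall i, (i < d)%N -> lspan d w (EO l (q i)).
  by move=> i _; apply: wE; exact: projK.
have [u uq Wu] := lspan_linear_inv lO (sub _ (wE _ (projK (q j) (oO l)))).
set W := EO l (q j) in Wu *.
have qju : inner (q j) u = 0.
  case: uq => c _ <-; rewrite inner_sumr big1// => i _; rewrite innerZr oq//.
    by rewrite gtn_eqF ?mulr0// (leq_trans (ltn_ord i)).
  by rewrite (leq_trans (ltn_ord i)).
have W2 : l2norm W ^+ 2 <= L * t ^+ n * l2norm W.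
  rewrite -[_ ^+ 2]ReC -inner_self {1}/W projA// [E _ W]projK//.
  have -> : inner (q j) W = inner (q j) (W - u) by rewrite innerBr qju subr0.
  rewrite (le_trans (Re_inner_le _ _))// (orthonormal_norm oq)// mul1r l2normB.
  by have := con u uq; rewrite -Wu.
have [W0|W0] := eqVneq (l2norm W) 0; first by rewrite W0.
have Wp : 0 < l2norm W by rewrite lt0r W0 l2norm_ge0.
by move: W2; rewrite expr2 ler_pM2r.
Qed.

(** The error has two parts: the component of q_j in the earlier eigenspaces, and its component off
    the first l + 1. Only the former needs a dimension count, and it involves l < N; thus the last
    eigenspace may be infinite-dimensional. *)
Lemma near_eigenspace l n q j : (l < N)%N -> orthonormal k q ->
  (forall i, (i < k)%N -> lspan i.+1 (fun j => iter n T (ebasis R j)) (q i)) ->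
  (cutoff k m l <= j < cutoff k m l.+1)%N -> (j < k)%N ->
  l2norm (E1 l (q j) - q j) <= 2 * (L * t ^+ n).
Proof.
move=> lN oq qs /andP[lj jl] jk.
have -> : E1 l (q j) - q j = - (EO l (q j) + (q j - EO l.+1 (q j))).
  by rewrite EOS//; apply: l2_ext => i; rewrite !(l2D, l2N); ring.
rewrite l2normN (le_trans (l2normD _ _))// mulr_natl mulr2n lerD//.
  by apply: EO_small => //; rewrite lj.
apply: (@le_trans _ _ (L * t ^+ n * l2norm (EO l.+1 (q j)))).
  apply: contraction => //.
  by apply: lspan_mono (qs j jk).
rewrite -[leRHS]mulr1 ler_wpM2l//; first by rewrite mulr_ge0 ?exprn_ge0.
by rewrite -(orthonormal_norm oq jk); exact: proj_le.
Qed.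

Lemma block_index j : (j < k)%N ->
  exists l, (l < N)%N && (cutoff k m l <= j < cutoff k m l.+1)%N.
Proof.
move=> jk.
have ex : exists l, (j < cutoff k m l)%N by exists N; rewrite cutoffN.
have [l jl lmin] := ex_minnP ex.
case: l jl lmin => [|l] jl lmin; first by move: jl; rewrite cutoff0.
exists l; rewrite jl andbT; apply/andP; split; first by apply: lmin; rewrite cutoffN.
by rewrite leqNgt; apply/negP => /lmin; rewrite ltnn.
Qed.

Lemma cutoff_mono a b : (a <= b <= N)%N -> (cutoff k m a <= cutoff k m b)%N.
Proof.
move=> /andP[/subnKC <-]; elim: (b - a)%N => [|d ih]; first by rewrite addn0.
rewrite addnS => abN; apply: leq_trans (cutoffS abN).
exact: ih (ltnW abN).
Qed.

Lemma block_index_uniq j a b : (a < N)%N && (cutoff k m a <= j < cutoff k m a.+1)%N ->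
  (b < N)%N && (cutoff k m b <= j < cutoff k m b.+1)%N -> a = b.
Proof.
move=> /and3P[aN ja aj] /and3P[bN jb bj]; apply/eqP; rewrite eqn_leq.
apply/andP; split; rewrite leqNgt; apply/negP => ab.
  have : (cutoff k m b.+1 <= cutoff k m a)%N by apply: cutoff_mono; rewrite ab ltnW.
  by move: ja bj; clear; lia.
have : (cutoff k m a.+1 <= cutoff k m b)%N by apply: cutoff_mono; rewrite ab ltnW.
by move: jb aj; clear; lia.
Qed.

(** Each block of q is projected to its eigenspace and made orthonormal again inside it. The
    eigenvalue equation and the unit norm are returned so that the eigenvalues can be recovered as
    Rayleigh quotients. *)
Lemma Xi1_near g (e h : R) n q :
  (forall S, chi T S = E (to_plane S)) ->
  (forall d q p, (d <= k)%N -> orthonormal d q ->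
     (forall i, (i < d)%N -> l2norm (p i - q i) <= h) ->
     exists2 q', orthonormal d q' &
       forall i, (i < d)%N -> lspan i.+1 p (q' i) /\ l2norm (q' i - q i) <= e) ->
  2 * (L * t ^+ n) <= h -> orthonormal k q ->
  (forall i, (i < k)%N -> lspan i.+1 (fun j => iter n T (ebasis R j)) (q i)) ->
  exists2 y, @Xi1 R k (T, g) y & forall j : 'I_k,
    [/\ l2norm (y.2 j - q j) <= e, T (y.2 j) = y.1 j *: y.2 j & l2norm (y.2 j) = 1].
Proof.
move=> chiE approx Lh oq qs.
have ckS l : (l < N)%N -> (cutoff k m l.+1 <= k)%N.
  by move=> lN; rewrite -[leqRHS]cutoffN cutoff_mono// lN leqnn.
have /choice[Q QP] (l : nat) : exists q', (l < N)%N ->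
    orthonormal (cutoff k m l.+1 - cutoff k m l) q' /\
    forall i, (i < cutoff k m l.+1 - cutoff k m l)%N ->
      T (q' i) = lam l *: q' i /\ l2norm (q' i - q (cutoff k m l + i)%N) <= e.
  have [lN|_] := ltnP l N; last by exists (fun=> 0).
  have cS := cutoffS lN; have ck := ckS _ lN.
  have [||i il|q' oq' q'P] := approx (cutoff k m l.+1 - cutoff k m l)%N
      (fun i => q (cutoff k m l + i)%N) (fun i => E1 l (q (cutoff k m l + i)%N)).
  - by rewrite leq_subLR (leq_trans ck)// leq_addl.
  - move=> i j il jl; rewrite oq; first by rewrite eqn_add2l.
      by move: il cS ck; clear; lia.
    by move: jl cS ck; clear; lia.
  - rewrite (le_trans _ Lh)//; apply: near_eigenspace => //.
      by move: il cS; clear; lia.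
    by move: il cS ck; clear; lia.
  exists q' => _; split=> // i il; have [q'i q'e] := q'P i il; split=> //.
  apply/(E1_eig _ lN); apply: (lspan_min (proj_ran_subspace (o1 l)) _ q'i).
  by move=> i' _; exact: projK (o1 l).
have /choice[b bP] (j : 'I_k) := block_index (ltn_ord j).
pose y : Mspace R k := (fun j => lam (b j), fun j => Q (b j) (j - cutoff k m (b j))%N).
exists y; last first.
  move=> j; have /and3P[bN bj jb] := bP j; have [oQ QE] := QP _ bN.
  have jd : (j - cutoff k m (b j) < cutoff k m (b j).+1 - cutoff k m (b j))%N.
    by rewrite ltn_sub2r// (leq_ltn_trans bj).
  have [TQ Qe] := QE _ jd; rewrite subnKC// in Qe; split=> //.
  exact: (orthonormal_norm oQ).
exists N, lam, m; split=> // l lN; have [oQ QE] := QP _ lN.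
have cS := cutoffS lN; have ck := ckS _ lN.
have yE (j : 'I_k) : (cutoff k m l <= j < cutoff k m l.+1)%N ->
    b j = l /\ y.2 j = Q l (j - cutoff k m l)%N.
  move=> jl; have bl : b j = l.
    by apply: block_index_uniq (bP j) _; rewrite lN.
  by rewrite /y /= bl.
have ortho (i j : 'I_k) : (cutoff k m l <= i < cutoff k m l.+1)%N ->
    (cutoff k m l <= j < cutoff k m l.+1)%N -> inner (y.2 i) (y.2 j) = (i == j)%:R.
  move=> il jl; have [_ ->] := yE _ il; have [_ ->] := yE _ jl.
  have id_ : (i - cutoff k m l < cutoff k m l.+1 - cutoff k m l)%N by move: il; clear; lia.
  have jd : (j - cutoff k m l < cutoff k m l.+1 - cutoff k m l)%N by move: jl; clear; lia.
  rewrite oQ//.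
  case/andP: il => il _; case/andP: jl => jl _.
  by rewrite -(eqn_add2l (cutoff k m l)) !subnKC.
pose span := [set \sum_(j < k | (cutoff k m l <= j < cutoff k m l.+1)%N) c j *: y.2 j
                 | c in [set: 'I_k -> R[i]]].
have sspan : lin_subspace span.
  split; first by exists (fun=> 0) => //; rewrite big1// => i _; rewrite scale0r.
  move=> a _ _ [c _ <-] [d _ <-]; exists (fun i => a * c i + d i) => //.
  rewrite scaler_sumr -big_split /=; apply: eq_bigr => i _.
  by rewrite scalerDl scalerA.
have yspan (j : 'I_k) : (cutoff k m l <= j < cutoff k m l.+1)%N -> span (y.2 j).
  move=> jl; exists (fun i => (i == j)%:R) => //.
  rewrite (bigD1 j)//= eqxx scale1r big1 ?addr0// => i /andP[_ /negPf ->].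
  by rewrite scale0r.
have spanE : span = lspan (cutoff k m l.+1 - cutoff k m l) (Q l).
  apply/seteqP; split.
    move=> _ [c _ <-]; apply: subspace_sum; first exact: lspan_subspace.
    move=> j jl; apply: subspaceZ; first exact: lspan_subspace.
    by have [_ ->] := yE _ jl; apply: mem_lspan; move: jl; clear; lia.
  apply: lspan_min => // i il.
  have jk : (cutoff k m l + i < k)%N by move: il cS ck; clear; lia.
  have jl : (cutoff k m l <= Ordinal jk < cutoff k m l.+1)%N by move: il cS; clear; rewrite /=; lia.
  by have [_] := yE _ jl; rewrite /= addKn => <-; exact: yspan.
have ranE : range (chi T [set lam l]) = [set x | E1 l x = x].
  rewrite chiE; apply/seteqP; split => [_ [x _ <-]|x /= <-]; first exact: projK (o1 l).
  by exists x.
split.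
- by move=> j /yE[bl _]; rewrite /y /= bl.
- move=> lN1; split; first exact: ortho.
  rewrite -/span ranE; apply/seteqP; split; last first.
    move=> x; rewrite spanE; apply: (lspan_min (proj_ran_subspace (o1 l))).
    by move=> i il /=; apply/(E1_eig _ lN); have [] := QE _ il.
  case: dom => _ /(_ l lN)[_ dl] /(_ l lN1)[_ fl] _ _.
  move=> x /= /(E1_eig _ lN) Tx; rewrite spanE.
  have cd : (cutoff k m l.+1 - cutoff k m l)%N = odflt 0%N (m l).
    by rewrite !cutoff_lt// /mult_sum big_ord_recr /= addKn.
  rewrite cd in oQ QE *; case: (m l) fl dl oQ QE => // d _ [v iv vE] oQ QE.
  (* Before the last block there are exactly as many orthonormal eigenvectors as the multiplicity,
     so they exhaust the eigenspace. *)
  apply: (exchange (orthonormal_indep oQ) (w := v)).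
    by move=> i il; rewrite -vE; have [] := QE _ il.
  by rewrite -vE.
- move=> lN1; exists span; split=> //.
    move=> x; rewrite ranE spanE; apply: (lspan_min (proj_ran_subspace (o1 l))).
    by move=> i il /=; apply/(E1_eig _ lN); have [] := QE _ il.
  have cN : cutoff k m l.+1 = k by rewrite lN1 cutoffN.
  by split; rewrite /span ?cN// in ortho *.
Qed.

End OneOperator.

(** * Strong convergence and stability *)

Section InfoNbhs.
Variable R : realType.

(** One integer controls the range of indices and the accuracy, so the condition strengthens with M
    and generates a filter. *)
Definition info_close M (T B : input R) : Prop :=
  (forall i j, (i < M)%N -> (j < M)%N ->
     normc (eval_at (EntryEv i j) B - eval_at (EntryEv i j) T) <= M.+1%:R^-1) /\
  (forall j n, (j < M)%N -> (n < M)%N -> B.2 j n = T.2 j n).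

Lemma info_close_le M M' T B : (M <= M')%N -> info_close M' T B -> info_close M T B.
Proof.
move=> MM' [h1 h2]; split=> [i j iM jM|j n jM nM]; last by apply: h2; exact: leq_trans MM'.
rewrite (le_trans (h1 _ _ _ _)) ?(leq_trans _ MM')// lef_pV2 ?posrE ?ltr0n// ler_nat.
by rewrite ltnS.
Qed.

Definition info_nbhs (Om : set (input R)) (T : input R) : set_system (input R) :=
  filter_from setT (fun M => [set B | Om B /\ info_close M T B]).

Global Instance info_nbhs_filter Om T : Filter (info_nbhs Om T).
Proof.
apply: filter_from_filter; first by exists 0%N.
move=> M M' _ _; exists (maxn M M') => // B [OB c]; split; split=> //.
  by apply: info_close_le c; exact: leq_maxl.
by apply: info_close_le c; exact: leq_maxr.
Qed.

Lemma near_Om Om T : \forall B \near info_nbhs Om T, Om B.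
Proof. by exists 0%N => // B []. Qed.

Lemma near_entry Om T i j (e : R) : 0 < e ->
  \forall B \near info_nbhs Om T, normc (eval_at (EntryEv i j) B - eval_at (EntryEv i j) T) <= e.
Proof.
move=> e0; pose n := Num.truncn e^-1.
exists (maxn (maxn i j).+1 n) => // B [_ [h _]].
rewrite (le_trans (h _ _ _ _))//.
- by rewrite leq_max ltnS leq_maxl.
- by rewrite leq_max ltnS leq_maxr.
rewrite invf_ple ?posrE ?ltr0n// ltW// (lt_le_trans (truncnS_gt _))//.
by rewrite ler_nat ltnS leq_maxr.
Qed.

Lemma near_gval Om T j n : \forall B \near info_nbhs Om T, B.2 j n = T.2 j n.
Proof.
exists (maxn j n).+1 => // B [_ [_ h]].
by apply: h; rewrite ltnS ?leq_maxl ?leq_maxr.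
Qed.

End InfoNbhs.

(** * Strong convergence of operators from finitely many data *)

Section StrongConvergence.
Variables (R : realType) (L : R) (Om : set (input R)).
Hypothesis L0 : 0 < L.
Hypothesis OmP : forall B, Om B -> [/\ bounded_op B.1, opnorm B.1 <= L & access B.1 B.2].
Variable T : input R.
Hypothesis OT : Om T.
Local Notation nT := (info_nbhs Om T).

Let linO B : Om B -> linear B.1. Proof. by case/OmP => -[]. Qed.

Lemma Om_bound B x : Om B -> l2norm (B.1 x) <= L * l2norm x.
Proof.
case/OmP => bB BL _; rewrite (le_trans (opnorm_le x bB))// ler_wpM2r//.
exact: l2norm_ge0.
Qed.

Lemma trunc_l2_diff n (x y : l2 R) :
  l2norm (trunc_l2 n x - trunc_l2 n y) <= \sum_(i < n) normc (x i - y i).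
Proof.
rewrite /trunc_l2 -sumrB (le_trans (l2norm_sum _ _ _))//; apply: ler_sum => i _.
by rewrite -scalerBl l2normZ l2norm_ebasis mulr1.
Qed.

(** Once B and T share the value G = g^j(n), both columns are within 1/(j+1) of their truncations at
    the same G, and only G entries remain to be compared. This is where access to g enters. *)
Lemma near_column n (e : R) : 0 < e ->
  \forall B \near nT, l2norm (B.1 (ebasis R n) - T.1 (ebasis R n)) <= e.
Proof.
move=> e0; pose j := Num.truncn (4 / e).
have je : j.+1%:R^-1 <= e / 4.
  by rewrite invf_ple ?posrE ?ltr0n ?divr_gt0// invf_div ltW// truncnS_gt.
pose G := T.2 j n.
have e1 : 0 < e / 2 / G.+1%:R by rewrite !divr_gt0.
near=> B.
have OB : Om B by near: B; exact: near_Om.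
have gB : B.2 j n = G by near: B; exact: near_gval.
have ent : forall i : 'I_G, normc (eval_at (EntryEv i n) B - eval_at (EntryEv i n) T) <= e / 2 / G.+1%:R.
  by near: B; apply: filter_forall => i; exact: near_entry.
have [_ _ /(_ j)[_ _ /(_ n)]] := OmP OB; rewrite gB Pm_trunc l2normB => h1.
have [_ _ /(_ j)[_ _ /(_ n)]] := OmP OT; rewrite -/G Pm_trunc => h2.
rewrite (le_trans (l2norm_dist _ (trunc_l2 G (B.1 (ebasis R n))) _))//.
have h3 := l2norm_dist (trunc_l2 G (B.1 (ebasis R n))) (trunc_l2 G (T.1 (ebasis R n))) (T.1 (ebasis R n)).
have h4 : l2norm (trunc_l2 G (B.1 (ebasis R n)) - trunc_l2 G (T.1 (ebasis R n))) <= e / 2.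
  rewrite (le_trans (trunc_l2_diff _ _ _))//.
  apply: (@le_trans _ _ (\sum_(i < G) (e / 2 / G.+1%:R))).
    by apply: ler_sum => i _; have := ent i; rewrite /eval_at !inner_ebasis.
  rewrite sumr_const card_ord -[leLHS]mulr_natr (_ : _ * _ = e / 2 * G%:R / G.+1%:R); last by ring.
  rewrite ler_pdivrMr ?ltr0n//.
  by rewrite ler_pM2l ?divr_gt0// ler_nat.
rewrite (_ : e = e / 4 + (e / 2 + e / 4)); last by field.
exact: lerD (le_trans h1 je) (le_trans h3 (lerD h4 (le_trans h2 je))).
Unshelve. all: by end_near. Qed.

(** The common norm bound L controls the tail of x uniformly in B; its truncation involves finitely
    many columns. *)
Lemma near_strong x (e : R) : 0 < e -> \forall B \near nT, l2norm (B.1 x - T.1 x) <= e.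
Proof.
move=> e0.
have e1 : 0 < e / (4 * L) by rewrite divr_gt0// mulr_gt0.
have /cvgrPdist_lt/(_ _ e1)[n _ /(_ n (leqnn n)) /=] := trunc_l2_cvg x.
rewrite sub0r normrN ger0_norm ?l2norm_ge0// => xn.
set y := trunc_l2 n x in xn.
have e2 : 0 < e / 2 / (n%:R * l2norm x + 1).
  by rewrite !divr_gt0// ltr_wpDl// mulr_ge0// l2norm_ge0.
near=> B.
have OB : Om B by near: B; exact: near_Om.
have col : forall i : 'I_n, l2norm (B.1 (ebasis R i) - T.1 (ebasis R i)) <= e / 2 / (n%:R * l2norm x + 1).
  by near: B; apply: filter_forall => i; exact: near_column.
have lB := linO OB; have lT := linO OT.
have -> : B.1 x - T.1 x = (B.1 (x - y) - T.1 (x - y)) + (B.1 y - T.1 y).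
  by rewrite (linB _ _ lB) (linB _ _ lT); apply: l2_ext => i; rewrite !(l2D, l2N); ring.
rewrite (le_trans (l2normD _ _))// [leRHS]splitr lerD//.
  rewrite (le_trans (l2normD _ _))// l2normN.
  have h1 := Om_bound (x - y) OB; have h2 := Om_bound (x - y) OT.
  have h3 : L * l2norm (x - y) <= e / 4.
    rewrite mulrC -ler_pdivlMr// ltW// (lt_le_trans xn)// -mulrA.
    by rewrite invfM mulrA.
  rewrite (_ : e / 2 = e / 4 + e / 4); last by field.
  exact: lerD (le_trans h1 h3) (le_trans h2 h3).
rewrite /y /trunc_l2 (lin_sum _ _ _ lB) (lin_sum _ _ _ lT) -sumrB.
rewrite (le_trans (l2norm_sum _ _ _))//.
apply: (@le_trans _ _ (\sum_(i < n) l2norm x * (e / 2 / (n%:R * l2norm x + 1)))).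
  apply: ler_sum => i _; rewrite (linZ _ _ lB) (linZ _ _ lT) -scalerBr l2normZ.
  by rewrite ler_pM ?normc_ge0 ?l2norm_ge0// normc_coord.
rewrite sumr_const card_ord -[leLHS]mulr_natr.
set w := n%:R * l2norm x.
have w0 : 0 <= w by rewrite mulr_ge0// l2norm_ge0.
rewrite (_ : _ * _ * _ = e / 2 * (w / (w + 1))); last by rewrite /w; ring.
rewrite ger_pMr ?divr_gt0// ler_pdivrMr ?mul1r ?lerDl//.
by rewrite ltr_wpDl.
Unshelve. all: by end_near. Qed.

(** The difference splits as B (B^n x - T^n x) + (B - T) T^n x, with the strong estimate used at the
    fixed vector T^n x. *)
Lemma near_iter n x (e : R) : 0 < e ->
  \forall B \near nT, l2norm (iter n B.1 x - iter n T.1 x) <= e.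
Proof.
elim: n e => [|n ih] e e0.
  by near=> B; rewrite subrr l2norm0 ltW.
have e1 : 0 < e / 2 / L by rewrite !divr_gt0.
have e2 : 0 < e / 2 by rewrite divr_gt0.
near=> B.
have OB : Om B by near: B; exact: near_Om.
have h1 : l2norm (iter n B.1 x - iter n T.1 x) <= e / 2 / L by near: B; exact: ih.
have h2 : l2norm (B.1 (iter n T.1 x) - T.1 (iter n T.1 x)) <= e / 2.
  by near: B; exact: near_strong.
rewrite /= (le_trans (l2norm_dist _ (B.1 (iter n T.1 x)) _))// [leRHS]splitr lerD//.
rewrite -(linB _ _ (linO OB)) (le_trans (Om_bound _ OB))//.
by rewrite mulrC -ler_pdivlMr.
Unshelve. all: by end_near. Qed.

Lemma near_comb s (c : 'I_s -> R[i]) n (e : R) : 0 < e ->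
  \forall B \near nT, l2norm (\sum_(i < s) c i *: iter n B.1 (ebasis R i) -
                              \sum_(i < s) c i *: iter n T.1 (ebasis R i)) <= e.
Proof.
move=> e0; pose C := \sum_(i < s) normc (c i) + 1.
have C0 : 0 < C by rewrite ltr_wpDl// sumr_ge0// => i _; exact: normc_ge0.
near=> B.
have h : forall i : 'I_s, l2norm (iter n B.1 (ebasis R i) - iter n T.1 (ebasis R i)) <= e / C.
  by near: B; apply: filter_forall => i; apply: near_iter; rewrite divr_gt0.
rewrite -sumrB (le_trans (l2norm_sum _ _ _))//.
apply: (@le_trans _ _ (\sum_(i < s) normc (c i) * (e / C))).
  apply: ler_sum => i _; rewrite -scalerBr l2normZ ler_wpM2l ?normc_ge0//.
rewrite -mulr_suml mulrCA ger_pMr// ler_pdivrMr// mul1r /C.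
by rewrite lerDl.
Unshelve. all: by end_near. Qed.

End StrongConvergence.

(** * Stability of the solution set *)

Section Stability.
Variables (R : realType) (k : nat) (t L : R).
Hypotheses (k0 : (0 < k)%N) (t0 : 0 < t) (t1 : t < 1) (L0 : 0 < L).

Lemma Omega_bound (B : input R) : Omega k t L B ->
  [/\ bounded_op B.1, opnorm B.1 <= L & access B.1 B.2].
Proof. by case: B => T g [[? _ _ ? ?] _]. Qed.

Lemma iter_indep (T : l2 R -> l2 R) n : linear T -> invertible T ->
  lin_indep k (fun j => iter n T (ebasis R j)).
Proof.
move=> lT [S [_ TS _]] c c0.
have iK : cancel (iter n T) (iter n S).
  by elim: n {c0} => // n ih x; rewrite iterSr [iter n.+1 T x]iterS TS ih.
apply: (orthonormal_indep (q := ebasis R)); first by move=> i j _ _; exact: ebasis_orth.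
apply: (can_inj iK); rewrite (lin0 (linear_iter n lT)) -[RHS]c0.
rewrite (lin_sum _ _ _ (linear_iter n lT)); apply: eq_bigr => i _.
by rewrite (linZ _ _ (linear_iter n lT)).
Qed.

Lemma Omega_stable (T : input R) (e : R) : Omega k t L T -> 0 < e ->
  exists y : Mspace R k, \forall B \near info_nbhs (Omega k t L) T,
    exists2 y', Xi1 B y' & distM y y' <= e.
Proof.
move=> OT e0.
(* Each of the k indices costs (4 L + 1) e1 for the eigenvalue and 2 e1 for the eigenvector. *)
pose e1 := e / (k%:R * (4 * L + 3)).
have k0' : 0 < k%:R :> R by rewrite ltr0n.
have cL : 0 < 4 * L + 3 by rewrite addr_gt0// mulr_gt0.
have e10 : 0 < e1 by rewrite divr_gt0// mulr_gt0.
have [h h0 approx] := orthonormal_approx_uniform k e10.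
have [n Ln] : exists n, 2 * (L * t ^+ n) <= h.
  have : (fun n => 2 * L * t ^+ n) @ \oo --> 2 * L * 0.
    by apply: cvgMr; apply: cvg_expr; rewrite ger0_norm// ltW.
  rewrite mulr0 => /cvgrPdist_lt/(_ _ h0)[n _ /(_ n (leqnn n)) /=].
  rewrite sub0r normrN => nh; exists n.
  by rewrite mulrA (le_trans (ler_norm _))// ltW.
have [[bT iT _ _ _] _] : [/\ bounded_op T.1, invertible T.1, normal_op T.1, opnorm T.1 <= L
   & access T.1 T.2] /\ True by case: (T) OT => T' g [].
have lT := bT.1.
have [q oq qs] := gram_schmidt (@iter_indep _ n lT iT).
(* These coefficients come from T alone; the same ones are applied to the powers of B. *)
have /choice[c cE] (j : 'I_k) : exists c : nat -> R[i],
    \sum_(i < j.+1) c i *: iter n T.1 (ebasis R i) = q j.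
  have [c _ <-] := qs j (ltn_ord j); exists (c \o inord).
  by apply: eq_bigr => i _; rewrite /= inord_val.
exists (fun j : 'I_k => inner (T.1 (q j)) (q j), fun j : 'I_k => q j).
pose p (B : input R) j := if insub j is Some j' then
  \sum_(i < (j' : 'I_k).+1) c j' i *: iter n B.1 (ebasis R i) else 0.
near=> B.
have OB : Omega k t L B by near: B; exact: near_Om.
have pB : forall j : 'I_k, l2norm (\sum_(i < j.+1) c j i *: iter n B.1 (ebasis R i) - q j) <= h.
  near: B; apply: filter_forall => j; rewrite -cE.
  exact: (near_comb L0 Omega_bound OT (fun i : 'I_j.+1 => c j i)).
have TB : forall j : 'I_k, l2norm (B.1 (q j) - T.1 (q j)) <= e1.
  near: B; apply: filter_forall => j.
  exact: (near_strong L0 Omega_bound OT).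
have bB := Omega_bound OB; have lB : linear B.1 by case: bB => -[].
have [q1 oq1 q1P] : exists2 q', orthonormal k q' &
    forall i, (i < k)%N -> lspan i.+1 (p B) (q' i) /\ l2norm (q' i - q i) <= e1.
  apply: approx => // i ik; rewrite /p insubT; exact: (pB (Ordinal ik)).
have q1s i : (i < k)%N -> lspan i.+1 (fun j => iter n B.1 (ebasis R j)) (q1 i).
  move=> ik; have [+ _] := q1P i ik; apply: lspan_min; first exact: lspan_subspace.
  move=> j ji; have jk : (j < k)%N by exact: leq_trans ik.
  rewrite /p insubT /=; apply: (@lspan_mono _ j.+1) => //.
  by exists (fun i : 'I_j.+1 => c (Sub j jk) i).
have [y' Xy y'P] : exists2 y, @Xi1 R k B y & forall j : 'I_k,
    [/\ l2norm (y.2 j - q1 j) <= e1, B.1 (y.2 j) = y.1 j *: y.2 j & l2norm (y.2 j) = 1].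
  (* The blocks introduced here are those of B. *)
  case: (B) OB bB q1s => T' g [_ [N [lam [m [dom ind rt [EN [_ ENe _] [Ph tn]]]]]]] [bT' _ _] /= q1s.
  have [E hE chiE] := chi_spectral k0 ind.
  exact: (Xi1_near t0 L0 bT' hE dom rt ENe Ph tn g chiE approx Ln oq1 q1s).
exists y' => //.
have yq (j : 'I_k) : l2norm (q j - y'.2 j) <= 2 * e1.
  have [h1 _ _] := y'P j; have [_ h2] := q1P j (ltn_ord j).
  rewrite l2normB (le_trans (l2norm_dist _ (q1 j) _))//.
  by rewrite mulr_natl mulr2n lerD.
have yl (j : 'I_k) : normc (inner (T.1 (q j)) (q j) - y'.1 j) <= (4 * L + 1) * e1.
  have [_ h2 h3] := y'P j; have qn := orthonormal_norm oq (ltn_ord j).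
  (* As Rayleigh quotients, the eigenvalues of B can be compared with <T q_j, q_j> through vectors
     only. *)
  have -> : y'.1 j = inner (B.1 (y'.2 j)) (y'.2 j).
    by rewrite h2 innerZl inner_self h3 expr1n mulr1.
  have -> : inner (T.1 (q j)) (q j) - inner (B.1 (y'.2 j)) (y'.2 j) =
      inner (T.1 (q j)) (q j - y'.2 j) +
      (inner (T.1 (q j) - B.1 (q j)) (y'.2 j) + inner (B.1 (q j - y'.2 j)) (y'.2 j)).
    by rewrite (linB _ _ lB) innerBr !innerBl; ring.
  have b1 := Om_bound Omega_bound (q j) OT.
  have b2 := Om_bound Omega_bound (q j - y'.2 j) OB.
  have c1 := CauchySchwarz (T.1 (q j)) (q j - y'.2 j).
  have c2 := CauchySchwarz (T.1 (q j) - B.1 (q j)) (y'.2 j).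
  have c3 := CauchySchwarz (B.1 (q j - y'.2 j)) (y'.2 j).
  rewrite h3 mulr1 in c2; rewrite h3 mulr1 in c3; rewrite qn mulr1 in b1.
  have d1 : l2norm (T.1 (q j)) * l2norm (q j - y'.2 j) <= L * (2 * e1).
    by rewrite ler_pM ?l2norm_ge0.
  have d3 : L * l2norm (q j - y'.2 j) <= L * (2 * e1) by rewrite ler_wpM2l// ltW.
  rewrite (le_trans (ler_normcD _ _))//.
  rewrite (_ : _ * e1 = L * (2 * e1) + (e1 + L * (2 * e1))); last by ring.
  apply: lerD; first exact: le_trans c1 d1.
  rewrite (le_trans (ler_normcD _ _))//; apply: lerD.
    by rewrite (le_trans c2)// l2normB.
  exact: le_trans c3 (le_trans b2 d3).
rewrite /distM /=.
apply: (@le_trans _ _ (\sum_(j < k) (4 * L + 1) * e1 + \sum_(j < k) 2 * e1)).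
  by apply: lerD; apply: ler_sum => j _; [exact: yl|exact: yq].
rewrite !sumr_const !card_ord -[X in X + _ <= _]mulr_natr -[X in _ + X <= _]mulr_natr /e1 le_eqVlt; apply/orP; left; apply/eqP.
by field; apply/andP; split; apply: lt0r_neq0.
Unshelve. all: by end_near. Qed.

End Stability.

(** * The decision tree *)

Section RationalPoints.
Variables (R : realType) (k : nat).

Definition ratc (p : rat * rat) : R[i] := ratr p.1 +i* ratr p.2.

Definition rat_point (lq : 'I_k -> rat * rat) (qq : 'I_k -> seq (rat * rat)) : Mspace R k :=
  (fun j => ratc (lq j),
   fun j => \sum_(i < size (qq j)) ratc (nth (0, 0) (qq j) i) *: ebasis R i).

Lemma ratr_dense (x e : R) : 0 < e -> exists q : rat, `|ratr q - x| < e.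
Proof.
move=> e0; have [|q] := @rat_in_itvoo R (x - e) (x + e); first by lra.
by rewrite in_itv /= => /andP[? ?]; exists q; rewrite ltr_norml; apply/andP; split; lra.
Qed.

Lemma ratc_dense (a : R[i]) (e : R) : 0 < e -> exists p, normc (ratc p - a) <= e.
Proof.
move=> e0; have e2 : 0 < e / 2 by rewrite divr_gt0.
have [p hp] := ratr_dense (Re a) e2; have [q hq] := ratr_dense (Im a) e2.
exists (p, q); rewrite (le_trans (normc_le_ReIm _))// !RIE /= [leRHS]splitr.
by rewrite lerD// ltW.
Qed.

Lemma rat_l2_dense (x : l2 R) (e : R) : 0 < e -> exists s : seq (rat * rat),
  l2norm (\sum_(i < size s) ratc (nth (0, 0) s i) *: ebasis R i - x) <= e.
Proof.
move=> e0; have e2 : 0 < e / 2 by rewrite divr_gt0.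
have /cvgrPdist_lt/(_ _ e2)[n _ /(_ n (leqnn n)) /=] := trunc_l2_cvg x.
rewrite sub0r normrN ger0_norm ?l2norm_ge0// => xn.
have en : 0 < e / 2 / n.+1%:R by rewrite divr_gt0.
have /choice[c cP] i := ratc_dense (x i) en.
exists (mkseq c n); rewrite size_mkseq.
rewrite (le_trans (l2norm_dist _ (trunc_l2 n x) _))// [leRHS]splitr.
apply: lerD; last by rewrite l2normB ltW.
rewrite /trunc_l2 -sumrB (le_trans (l2norm_sum _ _ _))//.
apply: (@le_trans _ _ (\sum_(i < n) (e / 2 / n.+1%:R))).
  apply: ler_sum => i _; rewrite nth_mkseq// -scalerBl l2normZ l2norm_ebasis mulr1.
  exact: cP.
rewrite sumr_const card_ord -[leLHS]mulr_natr (_ : _ * _ = e / 2 * n%:R / n.+1%:R); last by ring.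
by rewrite ler_pdivrMr ?ltr0n// ler_pM2l// ler_nat.
Qed.

Lemma rat_point_dense (y : Mspace R k) (e : R) : 0 < e ->
  exists lq qq, distM (rat_point lq qq) y <= e.
Proof.
move=> e0; have e1 : 0 < e / (2 * k.+1%:R) by rewrite divr_gt0// mulr_gt0.
have /choice[lq lP] j := ratc_dense (y.1 j) e1.
have /choice[qq qP] j := rat_l2_dense (y.2 j) e1.
exists lq, qq; rewrite /distM /=.
apply: (@le_trans _ _ (\sum_(j < k) (e / (2 * k.+1%:R)) + \sum_(j < k) (e / (2 * k.+1%:R)))).
  by apply: lerD; apply: ler_sum => j _; [exact: lP|exact: qP].
rewrite !sumr_const !card_ord -mulr2n -mulrnA -[leLHS]mulr_natr natrM.
rewrite (_ : _ * _ = e * k%:R / k.+1%:R); last by field; rewrite ?natr1 ?nat1r pnatr_eq0.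
by rewrite ler_pdivrMr ?ltr0n// ler_pM2l// ler_nat.
Qed.

Lemma distM_triangle (x y z : Mspace R k) : distM x z <= distM x y + distM y z.
Proof.
rewrite /distM addrACA; apply: lerD; rewrite -big_split /=; apply: ler_sum => j _.
  by rewrite (_ : _ - _ = (x.1 j - y.1 j) + (y.1 j - z.1 j)) ?ler_normcD// addrA subrK.
exact: l2norm_dist.
Qed.

End RationalPoints.

(** * The decision tree built from a fixed schedule *)

Section Machine.
Variables (R : realType) (k : nat) (params : seq R).
Variables (Xi : input R -> set (Mspace R k)) (Om : set (input R)) (tol : R).

(** The instructions that gather information, as a sum of countable types so that pickling
    enumerates them. *)
Definition code : Type := (((nat * nat) + (nat * nat)) + (rat + (nat * nat)))%type.

Definition decode (c : code) : instruction k :=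
  match c with
  | inl (inl (i, j)) => IEntry k i j
  | inl (inr (j, n)) => IGval k j n
  | inr (inl c) => IConst k c
  | inr (inr (a, b)) => ICompare k a b
  end.

(** The extra natural number makes every code recur infinitely often; numbers that decode to nothing
    store the constant 0. *)
Definition schedule (p : nat) : code :=
  match @unpickle (nat * code)%type p with Some (_, c) => c | None => inr (inl 0) end.

(** Pigeonhole: the P + 1 pairs (i, c) have distinct pickles, which cannot all lie below P. *)
Lemma schedule_io (c : code) P : exists2 p, (P <= p)%N & schedule p = c.
Proof.
apply: contrapT => nex.
have lt (i : 'I_P.+1) : (@pickle (nat * code)%type (nat_of_ord i, c) < P)%N.
  rewrite ltnNge; apply/negP => Pp; apply: nex.
  by exists (@pickle (nat * code)%type (nat_of_ord i, c)); rewrite // /schedule pickleK.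
have inj : injective (fun i : 'I_P.+1 => Ordinal (lt i)).
  move=> i j /(congr1 val) /= /(congr1 (@unpickle (nat * code)%type)).
  by rewrite !pickleK => -[] /val_inj.
by have := leq_card _ inj; rewrite !card_ord ltnn.
Qed.

Implicit Types (T B : input R).

Definition obs B (r : seq R) (c : code) : nat :=
  match c with
  | inl (inr (j, n)) => B.2 j n
  | inr (inr (a, b)) => nat_of_bool (r`_a <= r`_b)
  | _ => 0%N
  end.

Definition newregs B (c : code) : seq R :=
  match c with
  | inl (inl (i, j)) => [:: Re (eval_at (EntryEv i j) B); Im (eval_at (EntryEv i j) B)]
  | inr (inl q) => [:: ratr q]
  | _ => [::]
  end.

Definition newevs (c : code) : seq evaluation :=
  match c with
  | inl (inl (i, j)) => [:: EntryEv i j]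
  | inl (inr (j, n)) => [:: GEv j n]
  | _ => [::]
  end.

Fixpoint regs B p : seq R :=
  if p is p'.+1 then regs B p' ++ newregs B (schedule p') else params.

Definition hist B p : seq nat := mkseq (fun i => obs B (regs B i) (schedule i)) p.

Fixpoint evs p : seq evaluation :=
  if p is p'.+1 then evs p' ++ newevs (schedule p') else [::].

Lemma histS B p : hist B p.+1 = rcons (hist B p) (obs B (regs B p) (schedule p)).
Proof. exact: mkseqS. Qed.

Lemma size_hist B p : size (hist B p) = p. Proof. exact: size_mkseq. Qed.

Lemma hist_obs T B p i : (i < p)%N -> hist B p = hist T p ->
  obs B (regs B i) (schedule i) = obs T (regs T i) (schedule i).
Proof. by move=> ip /(congr1 (fun s => nth 0%N s i)); rewrite !nth_mkseq. Qed.

Lemma hist_le T B p p' : (p <= p')%N -> hist B p' = hist T p' -> hist B p = hist T p.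
Proof.
move=> pp' h; apply: (@eq_from_nth _ 0%N); rewrite !size_hist// => i ip.
by rewrite !nth_mkseq//; apply: hist_obs h; exact: leq_trans pp'.
Qed.

Lemma size_newregs T B c : size (newregs B c) = size (newregs T c).
Proof. by case: c => -[[]|[]] => //=; case. Qed.

Lemma size_regs T B p : size (regs B p) = size (regs T p).
Proof. by elim: p => //= p ih; rewrite !size_cat ih (size_newregs T). Qed.

Lemma regs_nth B p p' i : (p < p')%N -> (i < size (newregs B (schedule p)))%N ->
  (regs B p')`_(size (regs B p) + i) = (newregs B (schedule p))`_i.
Proof.
move=> + il; elim: p' => // p' ih; rewrite ltnS leq_eqVlt => /predU1P[->|pp'] /=.
  by rewrite nth_cat ltnNge leq_addr /= addKn.
rewrite nth_cat ifT ?ih//.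
have : (size (regs B p) + i < size (regs B p.+1))%N by rewrite /= size_cat ltn_add2l.
move=> /leq_trans; apply.
rewrite -(subnKC pp'); elim: (p' - p.+1)%N => [|d ihd]; first by rewrite addn0.
rewrite addnS; apply: (leq_trans ihd).
by rewrite [regs B (_ + _).+1]/= size_cat leq_addr.
Qed.

(** A property of the history alone, so that the tree may act on it; it covers every input that
    could have produced h. *)
Definition good (h : seq nat)
    (z : ('I_k -> nat * nat) * ('I_k -> seq (nat * nat))) : Prop :=
  forall B, Om B -> hist B (size h) = h ->
    (dist (output (regs B (size h)) z.1 z.2) (Xi B) <= tol%:E)%E.

Definition result h : option (('I_k -> nat * nat) * ('I_k -> seq (nat * nat))) :=
  if pselect (exists z, good h z) is left e then Some (projT1 (cid e)) else None.

Lemma resultP h : match result h with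
  | Some z => good h z
  | None => forall z, ~ good h z end.
Proof.
rewrite /result; case: pselect => [e|ne]; first exact: (projT2 (cid e)).
by move=> z gz; apply: ne; exists z.
Qed.

Definition control (h : seq nat) : instruction k :=
  if result h is Some z then IHalt z.1 z.2 else decode (schedule (size h)).

Hypothesis halting : forall T, Om T -> exists p, isSome (result (hist T p)).

Definition stop T : nat :=
  if pselect (exists p, isSome (result (hist T p))) is left e then ex_minn e else 0%N.

Lemma stopP T : Om T -> isSome (result (hist T (stop T))) /\
  forall p, isSome (result (hist T p)) -> (stop T <= p)%N.
Proof.
move=> /halting ex; rewrite /stop; case: pselect => // e.
by case: ex_minnP => p.
Qed.

Definition Gamma T : Mspace R k :=
  if result (hist T (stop T)) is Some z then output (regs T (stop T)) z.1 z.2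
  else (fun=> 0, fun=> 0).

Lemma run_step T p c qs y : schedule p = c -> control (hist T p) = decode c ->
  runs control T (hist T p.+1) (regs T p.+1) qs y ->
  runs control T (hist T p) (regs T p) (newevs c ++ qs) y.
Proof.
move=> sc cc; rewrite histS /= sc.
case: c cc {sc} => [[[i j]|[j n]]|[q|[a b]]] cc /= hr.
- exact: RunEntry cc hr.
- by apply: RunGval cc _; rewrite cats0 in hr.
- by apply: RunConst cc _; rewrite cats1 in hr.
- by apply: RunCompare cc _; rewrite cats0 in hr.
Qed.

Lemma run_control T : Om T -> runs control T [::] params (evs (stop T)) (Gamma T).
Proof.
move=> OT; have [st smin] := stopP OT.
(* Induction on the distance d to the halting time, because a run is built from its end; before that
   time the tree follows the schedule by minimality of [stop]. *)
have key d p : (p + d)%N = stop T -> exists2 qs, evs p ++ qs = evs (stop T) &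
    runs control T (hist T p) (regs T p) qs (Gamma T).
  elim: d p => [|d ih] p pd.
    rewrite addn0 in pd; rewrite pd; exists [::]; first by rewrite cats0.
    rewrite /Gamma; case r: (result _) st => [z|]// _.
    by apply: RunHalt; rewrite /control r.
  have [|qs qsE hr] := ih p.+1; first by rewrite addSnnS.
  exists (newevs (schedule p) ++ qs); first by rewrite catA.
  apply: run_step hr => //; rewrite /control size_hist.
  case r: (result _) => [z|]//.
  have := smin p; rewrite r -pd => /(_ isT).
  by rewrite -{2}[p]addn0 leq_add2l.
by have [qs /= <- hr] := key (stop T) 0%N (add0n _).
Qed.

(** The schedule does not depend on the input, so equal evaluations give equal registers and
    observations step by step; values of g are compared through their injective cast to complex
    numbers. *)
Lemma agree_trace T B p : (forall q, List.In q (evs p) -> eval_at q B = eval_at q T) ->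
  hist B p = hist T p /\ regs B p = regs T p.
Proof.
elim: p => // p ih h.
have [|hE rE] := ih; first by move=> q qp; apply: h; apply/List.in_or_app; left.
have h' q : List.In q (newevs (schedule p)) -> eval_at q B = eval_at q T.
  by move=> qp; apply: h; apply/List.in_or_app; right.
rewrite !histS /= hE rE; split.
  congr rcons; case: (schedule p) h' => [[[i j]|[j n]]|[q|[a b]]]//= h'.
  have /eqP := h' (GEv j n) (or_introl erefl).
  by rewrite /= eqr_nat => /eqP.
congr (_ ++ _); case: (schedule p) h' => [[[i j]|[j n]]|[q|[a b]]]//= h'.
by have /= -> := h' (EntryEv i j) (or_introl erefl).
Qed.

Lemma finite_In (s : seq evaluation) : finite_set [set q | List.In q s].
Proof.
elim: s => [|a s ih].
  by rewrite (_ : [set _ | _] = set0)//; apply/seteqP; split.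
rewrite (_ : [set _ | _] = [set a] `|` [set q | List.In q s]).
  by rewrite finite_setU; split=> //; exact: finite_set1.
by apply/seteqP; split => q /= [<-|]; [left|right|left|right].
Qed.

Lemma control_radical : radical_algorithm params Om Gamma /\
  forall T, Om T -> (dist (Gamma T) (Xi T) <= tol%:E)%E.
Proof.
split; last first.
  move=> T OT; have [st _] := stopP OT; rewrite /Gamma.
  have := resultP (hist T (stop T)); case: (result _) st => // z _ /(_ T OT).
  by rewrite size_hist; apply.
exists (fun T => [set q | List.In q (evs (stop T))]).
  move=> T OT; split; first exact: finite_In.
  move=> B OB BT.
  have tr p : (p <= stop T)%N -> hist B p = hist T p /\ regs B p = regs T p.
    move=> ps; apply: agree_trace => q qp; apply: BT.
    rewrite /= -(subnKC ps); elim: (_ - _)%N => [|d ihd]; first by rewrite addn0.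
    by rewrite addnS /=; apply/List.in_or_app; left.
  have [st smin] := stopP OT; have [sb bmin] := stopP OB.
  (* The traces agree up to the halting time of T, so neither input can halt before the other. *)
  have sE : stop B = stop T.
    apply/eqP; rewrite eqn_leq; apply/andP; split.
      by apply: bmin; rewrite (tr _ (leqnn _)).1.
    rewrite leqNgt; apply/negP => lt.
    have := smin (stop B); rewrite -(tr _ (ltnW lt)).1 => /(_ sb).
    by rewrite leqNgt lt.
  have [hE rE] := tr _ (leqnn _).
  by rewrite /Gamma sE hE rE.
exists control => T OT; exists (evs (stop T)) => //.
exact: run_control.
Qed.

End Machine.

(** * Histories determine the input up to small errors *)

Section Information.
Variables (R : realType) (k : nat) (params : seq R).
Implicit Types (T B : input R).
Local Notation hist := (hist params).
Local Notation regs := (regs params).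

Definition hist_nbhs T : set_system (input R) :=
  filter_from setT (fun p => [set B | hist B p = hist T p]).

Global Instance hist_nbhs_filter T : Filter (hist_nbhs T).
Proof.
apply: filter_from_filter; first by exists 0%N.
move=> p p' _ _; exists (maxn p p') => // B /= h; split=> /=.
  exact: hist_le (leq_maxl _ _) h.
exact: hist_le (leq_maxr _ _) h.
Qed.

(** The address serves all inputs at once: register lists only grow at the end, and their lengths do
    not depend on the input. *)
Definition stored (a : nat) (f : input R -> R) : Prop :=
  exists P, forall B p, (P <= p)%N -> (regs B p)`_a = f B.

Lemma stored_const (q : rat) : exists a, stored a (fun=> ratr q).
Proof.
have [p _ sp] := schedule_io (inr (inl q)) 0.
pose T0 : input R := (id, fun _ _ => 0%N).
exists (size (regs T0 p)), p.+1 => B p' pp'.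
rewrite (size_regs params B T0) -[size _]addn0 regs_nth//; by rewrite sp.
Qed.

Lemma stored_entry i j : exists a,
  stored a (fun B => Re (eval_at (EntryEv i j) B)) /\
  stored a.+1 (fun B => Im (eval_at (EntryEv i j) B)).
Proof.
have [p _ sp] := schedule_io (inl (inl (i, j))) 0.
pose T0 : input R := (id, fun _ _ => 0%N).
exists (size (regs T0 p)); split; exists p.+1 => B p' pp'.
  by rewrite (size_regs params B T0) -[size _]addn0 regs_nth//; rewrite sp.
by rewrite (size_regs params B T0) -addn1 regs_nth//; rewrite sp.
Qed.

Lemma near_compare T a b f g : stored a f -> stored b g ->
  \forall B \near hist_nbhs T, (f B <= g B) = (f T <= g T).
Proof.
move=> [P fP] [P' gP].
have [p pP sp] := schedule_io (inr (inr (a, b))) (maxn P P').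
have [p1 p2] : (P <= p)%N /\ (P' <= p)%N by apply/andP; rewrite -geq_max.
exists p.+1 => // B /= /(hist_obs (ltnSn p)); rewrite sp /= !fP// !gP//.
by do 2 case: (_ <= _).
Qed.

(** The history records the comparisons of f with two rationals that bracket f T within e. *)
Lemma near_stored T a f (e : R) : stored a f -> 0 < e ->
  \forall B \near hist_nbhs T, `|f B - f T| <= e.
Proof.
move=> fa e0.
have [|q] := @rat_in_itvoo R (f T - e) (f T); first by lra.
rewrite in_itv /= => /andP[q1 q2].
have [|q'] := @rat_in_itvoo R (f T) (f T + e); first by lra.
rewrite in_itv /= => /andP[q'1 q'2].
have [b bq] := stored_const q; have [b' bq'] := stored_const q'.
have h1 := near_compare T bq fa; have h2 := near_compare T fa bq'.
near=> B.
have : ratr q <= f B by rewrite (near h1 B)// ltW.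
have : f B <= ratr q' by rewrite (near h2 B)// ltW.
by move=> ? ?; rewrite ler_norml; apply/andP; split; lra.
Unshelve. all: by end_near. Qed.

Lemma near_entry_hist T i j (e : R) : 0 < e ->
  \forall B \near hist_nbhs T,
    normc (eval_at (EntryEv i j) B - eval_at (EntryEv i j) T) <= e.
Proof.
move=> e0; have e2 : 0 < e / 2 by rewrite divr_gt0.
have [a [aR aI]] := stored_entry i j.
have h1 := near_stored T aR e2; have h2 := near_stored T aI e2.
near=> B.
rewrite (le_trans (normc_le_ReIm _))// ReD ImD ReN ImN [leRHS]splitr lerD//.
  exact: (near h1 B).
exact: (near h2 B).
Unshelve. all: by end_near. Qed.

Lemma near_gval_hist T j n : \forall B \near hist_nbhs T, B.2 j n = T.2 j n.
Proof.
have [p _ sp] := schedule_io (inl (inr (j, n))) 0.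
by exists p.+1 => // B /= /(hist_obs (ltnSn p)); rewrite sp.
Qed.

Lemma near_info_close T M : \forall B \near hist_nbhs T, info_close M T B.
Proof.
have M0 : 0 < M.+1%:R^-1 :> R by rewrite invr_gt0.
near=> B.
have h1 : forall i j : 'I_M,
    normc (eval_at (EntryEv i j) B - eval_at (EntryEv i j) T) <= M.+1%:R^-1.
  near: B; apply: filter_forall => i; apply: filter_forall => j.
  exact: near_entry_hist.
have h2 : forall i j : 'I_M, B.2 i j = T.2 i j.
  near: B; apply: filter_forall => i; apply: filter_forall => j.
  exact: near_gval_hist.
split=> [i j iM jM|i j iM jM]; first exact: (h1 (Ordinal iM) (Ordinal jM)).
exact: (h2 (Ordinal iM) (Ordinal jM)).
Unshelve. all: by end_near. Qed.

Lemma rat_point_output (lq : 'I_k -> rat * rat) (qq : 'I_k -> seq (rat * rat)) :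
  exists z, \forall p \near \oo, forall B, output (regs B p) z.1 z.2 = rat_point R lq qq.
Proof.
have /choice[pos posP] := stored_const.
pose pos2 (x : rat * rat) := (pos x.1, pos x.2).
have ev q : \forall p \near \oo, forall B, (regs B p)`_(pos q) = ratr q.
  by have [P h] := posP q; exists P => // p /= Pp B; exact: h.
have ev2 x : \forall p \near \oo, forall B, creg (regs B p) (pos2 x) = ratc R x.
  near=> p => B; rewrite /creg /ratc /=; congr (_ +i* _).
    by move: B; near: p; exact: ev.
  by move: B; near: p; exact: ev.
exists (fun j => pos2 (lq j), fun j => map pos2 (qq j)).
near=> p.
have h1 : forall j, forall B, creg (regs B p) (pos2 (lq j)) = ratc R (lq j).
  by near: p; apply: filter_forall => j; exact: ev2.
have h2 : forall j, forall i : 'I_(size (qq j)), forall B,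
    creg (regs B p) (pos2 (nth (0, 0) (qq j) i)) = ratc R (nth (0, 0) (qq j) i).
  near: p; apply: filter_forall => j; apply: filter_forall => i; exact: ev2.
move=> B; rewrite /output /rat_point /=; congr (_, _); apply/funext => j; first exact: h1.
rewrite size_map; apply: eq_bigr => i _; congr (_ *: _).
by rewrite (nth_map (0, 0))// h2.
Unshelve. all: by end_near. Qed.

(** Half of the tolerance pays for the rational approximation of y, half for the stability
    estimate. *)
Lemma stable_Delta1 (Xi : input R -> set (Mspace R k)) (Om : set (input R)) :
  (forall T (e : R), Om T -> 0 < e -> exists y : Mspace R k,
     \forall B \near info_nbhs Om T, exists2 y', Xi B y' & distM y y' <= e) ->
  Delta1 params Xi Om.
Proof.
move=> stable; exists (fun n => Gamma params Xi Om (2 ^- n)) => n.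
apply: control_radical => T OT.
have e0 : 0 < 2 ^- n / 2 :> R by rewrite divr_gt0// invr_gt0 exprn_gt0.
have [y [M _ yM]] := stable T _ OT e0.
have [lq [qq qy]] := rat_point_dense y e0.
have [z [P _ zP]] := rat_point_output lq qq.
have [p _ pM] := near_info_close T M.
(* By time P the rational point is in the registers, and by time p the history forces
   [info_close M]. *)
exists (maxn P p); have := resultP params Xi Om (2 ^- n) (hist T (maxn P p)).
case: (result _ _ _ _ _) => // /(_ z)[] B OB; rewrite size_hist => hB.
rewrite zP /=; last exact: leq_maxl.
have cB : info_close M T B by apply: pM; exact: hist_le (leq_maxr _ _) hB.
have [y' Xy' yy'] := yM B (conj OB cB).
apply: ereal_inf_le; exists (distM (rat_point R lq qq) y')%:E; first by exists y'.
rewrite lee_fin (le_trans (distM_triangle _ y _))// [leRHS]splitr.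
exact: lerD.
Qed.

End Information.

Theorem theorem5p3 (R : realType) (k : nat) (t L : R)
  (hk : (0 < k)%N) (ht0 : 0 < t) (ht1 : t < 1) (hL : 0 < L) :
  Delta1 [:: t; L] (@Xi1 R k) (Omega k t L).
Proof. by apply: stable_Delta1 => T e; exact: Omega_stable. Qed.
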